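(* Let $(\alpha,\gamma)$ be a twisted action of a finite group $W$ on a commutative $C^*$-algebra $C_0(X)$ ($X$ a locally compact Hausdorff space), and let $E$ be a Hilbert $C_0(X)$-module equipped with an $(\alpha,\gamma)$-twisted action $U$ of $W$, satisfying the completeness condition. Then the closed linear span $C(X,E,W)\subseteq C_0(X)\rtimes_\gamma W$ of the inner products $\langle\langle \xi\mid\eta\rangle\rangle$ ($\xi,\eta\in E$) is the ideal $$C(X,E,W)=\Big\{\sum_{w\in W}b_w w\in C_0(X)\rtimes_\gamma W\ \Big|\ b_{w'w}(x)=\iota_{w',x}\,\gamma_x(w',w)\,b_w(x)\ \text{ for all } x\in X,\ w'\in W'_x,\ w\in W\Big\},$$ and the module $E$ implements a Morita equivalence between the fixed-point algebra $\mathrm{K}_{C_0(X)}(E)^W$ and this ideal $C(X,E,W)$ of the twisted crossed product $C_0(X)\rtimes_\gamma W$.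
   Context: Twisted actions. $X$ is a locally compact Hausdorff space with an action of the finite group $W$ by homeomorphisms, and $(\alpha_w b)(x)=b(w^{-1}x)$ for functions $b$ on $X$. $\gamma:W\times W\to C(X,\mathbb T)$ is a map with $\alpha_u(\gamma(v,w))\gamma(u,vw)=\gamma(u,v)\gamma(uv,w)$ and $\gamma(1,w)=\gamma(w,1)=1$ for all $u,v,w\in W$; write $\gamma_x(v,w)=\gamma(v,w)(x)$. Such a pair $(\alpha,\gamma)$ is a twisted action of $W$ on $C_0(X)$. The twisted crossed product $C_0(X)\rtimes_\gamma W$ is the $C^*$-algebra of formal sums $\sum_{w\in W} b_w w$ ($b_w\in C_0(X)$) with $b_1w_1\cdot b_2w_2=b_1\alpha_{w_1}(b_2)\gamma(w_1,w_2)w_1w_2$ and $(bw)^*=\overline{\gamma(w^{-1},w)}\,\alpha_{w^{-1}}(b^* )w^{-1}$ (with its unique $C^*$-norm). Twisted actions on modules. $E$ is a right Hilbert $C_0(X)$-module with inner product $\langle\ \mid\ \rangle$. An $(\alpha,\gamma)$-twisted action of $W$ on $E$ is a map $U$ from $W$ to the invertible linear operators on $E$ with $U_w(\xi b)=U_w(\xi)\alpha_w(b)$, $\langle U_w\xi\mid U_w\eta\rangle=\alpha_w\langle\xi\mid\eta\rangle$ and $U_vU_w(\xi)=U_{vw}(\xi)\gamma(v,w)^*$. Then $E$ is a right Hilbert $C_0(X)\rtimes_\gamma W$-module via $\xi\cdot bw=U_w^{-1}(\xi b)$ and $\langle\langle\xi\mid\eta\rangle\rangle=\sum_{w\in W}\langle\xi\mid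 U_w\eta\rangle w$. $\mathrm K_{C_0(X)}(E)$ is the $C^*$-algebra of compact operators on $E$ (the norm closure of the span of the operators $\zeta\mapsto\xi\langle\eta\mid\zeta\rangle$), and $\mathrm K_{C_0(X)}(E)^W=\{k: U_wk=kU_w\ \forall w\in W\}$. ''$E$ implements a Morita equivalence'' means: with the left action of $\mathrm K_{C_0(X)}(E)^W$ and the right module structure and inner product just described, $E$ is an imprimitivity bimodule. Local data. For $x\in X$, $E_x=E\otimes_{C_0(X)}\mathbb C_x$ is the fibre Hilbert space, where $\mathbb C_x=\mathbb C$ with $b$ acting by $b(x)$, and $\xi(x)=\xi\otimes1\in E_x$. The unitaries $I_{w,x}:E_x\to E_{wx}$ are defined by $I_{w,x}(\xi(x))=(U_w\xi)(wx)$. $W_x$ is the stabiliser of $x$. For a $\mathbb T$-valued 2-cocycle $\eta$ on a finite group, a unitary $\eta$-representation is a map $\pi$ to unitaries with $\pi(g_1)\pi(g_2)=\eta(g_1,g_2)\pi(g_1g_2)$. The map $I_x:w\mapsto I_{w,x}$ is a unitary $\overline{\gamma_x}$-representation of $W_x$ on $E_x$. Its contragredient is the $\gamma_x$-representation $w\mapsto\overline{I_{w,x}}$ on the complex conjugate Hilbert space $\overline{E_x}$, where $\overline{I_{w,x}}\,\overline h=\overline{I_{w,x}h}$. $W'_x=\{w\in W_x: I_{w,x}\text{ is a scalar operator on }E_x\}$ and, for $w\in W'_x$, $\iota_{w,x}\in\mathbb T$ is the scalar with $I_{w,x}=\iota_{w,x}\,\mathrm{id}_{E_x}$ (so it is understood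 that $E_x\ne0$). An irreducible unitary $\gamma_x$-representation $\pi$ of $W_x$ lies over $\overline{\iota_x}$ if $\pi(w')=\overline{\iota_{w',x}}\,\mathrm{id}$ for all $w'\in W'_x$. Completeness condition: for each $x\in X$, every irreducible unitary $\gamma_x$-representation of $W_x$ that lies over $\overline{\iota_x}$ appears in the contragredient of $I_x$. *)

(* Defs.v *)
From HB Require Import structures.
From mathcomp Require Import all_boot all_order all_algebra all_fingroup.
From mathcomp Require Import generic_quotient ring_quotient complex.
From mathcomp Require Import all_classical all_reals all_analysis.
From mathcomp Require Import ring lra.

Set Implicit Arguments.
Unset Strict Implicit.
Unset Printing Implicit Defensive.

Import Order.TTheory GRing.Theory Num.Theory numFieldNormedType.Exports.

Local Open Scope classical_set_scope.
Local Open Scope ring_scope.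

Section FunctionAlgebras.
Variables (R : realType) (X : topologicalType).
Implicit Types f g : X -> R[i]^o.

Definition vanishing_at_infinity f : Prop :=
  forall e : R[i], 0 < e ->
    exists2 K : set X, compact K & forall x, ~ K x -> `|f x| < e.

Definition C0_pred : {pred X -> R[i]^o} :=
  fun f => `[< continuous f /\ vanishing_at_infinity f >].

Record C0 := MkC0 { C0_fun :> X -> R[i]^o; C0_funP : C0_fun \in C0_pred }.

HB.instance Definition _ := [isSub for C0_fun].
HB.instance Definition _ := [Choice of C0 by <:].

Lemma C0_submod_closed : submod_closed C0_pred.
Proof.
split.
  apply/asboolP; split; first by move=> x; exact: cvg_cst.
  move=> e e0; exists set0; first exact: compact0.
  by move=> x _; rewrite normr0.
move=> a f g /asboolP[cf vf] /asboolP[cg vg]; apply/asboolP; split.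
  move=> x; apply: continuousD; last exact: cg.
  by apply: continuousM; [exact: cvg_cst | exact: cf].
move=> e e0.
have d0 : 0 < e / 2 / (`|a| + 1) by rewrite !divr_gt0// ltr_wpDl.
have [K cK hK] := vf _ d0; have [L cL hL] := vg (e / 2) ltac:(by rewrite divr_gt0).
exists (K `|` L); first exact: compactU.
move=> x /not_orP[/hK hx /hL hy]; rewrite [e](splitr e).
apply: le_lt_trans (ler_normD _ _) _; apply: ler_ltD => //.
have -> : (a *: f) x = a * f x by [].
rewrite normrM; apply: (@le_trans _ _ ((`|a| + 1) * `|f x|)).
  by rewrite ler_wpM2r// lerDl.
by rewrite mulrC -ler_pdivlMr ?ltr_wpDl// ltW.
Qed.

HB.instance Definition _ :=
  GRing.isSubmodClosed.Build R[i] (X -> R[i]^o) C0_pred C0_submod_closed.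
HB.instance Definition _ := [SubChoice_isSubLmodule of C0 by <:].

Lemma C0_ext (f g : C0) : (forall x, f x = g x) -> f = g.
Proof. by move=> fg; apply/val_inj/funext. Qed.

Lemma C0_mul_subproof (f g : C0) : (fun x => f x * g x) \in C0_pred.
Proof.
case: f g => f /asboolP[cf vf] [g /asboolP[cg vg]] /=; apply/asboolP; split.
  by move=> x; apply: continuousM; [exact: cf | exact: cg].
move=> e e0; have [K cK hK] := vf _ (@ltr01 _); have [L cL hL] := vg _ e0.
exists (K `|` L); first exact: compactU.
move=> x /not_orP[/hK hx /hL hy]; rewrite normrM -[e]mul1r.
exact: ltr_pM.
Qed.
Definition C0_mul (f g : C0) : C0 := MkC0 (C0_mul_subproof f g).

Lemma C0_conj_subproof (f : C0) : (fun x => (f x : R[i])^* : R[i]^o) \in C0_pred.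
Proof.
case: f => f /asboolP[cf vf] /=; apply/asboolP; split.
  move=> x; apply/cvgrPdist_lt => e e0; near=> t.
  rewrite -rmorphB norm_conjC.
  by near: t; move/cvgrPdist_lt: (cf x); exact.
move=> e /vf[K cK hK]; exists K => // x /hK; by rewrite norm_conjC.
Unshelve. all: by end_near. Qed.
Definition C0_conj (f : C0) : C0 := MkC0 (C0_conj_subproof f).

(* The supremum of the empty set is 0, which is the right value for empty [X]. *)
Definition C0_norm (f : C0) : R := sup (range (fun x => complex.Re `|f x|)).

(* Elements of [C(X, T)], [T] the unit circle. *)
Record unitary_fun := UnitaryFun {
  uf_fun :> X -> R[i]^o;
  uf_continuous : continuous uf_fun;
  uf_norm : forall x, `|uf_fun x| = 1 }.

Lemma unitary_conj_continuous (u : unitary_fun) :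
  continuous (fun x => (u x : R[i])^* : R[i]^o).
Proof.
have cu := @uf_continuous u.
move=> x; apply/cvgrPdist_lt => e e0; near=> t.
rewrite -rmorphB norm_conjC.
by near: t; move/cvgrPdist_lt: (cu x); exact.
Unshelve. all: by end_near. Qed.

Lemma unitary_conj_norm (u : unitary_fun) x : `|(u x : R[i])^*| = 1.
Proof. by rewrite norm_conjC uf_norm. Qed.

Definition unitary_conj (u : unitary_fun) :=
  UnitaryFun (@unitary_conj_continuous u) (unitary_conj_norm u).

Lemma C0_umul_subproof (u : unitary_fun) (f : C0) :
  (fun x => u x * f x) \in C0_pred.
Proof.
case: f => f /asboolP[cf vf] /=; apply/asboolP; split.
  by move=> x; apply: continuousM; [exact: (@uf_continuous u) | exact: cf].
by move=> e /vf[K cK hK]; exists K => // x /hK; rewrite normrM uf_norm mul1r.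
Qed.
Definition C0_umul (u : unitary_fun) (f : C0) : C0 := MkC0 (C0_umul_subproof u f).
End FunctionAlgebras.

Section NormedStarAlgebras.
Variable R : realType.
Local Notation C := R[i].

Section Subspaces.
Variables (V : lmodType C) (N : V -> R).

Definition lin_subspace (S : set V) : Prop :=
  S 0 /\ forall (a : C) u v, S u -> S v -> S (a *: u + v).

Definition lin_span (S : set V) : set V :=
  [set v | exists n (a : 'I_n -> C) (s : 'I_n -> V),
    (forall i, S (s i)) /\ v = \sum_i a i *: s i].

Definition norm_closure (S : set V) : set V :=
  [set v | forall e : R, 0 < e -> exists2 s, S s & N (v - s) < e].

Definition norm_complete (S : set V) : Prop :=
  forall u : nat -> V, (forall n, S (u n)) ->
    (forall e : R, 0 < e -> exists n0, forall m n,
       (n0 <= m)%N -> (n0 <= n)%N -> N (u m - u n) < e) ->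
    exists2 l, S l & forall e : R, 0 < e -> exists n0, forall n,
       (n0 <= n)%N -> N (u n - l) < e.

End Subspaces.

(* A C*-algebra is given by a subset [S] of the carrier of such data. The data are
   only required to behave well on [S], so that C*-subalgebras are subsets of one
   ambient type, and [cstar_norm_on] includes completeness of [S]. *)
Record normedStarData := NormedStarData {
  nsd_sort :> lmodType C;
  nsd_mul : nsd_sort -> nsd_sort -> nsd_sort;
  nsd_star : nsd_sort -> nsd_sort;
  nsd_norm : nsd_sort -> R }.

Section CstarAlgebras.
Variables (A : normedStarData) (S : set A).
Local Notation "a ** b" := (nsd_mul a b) (at level 40, left associativity).
Local Notation star := (@nsd_star A).
Local Notation N := (@nsd_norm A).

Record star_algebra_on : Prop := StarAlgebraOn {
  sa_subspace : lin_subspace S;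
  sa_mul_in : forall a b, S a -> S b -> S (a ** b);
  sa_star_in : forall a, S a -> S (star a);
  sa_mulA : forall a b c, S a -> S b -> S c -> a ** (b ** c) = a ** b ** c;
  sa_mull : forall (z : C) a b c, S a -> S b -> S c ->
    (z *: a + b) ** c = z *: (a ** c) + b ** c;
  sa_mulr : forall (z : C) a b c, S a -> S b -> S c ->
    c ** (z *: a + b) = z *: (c ** a) + c ** b;
  sa_star_semilinear : forall (z : C) a b, S a -> S b ->
    star (z *: a + b) = z^* *: star a + star b;
  sa_starK : forall a, S a -> star (star a) = a;
  sa_starM : forall a b, S a -> S b -> star (a ** b) = star b ** star a }.

Record cstar_norm_on : Prop := CstarNormOn {
  cn_ge0 : forall a, S a -> 0 <= N a;
  cn_eq0 : forall a, S a -> N a = 0 -> a = 0;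
  cn_scale : forall (z : C) a, S a -> N (z *: a) = complex.Re `|z| * N a;
  cn_triangle : forall a b, S a -> S b -> N (a + b) <= N a + N b;
  cn_submult : forall a b, S a -> S b -> N (a ** b) <= N a * N b;
  cn_cstar : forall a, S a -> N (star a ** a) = N a ^+ 2;
  cn_complete : norm_complete N S }.

Definition cstar_algebra_on : Prop := star_algebra_on /\ cstar_norm_on.

(* Positivity in the C*-algebra [S]. *)
Definition positive_in (a : A) : Prop := exists2 b, S b & a = star b ** b.

Definition closed_ideal (I : set A) : Prop :=
  [/\ lin_subspace I, I `<=` S, norm_closure N I `&` S `<=` I &
      forall a b, S a -> I b -> I (a ** b) /\ I (b ** a)].

Section HilbertModules.
Variable E : lmodType C.

(* Inner products of right modules are linear in the second variable, those of
   left modules in the first one. *)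
Record right_hilbert_module (ract : E -> A -> E) (ip : E -> E -> A) : Prop :=
  RightHilbertModule {
  rhm_actl : forall (z : C) x y a, S a ->
    ract (z *: x + y) a = z *: ract x a + ract y a;
  rhm_actr : forall (z : C) x a b, S a -> S b ->
    ract x (z *: a + b) = z *: ract x a + ract x b;
  rhm_actM : forall x a b, S a -> S b -> ract x (a ** b) = ract (ract x a) b;
  rhm_ip_in : forall x y, S (ip x y);
  rhm_ip_linear : forall (z : C) x y y', ip x (z *: y + y') = z *: ip x y + ip x y';
  rhm_ip_act : forall x y a, S a -> ip x (ract y a) = ip x y ** a;
  rhm_ip_star : forall x y, star (ip x y) = ip y x;
  rhm_ip_pos : forall x, positive_in (ip x x);
  rhm_ip_def : forall x, ip x x = 0 -> x = 0;
  rhm_complete : norm_complete (fun x => Num.sqrt (N (ip x x))) setT }.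

Record left_hilbert_module (lact : A -> E -> E) (ip : E -> E -> A) : Prop :=
  LeftHilbertModule {
  lhm_actr : forall (z : C) x y a, S a ->
    lact a (z *: x + y) = z *: lact a x + lact a y;
  lhm_actl : forall (z : C) x a b, S a -> S b ->
    lact (z *: a + b) x = z *: lact a x + lact b x;
  lhm_actM : forall x a b, S a -> S b -> lact (a ** b) x = lact a (lact b x);
  lhm_ip_in : forall x y, S (ip x y);
  lhm_ip_linear : forall (z : C) x x' y, ip (z *: x + x') y = z *: ip x y + ip x' y;
  lhm_ip_act : forall x y a, S a -> ip (lact a x) y = a ** ip x y;
  lhm_ip_star : forall x y, star (ip x y) = ip y x;
  lhm_ip_pos : forall x, positive_in (ip x x);
  lhm_ip_def : forall x, ip x x = 0 -> x = 0;
  lhm_complete : norm_complete (fun x => Num.sqrt (N (ip x x))) setT }.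

Definition ip_range (ip : E -> E -> A) : set A := [set a | exists x y, a = ip x y].

Definition full (ip : E -> E -> A) : Prop :=
  S `<=` norm_closure N (lin_span (ip_range ip)).

End HilbertModules.
End CstarAlgebras.

Section Imprimitivity.
Variables (A B : normedStarData) (SA : set A) (SB : set B) (E : lmodType C).
Variables (lact : A -> E -> E) (ract : E -> B -> E).
Variables (lip : E -> E -> A) (rip : E -> E -> B).

Record imprimitivity_bimodule : Prop := ImprimitivityBimodule {
  ib_cstarl : cstar_algebra_on SA;
  ib_cstarr : cstar_algebra_on SB;
  ib_left : left_hilbert_module SA lact lip;
  ib_right : right_hilbert_module SB ract rip;
  ib_fulll : full SA lip;
  ib_fullr : full SB rip;
  ib_bimodule : forall a x b, SA a -> SB b ->
    ract (lact a x) b = lact a (ract x b);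
  ib_adjl : forall a x y, SA a -> rip (lact a x) y = rip x (lact (nsd_star a) y);
  ib_adjr : forall b x y, SB b -> lip (ract x b) y = lip x (ract y (nsd_star b));
  ib_assoc : forall x y z, lact (lip x y) z = ract x (rip y z) }.

End Imprimitivity.

Record hilbertSpace := HilbertSpace {
  hs_sort :> lmodType C;
  hs_ip : hs_sort -> hs_sort -> C;
  hs_ip_linear : forall (z : C) h k k',
    hs_ip h (z *: k + k') = z * hs_ip h k + hs_ip h k';
  hs_ip_conj : forall h k, (hs_ip h k)^* = hs_ip k h;
  hs_ip_ge0 : forall h, 0 <= hs_ip h h;
  hs_ip_def : forall h, hs_ip h h = 0 -> h = 0;
  hs_complete : norm_complete (fun h => Num.sqrt (complex.Re (hs_ip h h))) setT }.

Definition hs_norm (H : hilbertSpace) (h : H) : R :=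
  Num.sqrt (complex.Re (hs_ip h h)).

End NormedStarAlgebras.

Section ConjugateSpace.
Variable R : realType.
Local Notation C := R[i].

(* [V] with scalar multiplication by the complex conjugate. *)
Definition conj_space (V : Type) : Type := V.

Section Lmodule.
Variable V : lmodType C.
HB.instance Definition _ := GRing.Zmodule.on (conj_space V).

Definition conj_scale (z : C) (v : conj_space V) : conj_space V :=
  (z^* *: (v : V) : V).

Fact conj_scaleA a b v : conj_scale a (conj_scale b v) = conj_scale (a * b) v.
Proof. by rewrite /conj_scale scalerA rmorphM. Qed.
Fact conj_scale1 : left_id 1 conj_scale.
Proof. by move=> v; rewrite /conj_scale rmorph1 scale1r. Qed.
Fact conj_scaleDr : right_distributive conj_scale +%R.
Proof. by move=> a u v; rewrite /conj_scale scalerDr. Qed.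
Fact conj_scaleDl v : {morph conj_scale^~ v : a b / a + b}.
Proof. by move=> a b; rewrite /conj_scale rmorphD scalerDl. Qed.

HB.instance Definition _ := GRing.Zmodule_isLmodule.Build C (conj_space V)
  conj_scaleA conj_scale1 conj_scaleDr conj_scaleDl.
End Lmodule.

Variable H : hilbertSpace R.

Definition conj_ip (h k : conj_space H) : C := hs_ip (k : H) (h : H).

Fact conj_ip_linear (z : C) (h k k' : conj_space H) :
  conj_ip h (z *: k + k') = z * conj_ip h k + conj_ip h k'.
Proof.
have -> : conj_ip h (z *: k + k') = hs_ip (z^* *: (k : H) + k') (h : H) by [].
rewrite -hs_ip_conj hs_ip_linear rmorphD rmorphM /= !hs_ip_conj.
by congr (_ * _ + _); exact: conjCK.
Qed.
Fact conj_ip_conj (h k : conj_space H) : (conj_ip h k)^* = conj_ip k h.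
Proof. exact: hs_ip_conj. Qed.
Fact conj_ip_ge0 (h : conj_space H) : 0 <= conj_ip h h.
Proof. exact: hs_ip_ge0. Qed.
Fact conj_ip_def (h : conj_space H) : conj_ip h h = 0 -> h = 0.
Proof. exact: (@hs_ip_def R H h). Qed.
Fact conj_complete :
  norm_complete (fun h : conj_space H => Num.sqrt (complex.Re (conj_ip h h))) setT.
Proof. exact: (@hs_complete R H). Qed.

Definition conj_hilbert : hilbertSpace R := HilbertSpace conj_ip_linear
  conj_ip_conj conj_ip_ge0 conj_ip_def conj_complete.
End ConjugateSpace.

Definition C0_alg (R : realType) (X : topologicalType) : normedStarData R :=
  NormedStarData (@C0_mul R X) (@C0_conj R X) (@C0_norm R X).

Record hilbertModule (R : realType) (X : topologicalType) := HilbertModule {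
  hm_sort :> lmodType R[i];
  hm_act : hm_sort -> C0 R X -> hm_sort;
  hm_ip : hm_sort -> hm_sort -> C0 R X;
  hm_ax : @right_hilbert_module R (C0_alg R X) setT hm_sort hm_act hm_ip }.

Section SemiInnerProduct.
Variables (R : realType) (V : lmodType R[i]) (s : V -> V -> R[i]).
Hypothesis sl : forall (z : R[i]) h k k', s h (z *: k + k') = z * s h k + s h k'.
Hypothesis sc : forall h k, (s h k)^* = s k h.
Hypothesis s0 : forall h, 0 <= s h h.

Let sD h k k' : s h (k + k') = s h k + s h k'.
Proof. by have := sl 1 h k k'; rewrite scale1r mul1r. Qed.
Let sr0 h : s h 0 = 0.
Proof. by apply: (addrI (s h 0)); rewrite -sD !addr0. Qed.
Let sZ z h k : s h (z *: k) = z * s h k.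
Proof. by have := sl z h k 0; rewrite addr0 sr0 addr0. Qed.
Let sDl h h' k : s (h + h') k = s h k + s h' k.
Proof. by rewrite -sc sD rmorphD /= !sc. Qed.
Let sZl z h k : s (z *: h) k = z^* * s h k.
Proof. by rewrite -sc sZ rmorphM /= !sc. Qed.

Let sq z u v : s (v + z *: u) (v + z *: u) =
  s v v + z * s v u + z^* * s u v + z^* * z * s u u.
Proof. rewrite sD !sZ !sDl !sZl; ring. Qed.

Lemma semi_ip_CS u v : `|s u v| ^+ 2 <= s u u * s v v.
Proof.
have nb : `|s u v| ^+ 2 = s u v * s v u by rewrite normCK sc.
have ar w : (s w w)^* = s w w by rewrite sc.
have [a0|a0] := eqVneq (s u u) 0.
  rewrite a0 mul0r.
  have [->|b0] := eqVneq (s u v) 0; first by rewrite normr0 expr0n.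
  have b2 : 0 < `|s u v| ^+ 2 by rewrite exprn_gt0// normr_gt0.
  set t := (s v v + 1) / `|s u v| ^+ 2.
  have tr : t^* = t.
    by apply: CrealP; apply: ger0_real; rewrite divr_ge0 ?addr_ge0// ltW.
  have := s0 (v + (- t * s u v) *: u).
  rewrite sq a0 mulr0 addr0.
  have -> : (- t * s u v)^* = - t * s v u by rewrite rmorphM rmorphN /= tr sc.
  have -> : s v v + - t * s u v * s v u + - t * s v u * s u v =
            s v v - (t * `|s u v| ^+ 2) *+ 2 by rewrite nb; ring.
  rewrite /t mulfVK ?gt_eqF//.
  have -> : s v v - (s v v + 1) *+ 2 = - (s v v + 2) by ring.
  rewrite oppr_ge0 => h.
  have : 0 < s v v + 2 by rewrite ltr_wpDl.
  by move=> /lt_le_trans/(_ h); rewrite ltxx.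
have ap : 0 < s u u by rewrite lt_def a0 s0.
have := s0 (v + (- (s u v / s u u)) *: u).
rewrite sq rmorphN rmorphM fmorphV /= ar sc.
have -> : s v v + - (s u v / s u u) * s v u + - (s v u / s u u) * s u v +
  - (s v u / s u u) * - (s u v / s u u) * s u u =
  (s u u * s v v - s u v * s v u) / s u u by field.
by rewrite -nb pmulr_lge0 ?invr_gt0// subr_ge0.
Qed.

Lemma semi_ip_null u v : s u u = 0 -> s u v = 0.
Proof.
move=> u0; have := semi_ip_CS u v; rewrite u0 mul0r => h.
apply/eqP; rewrite -normr_eq0 -sqrf_eq0 eq_le h /=.
exact: exprn_ge0.
Qed.

Definition semi_norm (u : V) : R := Num.sqrt (complex.Re (s u u)).

Let sRe w : s w w = (complex.Re (s w w))%:C%C.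
Proof. by have := s0 w; case: (s w w) => a b /=; rewrite lecE /= => /andP[/eqP -> _]. Qed.
Let Re0 w : 0 <= complex.Re (s w w).
Proof. by have := s0 w; rewrite sRe lecR. Qed.

Lemma semi_normD u v : semi_norm (u + v) <= semi_norm u + semi_norm v.
Proof.
have ge u' : 0 <= semi_norm u' by exact: sqrtr_ge0.
rewrite /semi_norm -(@ler_pXn2r _ 2)// ?nnegrE ?sqrtr_ge0 ?addr_ge0 ?sqrtr_ge0//.
rewrite sqrrD !sqr_sqrtr//.
rewrite -sqrtrM//.
have : complex.Re (s u v) <= Num.sqrt (complex.Re (s u u) * complex.Re (s v v)).
  apply: (@le_trans _ _ `|complex.Re (s u v)|); first exact: ler_norm.
  rewrite -sqrtr_sqr ler_sqrt ?mulr_ge0//.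
  rewrite -real_normK ?num_real// -lecR rmorphXn rmorphM /= -!sRe.
  apply: le_trans (semi_ip_CS u v); apply: lerXn2r; rewrite ?nnegrE ?normr_ge0 ?ler0c ?normr_ge0//.
  exact: normc_ge_Re.
have -> : complex.Re (s (u + v) (u + v)) =
  complex.Re (s u u) + complex.Re (s u v) *+ 2 + complex.Re (s v v).
  rewrite sD !sDl -(sc u v); case: (s u u) => a a'; case: (s u v) => b b'.
  by case: (s v v) => c c' /=; ring.
lra.
Qed.

Lemma semi_normZ z u : semi_norm (z *: u) = complex.Re `|z| * semi_norm u.
Proof.
have zr : `|z| = (complex.Re `|z|)%:C%C by rewrite normc_def.
have z0 : 0 <= complex.Re `|z| by rewrite normc_def /= sqrtr_ge0.
rewrite /semi_norm sZ sZl mulrA -normCK zr -rmorphXn /=.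
case: (s u u) => a b /=; rewrite mul0r subr0 sqrtrM ?sqr_ge0//.
by rewrite sqrtr_sqr ger0_norm.
Qed.

Lemma semi_norm_sq u : ((semi_norm u ^+ 2)%:C)%C = s u u.
Proof. by rewrite /semi_norm sqr_sqrtr// -sRe. Qed.
End SemiInnerProduct.

Arguments C0_pred {R X}.

Section HilbertModuleNorm.
Variables (R : realType) (X : topologicalType).

Lemma C0_bounded (f : C0 R X) : exists M : R, forall x, complex.Re `|f x| <= M.
Proof.
case: f => f P /=; move: (P) => /asboolP[cf vf].
have [K cK hK] := vf _ (@ltr01 _).
have cg : continuous (fun x => complex.Re `|f x| : R^o).
  move=> x; apply/cvgrPdist_lt => e e0.
  have ec0 : 0 < e%:C%C by rewrite ltcR.
  near=> t; rewrite -raddfB -ltcR; apply: le_lt_trans (normc_ge_Re _) _.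
  apply: le_lt_trans (ler_dist_dist _ _) _.
  by near: t; move/cvgrPdist_lt: (cf x) => /(_ _ ec0).
have /compact_bounded[M [_ MP]] : compact ((fun x => complex.Re `|f x| : R^o) @` K).
  by apply: continuous_compact => //; exact: continuous_subspaceT.
have M1 : M < `|M| + 1 by rewrite (le_lt_trans (ler_norm _))// ltrDl.
exists (`|M| + 1) => x.
have [Kx|/hK fx] := pselect (K x).
  have : `|(complex.Re `|f x| : R^o)| <= `|M| + 1 by apply: (MP _ M1); exists x.
  by apply: le_trans; exact: ler_norm.
have : complex.Re `|f x| < 1 by rewrite -ltcR; move: fx; rewrite normc_def.
by move=> /ltW/le_trans; apply; rewrite lerDr.
Unshelve. all: by end_near. Qed.

Lemma C0_norm_ge (f : C0 R X) x : complex.Re `|f x| <= C0_norm f.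
Proof.
have [M hM] := C0_bounded f.
apply: ub_le_sup; last by exists x.
by exists M => _ [y _ <-].
Qed.

Lemma C0_norm_le (f : C0 R X) (M : R) : 0 <= M ->
  (forall x, complex.Re `|f x| <= M) -> C0_norm f <= M.
Proof.
move=> M0 hM; rewrite /C0_norm.
have [->|/set0P ne] := eqVneq (range (fun x => complex.Re `|f x|)) set0.
  by rewrite sup0.
by apply: ge_sup => // _ [y _ <-].
Qed.

Variable E : hilbertModule R X.

Definition hm_norm (xi : E) : R := Num.sqrt (C0_norm (hm_ip xi xi)).

Definition ip_at (y : X) (xi eta : E) : R[i] := hm_ip xi eta y.

Lemma ip_at_linear y (z : R[i]) h k k' :
  ip_at y h (z *: k + k') = z * ip_at y h k + ip_at y h k'.
Proof. by rewrite /ip_at (rhm_ip_linear (hm_ax E)). Qed.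
Lemma ip_at_conj y h k : (ip_at y h k)^* = ip_at y k h.
Proof. by rewrite /ip_at -(rhm_ip_star (hm_ax E) h k). Qed.
Lemma ip_at_ge0 y h : 0 <= ip_at y h h.
Proof.
rewrite /ip_at; have [b _ ->] := rhm_ip_pos (hm_ax E) h.
by rewrite /= mulrC mul_conjC_ge0.
Qed.
Lemma ip_at_act y h k b : ip_at y h (hm_act k b) = ip_at y h k * b y.
Proof. by rewrite /ip_at (rhm_ip_act (hm_ax E)). Qed.

Lemma ip_at0 y h : ip_at y h 0 = 0.
Proof.
have := ip_at_linear y 1 h 0 0; rewrite scale1r addr0 mul1r => e.
by apply: (addrI (ip_at y h 0)); rewrite addr0 -e.
Qed.
Lemma ip_atZ y z h k : ip_at y h (z *: k) = z * ip_at y h k.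
Proof. by have := ip_at_linear y z h k 0; rewrite addr0 ip_at0 addr0. Qed.
Lemma ip_at_null y h k : ip_at y h h = 0 -> ip_at y h k = 0.
Proof.
exact: (semi_ip_null (ip_at_linear y) (ip_at_conj y) (ip_at_ge0 y)).
Qed.

Definition snorm_at (y : X) : E -> R := semi_norm (ip_at y).

Lemma snorm_at_le y xi : snorm_at y xi <= hm_norm xi.
Proof.
rewrite /snorm_at /semi_norm /hm_norm; apply: ler_wsqrtr.
apply: le_trans (C0_norm_ge (hm_ip xi xi) y).
by rewrite -[hm_ip xi xi y]/(ip_at y xi xi) ger0_norm ?ip_at_ge0.
Qed.

Lemma hm_norm_le xi M : 0 <= M -> (forall y, snorm_at y xi <= M) -> hm_norm xi <= M.
Proof.
move=> M0 hM; rewrite /hm_norm -(ger0_norm M0) -sqrtr_sqr; apply: ler_wsqrtr.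
apply: C0_norm_le => [|y]; first exact: sqr_ge0.
have := hM y; rewrite -[hm_ip xi xi y]/(ip_at y xi xi) ger0_norm ?ip_at_ge0//.
rewrite /snorm_at /semi_norm => h.
have p0 : 0 <= complex.Re (ip_at y xi xi).
  by have := ip_at_ge0 y xi; rewrite lecE => /andP[].
by rewrite -(sqr_sqrtr p0); apply: lerXn2r; rewrite ?nnegrE ?sqrtr_ge0.
Qed.

Lemma hm_normD xi eta : hm_norm (xi + eta) <= hm_norm xi + hm_norm eta.
Proof.
apply: hm_norm_le => [|y]; first by rewrite addr_ge0// sqrtr_ge0.
apply: le_trans (lerD (snorm_at_le y xi) (snorm_at_le y eta)).
by apply: semi_normD; [exact: ip_at_linear | exact: ip_at_conj | exact: ip_at_ge0].
Qed.

Section Cutoff.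
Variables (x : X) (xi : E).
Hypothesis sx : 0 < ip_at x xi xi.

Let h (y : X) : R[i]^o := 2 * ip_at y xi xi / (ip_at y xi xi + ip_at x xi xi).

Let h_C0 : h \in C0_pred.
Proof.
have /asboolP[ca va] := C0_funP (hm_ip xi xi).
apply/asboolP; split.
  move=> y; rewrite /h; apply: continuousM.
    by apply: continuousM; [exact: cvg_cst | exact: ca].
  apply: continuousV; first by rewrite gt_eqF// ltr_wpDl// ip_at_ge0.
  by apply: continuousD; [exact: ca | exact: cvg_cst].
move=> e e0.
have d0 : 0 < e * ip_at x xi xi / 2 by rewrite divr_gt0// mulr_gt0.
have [K cK hK] := va _ d0; exists K => // y /hK.
rewrite -[hm_ip xi xi y]/(ip_at y xi xi) /h.
have a0 := ip_at_ge0 y xi.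
have p0 : 0 < ip_at y xi xi + ip_at x xi xi by rewrite ltr_wpDl.
rewrite ger0_norm// ger0_norm; last by rewrite divr_ge0 ?mulr_ge0// ltW.
rewrite ltr_pdivlMr// ltr_pdivrMr// [2 * _]mulrC => /lt_le_trans; apply.
by rewrite ler_pM2l// lerDr.
Qed.

Let hC : C0 R X := MkC0 h_C0.
Let xi' : E := 2 *: xi - hm_act xi hC.

Let ip_diff y (c : R[i]) :
  ip_at y (c *: xi - hm_act xi hC) (c *: xi - hm_act xi hC) =
  (c - h y)^* * (c - h y) * ip_at y xi xi.
Proof.
have r eta : ip_at y eta (c *: xi - hm_act xi hC) = (c - h y) * ip_at y eta xi.
  rewrite addrC -scaleN1r ip_at_linear ip_at_act mulN1r.
  rewrite ip_atZ.
  rewrite /=; ring.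
by rewrite r -ip_at_conj r rmorphM /= ip_at_conj; ring.
Qed.

Lemma lift_pos : exists2 eta : E, ip_at x (xi - eta) (xi - eta) = 0 &
  hm_norm eta <= snorm_at x xi.
Proof.
have hx : h x = 1.
  by rewrite /h; field; rewrite -mulr2n mulrn_eq0 /= gt_eqF.
exists (2 *: xi - hm_act xi hC).
  have -> : xi - (2 *: xi - hm_act xi hC) = (-1) *: ((1 : R[i]) *: xi - hm_act xi hC).
    rewrite scaleN1r !opprB scale1r addrCA; congr (_ + _).
    by rewrite scaler_nat mulr2n opprD addrA subrr add0r.
  have e0 : ip_at x (1 *: xi - hm_act xi hC) (1 *: xi - hm_act xi hC) = 0.
    by rewrite ip_diff hx subrr mulr0 mul0r.
  by rewrite ip_atZ -ip_at_conj ip_atZ (ip_at_null _ e0) mulr0 conjC0 mulr0.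
apply: hm_norm_le => [|y]; first exact: sqrtr_ge0.
rewrite /snorm_at /semi_norm; apply: ler_wsqrtr; rewrite ip_diff.
have a0 := ip_at_ge0 y xi.
have p0 : 0 < ip_at y xi xi + ip_at x xi xi by rewrite ltr_wpDl.
suff : (2 - h y)^* * (2 - h y) * ip_at y xi xi <= ip_at x xi xi.
  by rewrite lecE => /andP[].
have -> : 2 - h y = 2 * ip_at x xi xi / (ip_at y xi xi + ip_at x xi xi).
  by rewrite /h; field; rewrite gt_eqF.
have -> : (2 * ip_at x xi xi / (ip_at y xi xi + ip_at x xi xi))^* =
    2 * ip_at x xi xi / (ip_at y xi xi + ip_at x xi xi).
  apply: CrealP; apply: ger0_real.
  by rewrite divr_ge0 ?mulr_ge0// ltW.
rewrite -subr_ge0.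
have -> : ip_at x xi xi - 2 * ip_at x xi xi / (ip_at y xi xi + ip_at x xi xi) *
    (2 * ip_at x xi xi / (ip_at y xi xi + ip_at x xi xi)) * ip_at y xi xi =
    ip_at x xi xi * (ip_at y xi xi - ip_at x xi xi) ^+ 2 /
    (ip_at y xi xi + ip_at x xi xi) ^+ 2.
  by field; rewrite gt_eqF.
rewrite divr_ge0//; last by rewrite exprn_ge0// ltW.
by rewrite mulr_ge0 ?(ltW sx)// real_exprn_even_ge0// realB// ger0_real// ltW.
Qed.
End Cutoff.

Lemma ip_at_null_lift x xi : exists2 eta : E, ip_at x (xi - eta) (xi - eta) = 0 &
  hm_norm eta <= snorm_at x xi.
Proof.
have [/eqP s0|] := boolP (ip_at x xi xi == 0); last first.
  by move=> s0; apply: lift_pos; rewrite lt_def s0 ip_at_ge0.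
exists 0; first by rewrite subr0.
apply: hm_norm_le => [|y]; first exact: sqrtr_ge0.
by rewrite /snorm_at /semi_norm ip_at0 sqrtr0 sqrtr_ge0.
Qed.
End HilbertModuleNorm.

(* The fibre [E_x] is the interior tensor product of [E] with [C_x]: the completion
   of the quotient of [E] by the vectors of length zero for the semi-inner product
   [<xi|eta>(x)]. Taking the completion adds nothing, see [fibre_complete]. *)
Section Fibre.
Local Open Scope quotient_scope.
Variables (R : realType) (X : topologicalType) (E : hilbertModule R X) (x : X).
Local Notation C := R[i].

Definition fibre_null : {pred E} := fun xi => `[< hm_ip xi xi x = 0 >].

Lemma fibre_null_submod : submod_closed fibre_null.
Proof.
split; first by apply/asboolP; exact: ip_at0.
move=> z u v /asboolP u0 /asboolP v0; apply/asboolP.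
rewrite -[LHS]/(ip_at x (z *: u + v) (z *: u + v)) ip_at_linear.
rewrite -ip_at_conj (ip_at_null _ u0) -(ip_at_conj _ v) (ip_at_null _ v0).
by rewrite conjC0 mulr0 add0r.
Qed.

HB.instance Definition _ :=
  GRing.isSubmodClosed.Build C E fibre_null fibre_null_submod.

Definition fibre_space : Type := Quotient.quot fibre_null.
HB.instance Definition _ := EqQuotient.on fibre_space.
HB.instance Definition _ := Choice.on fibre_space.
HB.instance Definition _ := ZmodQuotient.on fibre_space.

Definition fibre_class (xi : E) : fibre_space := \pi_fibre_space xi.

Lemma fibre_classP xi eta :
  fibre_class xi = fibre_class eta <-> hm_ip (xi - eta) (xi - eta) x = 0.
Proof.
rewrite /fibre_class; split.
  by move/eqP; rewrite -Quotient.idealrBE => /asboolP.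
by move=> h; apply/eqP; rewrite -Quotient.idealrBE; apply/asboolP.
Qed.
Lemma fibre_class_repr h : fibre_class (repr h) = h.
Proof. exact: reprK. Qed.
Lemma fibre_classD : {morph fibre_class : xi eta / xi + eta}.
Proof. exact: (raddfD \pi_fibre_space). Qed.
Lemma fibre_classB : {morph fibre_class : xi eta / xi - eta}.
Proof. exact: (raddfB \pi_fibre_space). Qed.

Definition fibre_scale (z : C) (h : fibre_space) : fibre_space :=
  fibre_class (z *: repr h).

Lemma fibre_classZ z xi : fibre_class (z *: xi) = fibre_scale z (fibre_class xi).
Proof.
apply/fibre_classP; rewrite -[LHS]/(ip_at x _ _) -scalerBr ip_atZ.
rewrite -ip_at_conj ip_atZ (_ : ip_at x _ _ = 0) ?(mulr0, conjC0)//.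
by apply/fibre_classP; rewrite fibre_class_repr.
Qed.

Fact fibre_scaleA a b v : fibre_scale a (fibre_scale b v) = fibre_scale (a * b) v.
Proof. by rewrite -[v]fibre_class_repr -!fibre_classZ scalerA. Qed.
Fact fibre_scale1 : left_id 1 fibre_scale.
Proof. by move=> v; rewrite -[v]fibre_class_repr -fibre_classZ scale1r. Qed.
Fact fibre_scaleDr : right_distributive fibre_scale +%R.
Proof.
move=> a u v; rewrite -[u]fibre_class_repr -[v]fibre_class_repr.
by rewrite -fibre_classD -!fibre_classZ -fibre_classD scalerDr.
Qed.
Fact fibre_scaleDl v : {morph fibre_scale^~ v : a b / a + b}.
Proof.
by move=> a b; rewrite -[v]fibre_class_repr -!fibre_classZ -fibre_classD scalerDl.
Qed.

HB.instance Definition _ := GRing.Zmodule_isLmodule.Build C fibre_space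
  fibre_scaleA fibre_scale1 fibre_scaleDr fibre_scaleDl.

Definition fibre_ip (h k : fibre_space) : C := hm_ip (repr h) (repr k) x.

Lemma fibre_ipE xi eta : fibre_ip (fibre_class xi) (fibre_class eta) = hm_ip xi eta x.
Proof.
have c (u v w : E) : ip_at x (v - w) (v - w) = 0 -> ip_at x u v = ip_at x u w.
  move=> h0; have -> : v = 1 *: (v - w) + w by rewrite scale1r subrK.
  by rewrite ip_at_linear -ip_at_conj (ip_at_null _ h0) conjC0 mulr0 add0r.
have r u : ip_at x (repr (fibre_class u) - u) (repr (fibre_class u) - u) = 0.
  by apply/fibre_classP; rewrite fibre_class_repr.
rewrite /fibre_ip -[LHS]/(ip_at x _ _) (c _ _ _ (r eta)).
by rewrite -ip_at_conj (c _ _ _ (r xi)) ip_at_conj.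
Qed.

Fact fibre_ip_linear (z : C) h k k' :
  fibre_ip h (z *: k + k') = z * fibre_ip h k + fibre_ip h k'.
Proof.
rewrite -[h]fibre_class_repr -[k]fibre_class_repr -[k']fibre_class_repr.
have -> : z *: fibre_class (repr k) = fibre_class (z *: repr k).
  by rewrite fibre_classZ.
by rewrite -fibre_classD !fibre_ipE; exact: ip_at_linear.
Qed.
Fact fibre_ip_conj h k : (fibre_ip h k)^* = fibre_ip k h.
Proof. exact: ip_at_conj. Qed.
Fact fibre_ip_ge0 h : 0 <= fibre_ip h h.
Proof. exact: ip_at_ge0. Qed.
Fact fibre_ip_def h : fibre_ip h h = 0 -> h = 0.
Proof.
rewrite -[h]fibre_class_repr fibre_ipE => h0.
have -> : 0 = fibre_class 0 by rewrite /fibre_class (raddf0 \pi_fibre_space).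
by apply/fibre_classP; rewrite subr0.
Qed.

Let nm (h : fibre_space) : R := Num.sqrt (complex.Re (fibre_ip h h)).

Let nm_class xi : nm (fibre_class xi) = snorm_at x xi.
Proof. by rewrite /nm fibre_ipE. Qed.

Let nmD h k : nm (h + k) <= nm h + nm k.
Proof. exact: (semi_normD fibre_ip_linear fibre_ip_conj fibre_ip_ge0). Qed.

Let lift h : exists2 xi, fibre_class xi = h & hm_norm xi <= nm h.
Proof.
have [eta h0 le] := ip_at_null_lift x (repr h).
exists eta; last by rewrite -[h]fibre_class_repr nm_class.
by rewrite -[h]fibre_class_repr; apply/esym/fibre_classP.
Qed.

Fact fibre_complete : norm_complete nm setT.
Proof.
move=> u _ uC.
have eps j : 0 < (2 ^- j : R) by rewrite invr_gt0 exprn_gt0.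
have /choice[M MP] j := uC _ (eps j).
pose n_ j := \max_(i < j.+1) M i.
have nM j : (M j <= n_ j)%N by exact: (@leq_bigmax _ (fun i : 'I_j.+1 => M i) ord_max).
have nS j : (n_ j <= n_ j.+1)%N by rewrite /n_ [leqRHS]big_ord_recr /= leq_maxl.
have /choice[D DP] j : exists xi, fibre_class xi = u (n_ j.+1) - u (n_ j) /\
    hm_norm xi <= 2 ^- j.
  have [xi h1 h2] := lift (u (n_ j.+1) - u (n_ j)); exists xi; split => //.
  by apply: le_trans h2 _; apply/ltW/MP => //; apply: leq_trans (nM j) _.
pose S m := repr (u (n_ 0)) + \sum_(j < m) D j.
have SE m : fibre_class (S m) = u (n_ m).
  elim: m => [|m IH]; first by rewrite /S big_ord0 addr0 fibre_class_repr.
  rewrite /S big_ord_recr /= addrA fibre_classD IH (DP m).1.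
  by rewrite addrC subrK.
have Sk m k : hm_norm (S (m + k)%N - S m) <= 2 * 2 ^- m - 2 * 2 ^- (m + k).
  elim: k => [|k IH].
    rewrite addn0 !subrr; apply: hm_norm_le => // y.
    by rewrite /snorm_at /semi_norm ip_at0 /= sqrtr0 lexx.
  have -> : S (m + k.+1)%N - S m = (S (m + k)%N - S m) + D (m + k)%N.
    rewrite addnS (_ : S (m + k).+1 = S (m + k)%N + D (m + k)%N); last first.
      by rewrite /S big_ord_recr /= addrA.
    by rewrite addrAC.
  apply: le_trans (hm_normD _ _) _; apply: le_trans (lerD IH (DP _).2) _.
  rewrite addnS exprS invfM mulrA divff// mul1r; lra.
have Sk' m k : hm_norm (S (m + k)%N - S m) < 2 * 2 ^- m.
  by apply: le_lt_trans (Sk m k) _; rewrite ltrBlDr ltrDl mulr_gt0.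
have hN xi : hm_norm (- xi) = hm_norm xi.
  have i y : ip_at y (- xi) (- xi) = ip_at y xi xi.
    rewrite -scaleN1r ip_atZ -ip_at_conj ip_atZ rmorphM /= ip_at_conj.
    by rewrite rmorphN rmorph1 !mulN1r opprK.
  by rewrite /hm_norm; congr (Num.sqrt (C0_norm _)); apply: C0_ext => y; exact: i.
have small (e : R) : 0 < e -> exists j, 2 ^- j < e.
  move=> e0; exists (Num.truncn e^-1).+1.
  rewrite -[X in _ < X]invrK ltf_pV2 ?posrE ?invr_gt0 ?exprn_gt0//.
  apply: lt_le_trans (truncnS_gt _) _.
  by rewrite -natrX ler_nat ltnW// ltn_expl.
have [l _ lP] : exists2 l, [set: E] l & forall e : R, 0 < e ->
    exists n0, forall n, (n0 <= n)%N -> hm_norm (S n - l) < e.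
  apply: (rhm_complete (hm_ax E)) => // e e0.
  have e4 : 0 < e / 4 by rewrite divr_gt0.
  have [j je] := small _ e4; exists j => m n jm jn.
  rewrite (_ : S m - S n = (S m - S j) + - (S n - S j)); last first.
    by rewrite opprB addrA subrK.
  apply: le_lt_trans (hm_normD _ _) _; rewrite hN.
  have := Sk' j (m - j)%N; have := Sk' j (n - j)%N; rewrite !subnKC//.
  lra.
exists (fibre_class l) => // e e0.
have e2 : 0 < e / 2 by rewrite divr_gt0.
have [j je] := small _ e2; have [n0 n0P] := lP _ e2.
pose J := maxn j n0; exists (n_ J) => n Jn.
have -> : u n - fibre_class l = (u n - u (n_ J)) + fibre_class (S J - l).
  by rewrite fibre_classB SE addrA subrK.
apply: le_lt_trans (nmD _ _) _; rewrite nm_class.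
have h1 := le_lt_trans (snorm_at_le x (S J - l)) (n0P J (leq_maxr _ _)).
have h2 : nm (u n - u (n_ J)) < 2 ^- J by apply: MP => //; apply: leq_trans (nM J) _.
have h3 : 2 ^- J <= 2 ^- j :> R.
  by rewrite lef_pV2 ?posrE ?exprn_gt0// ler_weXn2l ?leq_maxl// ler1n.
lra.
Qed.

Definition fibre : hilbertSpace R := HilbertSpace fibre_ip_linear
  fibre_ip_conj fibre_ip_ge0 fibre_ip_def fibre_complete.

Definition fibre_at (xi : E) : fibre := fibre_class xi.

End Fibre.

Section TwistedActions.
Variables (R : realType) (X : topologicalType) (W : finGroupType).
Local Notation C := R[i].

Record twisted_action := TwistedAction {
  ta_act : W -> X -> X;
  ta_act1 : forall x, ta_act 1%g x = x;
  ta_actM : forall u v x, ta_act (u * v)%g x = ta_act u (ta_act v x);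
  ta_act_continuous : forall w, continuous (ta_act w);
  ta_gamma : W -> W -> unitary_fun R X;
  ta_cocycle : forall u v w x,
    ta_gamma v w (ta_act u^-1%g x) * ta_gamma u (v * w)%g x =
    ta_gamma u v x * ta_gamma (u * v)%g w x;
  ta_gamma1l : forall w x, ta_gamma 1%g w x = 1;
  ta_gamma1r : forall w x, ta_gamma w 1%g x = 1 }.

Variable T : twisted_action.
Local Notation act := (ta_act T).
Local Notation gamma := (ta_gamma T).

Lemma ta_actK w : cancel (act w) (act w^-1%g).
Proof. by move=> x; rewrite -ta_actM mulVg ta_act1. Qed.

Lemma C0_translate_subproof (w : W) (b : C0 R X) :
  (fun x => b (act w^-1%g x)) \in C0_pred.
Proof.
case: b => b /asboolP[cb vb] /=; apply/asboolP; split.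
  move=> x; apply: (@continuous_comp _ _ _ (act w^-1%g) b); last exact: cb.
  exact: ta_act_continuous.
move=> e /vb[K cK hK]; exists (act w @` K).
  apply: continuous_compact => //; apply: continuous_subspaceT.
  exact: ta_act_continuous.
move=> x nK; apply: hK => Kx; apply: nK; exists (act w^-1%g x) => //.
by have := ta_actK w^-1%g x; rewrite invgK.
Qed.
Definition C0_translate (w : W) (b : C0 R X) : C0 R X :=
  MkC0 (C0_translate_subproof w b).

(* [f : twisted_crossed] stands for the formal sum of the [f w] times [w]. *)
Definition twisted_crossed : lmodType C := {ffun W -> C0 R X}.

Definition tc_mul (f g : {ffun W -> C0 R X}) : {ffun W -> C0 R X} :=
  [ffun t => \sum_u \sum_(v | (u * v)%g == t)
     C0_umul (gamma u v) (C0_mul (f u) (C0_translate u (g v)))].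

Definition tc_star (f : {ffun W -> C0 R X}) : {ffun W -> C0 R X} :=
  [ffun t => C0_umul (unitary_conj (gamma t t^-1%g))
     (C0_translate t (C0_conj (f t^-1%g)))].

(* The C*-norm of the crossed product is a parameter [N]; it is unique, being
   determined by [cstar_norm_on (A := tc_alg N) setT]. *)
Definition tc_alg (N : twisted_crossed -> R) : normedStarData R :=
  @NormedStarData R twisted_crossed tc_mul tc_star N.

Definition stabilizer (x : X) : set W := [set w | act w x = x].

Variable E : hilbertModule R X.

(* The last field states [U_v U_w xi = U_(vw) (xi) gamma(v,w)^*]. The right
   multiplication by an element [m] of [C(X,T)], a multiplier of [C_0(X)], is
   determined by [(xi m) b = xi (m b)] for all [b] in [C_0(X)]. *)
Record twisted_module_action := TwistedModuleAction {
  tm_U : W -> E -> E;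
  tm_Uinv : W -> E -> E;
  tm_linear : forall w (z : C) xi eta,
    tm_U w (z *: xi + eta) = z *: tm_U w xi + tm_U w eta;
  tm_UK : forall w, cancel (tm_U w) (tm_Uinv w);
  tm_UVK : forall w, cancel (tm_Uinv w) (tm_U w);
  tm_act : forall w xi b,
    tm_U w (hm_act xi b) = hm_act (tm_U w xi) (C0_translate w b);
  tm_ip : forall w xi eta,
    hm_ip (tm_U w xi) (tm_U w eta) = C0_translate w (hm_ip xi eta);
  tm_mul : forall v w xi b,
    hm_act (tm_U v (tm_U w xi)) b =
    hm_act (tm_U (v * w)%g xi) (C0_umul (unitary_conj (gamma v w)) b) }.

Variable U : twisted_module_action.

Definition crossed_act (xi : E) (f : twisted_crossed) : E :=
  \sum_w tm_Uinv U w (hm_act xi (f w)).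

Definition crossed_ip (xi eta : E) : twisted_crossed :=
  [ffun w => hm_ip xi (tm_U U w eta)].

(* The operator [I_(w,x)] from [E_x] to [E_y], where [y = wx]. The point [y] is
   an argument, so that for [w] in the stabiliser of [x] the operator is an
   endomorphism of [E_x] without a transport along [wx = x]. *)
Definition fibre_map (w : W) (x y : X) (h : fibre E x) : fibre E y :=
  fibre_at y (tm_U U w (repr (h : fibre_space E x))).

Lemma fibre_map_at w x y xi : act w x = y ->
  fibre_map w y (fibre_at x xi) = fibre_at y (tm_U U w xi).
Proof.
move=> <-; apply/fibre_classP.
have UB a b : tm_U U w a - tm_U U w b = tm_U U w (a - b).
  have -> : a - b = (-1) *: b + a by rewrite scaleN1r addrC.
  by rewrite tm_linear scaleN1r addrC.
rewrite UB tm_ip /= ta_actK.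
by apply/fibre_classP; rewrite fibre_class_repr.
Qed.

Definition stab_op (x : X) (w : W) : fibre E x -> fibre E x := fibre_map w x.

(* [scalar_stab x] is the subgroup [W'_x] of the stabiliser [W_x]. *)
Definition scalar_stab (x : X) : set W :=
  [set w | stabilizer x w /\ exists c : C, forall h : fibre E x, stab_op w h = c *: h].

(* For [w] in [scalar_stab x] and [E_x] nonzero the scalar is unique. *)
Definition stab_scalar (w : W) (x : X) : C :=
  xget 1 [set c : C | forall h : fibre E x, stab_op w h = c *: h].

Definition local_ideal : set twisted_crossed :=
  [set f : {ffun W -> C0 R X} | forall x w' w, scalar_stab x w' ->
    f (w' * w)%g x = stab_scalar w' x * gamma w' w x * f w x].

End TwistedActions.

Section ProjectiveRepresentations.
Variables (R : realType) (W : finGroupType) (G : set W) (eta : W -> W -> R[i]).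

Definition unitary_op (H K : hilbertSpace R) (f : H -> K) : Prop :=
  [/\ forall (z : R[i]) h k, f (z *: h + k) = z *: f h + f k,
      forall h k, hs_ip (f h) (f k) = hs_ip h k &
      forall k, exists h, f h = k].

(* [pi] represents the subgroup [G]; its values outside [G] are irrelevant. *)
Definition unitary_proj_rep (H : hilbertSpace R) (pi : W -> H -> H) : Prop :=
  (forall g, G g -> unitary_op (pi g)) /\
  forall g1 g2 h, G g1 -> G g2 -> pi g1 (pi g2 h) = eta g1 g2 *: pi (g1 * g2)%g h.

Definition irreducible_rep (H : hilbertSpace R) (pi : W -> H -> H) : Prop :=
  (exists h : H, h <> 0) /\
  forall S : set H, lin_subspace S -> norm_closure (@hs_norm R H) S `<=` S ->
    (forall g h, G g -> S h -> S (pi g h)) ->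
    S `<=` [set 0] \/ S = setT.

Definition appears_in (H K : hilbertSpace R) (pi : W -> H -> H)
    (rho : W -> K -> K) : Prop :=
  exists V : H -> K,
    [/\ forall (z : R[i]) h k, V (z *: h + k) = z *: V h + V k,
        forall h k, hs_ip (V h) (V k) = hs_ip h k &
        forall g h, G g -> V (pi g h) = rho g (V h)].

End ProjectiveRepresentations.

Section Completeness.
Variables (R : realType) (X : topologicalType) (W : finGroupType).
Variables (T : twisted_action R X W) (E : hilbertModule R X).
Variable U : twisted_module_action T E.

Definition contragredient (x : X) (w : W) (h : conj_hilbert (fibre E x)) :
  conj_hilbert (fibre E x) := stab_op U w (h : fibre E x).

Definition completeness_condition : Prop :=
  forall (x : X) (H : hilbertSpace R) (pi : W -> H -> H),
    unitary_proj_rep (stabilizer T x) (fun v w => ta_gamma T v w x) pi ->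
    irreducible_rep (stabilizer T x) pi ->
    (forall w', scalar_stab U x w' -> forall h, pi w' h = (stab_scalar U w' x)^* *: h) ->
    appears_in (stabilizer T x) pi (@contragredient x).

End Completeness.

Section CompactOperators.
Variables (R : realType) (X : topologicalType) (E : hilbertModule R X).

Definition is_adjoint (k k' : E -> E) : Prop :=
  forall xi eta, hm_ip (k xi) eta = hm_ip xi (k' eta).

Definition op_bounded (k : E -> E) : Prop :=
  exists M : R, forall xi, hm_norm (k xi) <= M * hm_norm xi.

Definition op_norm (k : E -> E) : R :=
  sup [set hm_norm (k xi) | xi in [set xi | hm_norm xi <= 1]].

(* The algebra of all functions from [E] to [E]; [op_adj] and [op_norm] are
   meaningful on the bounded adjointable operators. *)
Definition op_adj (k : E -> E) : E -> E := xget 0 [set k' | is_adjoint k k'].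

Definition op_alg : normedStarData R :=
  @NormedStarData R (E -> E) (fun k k' => k \o k') op_adj op_norm.

Definition adjointable : set (E -> E) :=
  [set k | op_bounded k /\ exists k', is_adjoint k k'].

Definition rank_one (xi eta : E) : E -> E := fun zeta => hm_act xi (hm_ip eta zeta).

Definition compact_op : set (E -> E) :=
  adjointable `&` norm_closure op_norm
    (lin_span [set k | exists xi eta, k = rank_one xi eta]).

Variables (W : finGroupType) (T : twisted_action R X W).
Variable U : twisted_module_action T E.

Definition compact_op_fixed : set op_alg :=
  [set k | compact_op k /\ forall w xi, tm_U U w (k xi) = k (tm_U U w xi)].

End CompactOperators.

Section MoritaEquivalence.
Variables (R : realType) (X : topologicalType) (W : finGroupType).
Variables (T : twisted_action R X W) (E : hilbertModule R X).
Variables (U : twisted_module_action T E) (N : twisted_crossed R X W -> R).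

Definition inner_product_span : set (tc_alg T N) :=
  norm_closure N (lin_span (ip_range (A := tc_alg T N) (crossed_ip U))).

(* The left inner product is part of the imprimitivity bimodule structure but is
   determined by the right one, through [ib_assoc]. *)
Definition implements_morita_equivalence (I : set (tc_alg T N)) : Prop :=
  exists lip : E -> E -> op_alg E,
    imprimitivity_bimodule (A := op_alg E) (B := tc_alg T N)
      (compact_op_fixed U) I
      (fun (k : op_alg E) (xi : E) => (k : E -> E) xi) (crossed_act U)
      lip (crossed_ip U).

End MoritaEquivalence.

Arguments inner_product_span {R X W T E} U N.

(* Main.v *)
Require Import Defs.
From HB Require Import structures.
From mathcomp Require Import all_boot all_order all_algebra all_fingroup.
From mathcomp Require Import complex.
From mathcomp Require Import all_classical all_reals all_analysis.
From mathcomp Require Import ring lra.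

Set Implicit Arguments.
Unset Strict Implicit.
Unset Printing Implicit Defensive.

Import Order.TTheory GRing.Theory Num.Theory numFieldNormedType.Exports.

Local Open Scope classical_set_scope.
Local Open Scope ring_scope.

(** Write [A] for the twisted crossed product, [N] for its C*-norm, [V_w] for the
    inverse of [U_w], and [<<xi|eta>>] for the [A]-valued inner product.

    The norm. All that is known of [N] is that it is a C*-norm. It is equivalent to
    the supremum norm of the coefficients ([tc_norm_le], [tc_coef_le]), so that every
    estimate can be made pointwise on [X]. The upper bound rests on
    [N(a)^2 <= N(a^2 + b^2)] for commuting self-adjoint [a] and [b], which gives
    [N(a)^2 <= N(a)] when [0 <= a <= 1] in [C_0(X)]. For the lower bound, the
    semi-inner products [(c, d) |-> (c^* d)_1 (x)] on [A] satisfy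
    [|f c|_x <= N(f) |c|_x]: if [N(f) <= 1], then [1 - f^* f] is a square in the
    unitization, by an iteration that converges in [N].

    The ideal. [<<xi|eta>>] satisfies the equations of the ideal because [U_w'] acts on
    the fibre [E_x] as the scalar [iota] when [w'] is in [W'_x]. Conversely, a
    partition of unity reduces the density of the span to a statement at one point [x]
    ([local_approximation]), and a function that separates the orbit of [x] reduces
    it to one coset of the stabiliser ([local_ideal_coset]). What remains is that the
    functions [c] on [W_x] with [c(w'g) = iota_w' gamma(w',g) c(g)] are spanned by
    the matrix coefficients of [I_x] ([matrix_coefficients_span]). The conjugates of
    these functions form a [gamma_x]-representation of [W_x] by right translation,
    which lies over the conjugate of [iota_x]. If matrix coefficients did not exhaust
    it, their orthogonal complement would contain an irreducible subrepresentation.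
    By the completeness condition this embeds in the contragredient of [I_x], and
    writing evaluation at [1] as an inner product exhibits its elements as matrix
    coefficients, which is absurd.

    The bimodule. The left inner product of [xi] and [eta] is the operator
    [zeta |-> xi <<eta|zeta>>], the sum over [w] of the rank one operators of [V_w xi]
    and [V_w eta]. It is full because averaging over [W] maps the finite rank operators
    onto the span of these sums and fixes [K(E)^W]. The delicate axiom is that
    [<<xi|xi>>] and the left inner product of [xi] with itself are of the form [b^* b]
    with [b] in the algebra itself. Both act as positive operators for a family of
    semi-inner products that controls the C*-norm, and for such elements
    [positive_in_of_forms] constructs a square root: the iteration
    [y |-> (a + 2 q y - y^2) / 2], with suitable scalars [q] increasing to [1],
    stays in the algebra, and is Cauchy because [q - y] is the usual iteration
    for [1 - sqrt a] in terms of the contraction [1 - a]. *)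

(** * Complex moduli, semi-inner products and functions vanishing at infinity *)

Local Notation cabs z := (complex.Re `|z|).

Section ComplexModulus.
Variable R : realType.
Implicit Types z w : R[i].

Lemma cabsE z : `|z| = (cabs z)%:C%C.
Proof. by rewrite normc_def. Qed.

Lemma cabs_ge0 z : 0 <= cabs z.
Proof. by rewrite normc_def /= sqrtr_ge0. Qed.

Lemma cabs_le z (M : R) : (cabs z <= M) = (`|z| <= M%:C%C).
Proof. by rewrite [in RHS]cabsE lecR. Qed.

Lemma cabs_lt z (M : R) : (cabs z < M) = (`|z| < M%:C%C).
Proof. by rewrite [in RHS]cabsE ltcR. Qed.

Lemma cabs0 : cabs (0 : R[i]) = 0.
Proof. by rewrite normr0. Qed.

Lemma cabs_eq0 z : cabs z = 0 -> z = 0.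
Proof. by move=> z0; apply/eqP; rewrite -normr_eq0 cabsE z0. Qed.

Lemma cabsM z w : cabs (z * w) = cabs z * cabs w.
Proof. by apply: complexI; rewrite rmorphM /= -!cabsE normrM. Qed.

Lemma cabsD z w : cabs (z + w) <= cabs z + cabs w.
Proof. by rewrite cabs_le rmorphD /= -!cabsE ler_normD. Qed.

Lemma cabsN z : cabs (- z) = cabs z.
Proof. by rewrite normrN. Qed.

Lemma cabs_half : cabs (2^-1 : R[i]) = 2^-1.
Proof.
have -> : (2^-1 : R[i]) = ((2^-1 : R)%:C)%C by rewrite fmorphV rmorph_nat.
by rewrite normc_def /= expr0n addr0 sqrtr_sqr ger0_norm// invr_ge0.
Qed.

Lemma cabs_conj z : cabs z^* = cabs z.
Proof. by rewrite norm_conjC. Qed.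

Lemma cabs_real (r : R) : 0 <= r -> cabs (r%:C%C) = r.
Proof. by move=> r0; rewrite ger0_norm ?ler0c. Qed.

Lemma cabs_sum I (r : seq I) (P : pred I) (F : I -> R[i]) :
  cabs (\sum_(i <- r | P i) F i) <= \sum_(i <- r | P i) cabs (F i).
Proof.
elim/big_ind2: _ => [|a b c d ab cd|//]; first by rewrite cabs0.
by apply: le_trans (cabsD _ _) _; exact: lerD.
Qed.

Lemma cabs_sq z : ((cabs z ^+ 2)%:C)%C = z^* * z.
Proof. by rewrite rmorphXn /= -cabsE normCKC. Qed.

Lemma ge0_ReE z : 0 <= z -> z = (complex.Re z)%:C%C.
Proof. by move=> /ger0_Im; case: z => a b /= ->. Qed.

Lemma conjC_real (r : R) : (r%:C%C : R[i])^* = r%:C%C.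
Proof. by apply: CrealP; rewrite complex_real. Qed.

End ComplexModulus.

Section SemiInnerProducts.
Variables (R : realType) (V : lmodType R[i]).

Record semi_inner (s : V -> V -> R[i]) : Prop := SemiInner {
  si_linear : forall (z : R[i]) h k k', s h (z *: k + k') = z * s h k + s h k';
  si_conj : forall h k, (s h k)^* = s k h;
  si_ge0 : forall h, 0 <= s h h }.

Variables (s : V -> V -> R[i]) (sP : semi_inner s).

Lemma si_Dr h k k' : s h (k + k') = s h k + s h k'.
Proof. by have := si_linear sP 1 h k k'; rewrite scale1r mul1r. Qed.
Lemma si_0r h : s h 0 = 0.
Proof. by apply: (addrI (s h 0)); rewrite -si_Dr !addr0. Qed.
Lemma si_Zr z h k : s h (z *: k) = z * s h k.
Proof. by have := si_linear sP z h k 0; rewrite addr0 si_0r addr0. Qed.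
Lemma si_Dl h h' k : s (h + h') k = s h k + s h' k.
Proof. by rewrite -(si_conj sP) si_Dr rmorphD /= !(si_conj sP). Qed.
Lemma si_Zl z h k : s (z *: h) k = z^* * s h k.
Proof. by rewrite -(si_conj sP) si_Zr rmorphM /= !(si_conj sP). Qed.
Lemma si_0l h : s 0 h = 0.
Proof. by rewrite -(si_conj sP) si_0r conjC0. Qed.
Lemma si_Nr h k : s h (- k) = - s h k.
Proof. by rewrite -scaleN1r si_Zr mulN1r. Qed.
Lemma si_Nl h k : s (- h) k = - s h k.
Proof. by rewrite -(si_conj sP) si_Nr rmorphN /= (si_conj sP). Qed.
Lemma si_Br h k k' : s h (k - k') = s h k - s h k'.
Proof. by rewrite si_Dr si_Nr. Qed.
Lemma si_Bl h k k' : s (k - k') h = s k h - s k' h.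
Proof. by rewrite si_Dl si_Nl. Qed.
Lemma si_sumr I (r : seq I) (P : pred I) (F : I -> V) h :
  s h (\sum_(i <- r | P i) F i) = \sum_(i <- r | P i) s h (F i).
Proof. by apply: (big_morph (s h)) => [x y|]; rewrite ?si_Dr ?si_0r. Qed.
Lemma si_CS u v : `|s u v| ^+ 2 <= s u u * s v v.
Proof.
by apply: semi_ip_CS; [exact: si_linear | exact: si_conj | exact: si_ge0].
Qed.

Lemma si_null u v : s u u = 0 -> s u v = 0.
Proof.
by apply: semi_ip_null; [exact: si_linear | exact: si_conj | exact: si_ge0].
Qed.

Lemma si_normD u v : semi_norm s (u + v) <= semi_norm s u + semi_norm s v.
Proof.
by apply: semi_normD; [exact: si_linear | exact: si_conj | exact: si_ge0].
Qed.

Lemma si_normZ z u : semi_norm s (z *: u) = cabs z * semi_norm s u.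
Proof. exact: (semi_normZ (si_linear sP) (si_conj sP)). Qed.

Lemma si_norm_ge0 u : 0 <= semi_norm s u.
Proof. exact: sqrtr_ge0. Qed.

Lemma si_norm_sq u : ((semi_norm s u ^+ 2)%:C)%C = s u u.
Proof. exact: (semi_norm_sq (si_ge0 sP)). Qed.

Lemma si_norm_le u v (c : R) : 0 <= c ->
  (s u u <= (c ^+ 2)%:C%C * s v v) <-> (semi_norm s u <= c * semi_norm s v).
Proof.
move=> c0; rewrite -!si_norm_sq -rmorphM /= lecR -exprMn.
by rewrite ler_pXn2r// nnegrE ?mulr_ge0// si_norm_ge0.
Qed.

End SemiInnerProducts.

Section C0Facts.
Variables (R : realType) (X : topologicalType).
Implicit Types f g : C0 R X.

Lemma C0B f g x : (f - g) x = f x - g x. Proof. by []. Qed.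
Lemma C0Z (z : R[i]) f x : (z *: f) x = z * f x. Proof. by []. Qed.
Lemma C0_sum I (r : seq I) (P : pred I) (F : I -> C0 R X) x :
  (\sum_(i <- r | P i) F i) x = \sum_(i <- r | P i) F i x.
Proof. exact: (big_morph (fun f : C0 R X => f x)). Qed.

Lemma C0_norm_ge0 f : 0 <= C0_norm f.
Proof.
have [[x _]|X0] := pselect (exists x : X, True).
  exact: le_trans (cabs_ge0 (f x)) (C0_norm_ge f x).
suff -> : C0_norm f = 0 by [].
rewrite /C0_norm -[RHS](@sup0 R); congr sup; rewrite -subset0.
by move=> ? [x ? _]; apply: X0; exists x.
Qed.

Lemma C0_Re_continuous f : continuous (fun x => complex.Re (f x) : R^o).
Proof.
have /asboolP[cf _] := C0_funP f.
move=> x; apply/cvgrPdist_lt => e e0.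
have ec0 : 0 < e%:C%C by rewrite ltcR.
near=> t; rewrite -raddfB -ltcR; apply: le_lt_trans (normc_ge_Re _) _.
by near: t; move/cvgrPdist_lt: (cf x) => /(_ _ ec0).
Unshelve. all: by end_near. Qed.

Lemma real_complex_continuous (g : X -> R^o) : continuous g ->
  continuous (fun x => (g x)%:C%C : R[i]^o).
Proof.
move=> cg x; apply/cvgrPdist_lt => e e0.
have eE := ge0_ReE (ltW e0).
have er0 : 0 < complex.Re e by rewrite -ltcR -eE.
near=> t; rewrite -raddfB eE normc_def /= expr0n addr0 sqrtr_sqr ltcR.
by near: t; move/cvgrPdist_lt: (cg x) => /(_ _ er0).
Unshelve. all: by end_near. Qed.

Lemma C0_sqrt_subproof f :
  (fun x => (Num.sqrt (complex.Re (f x)))%:C%C : R[i]^o) \in C0_pred.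
Proof.
have /asboolP[cf vf] := C0_funP f; apply/asboolP; split.
  apply: real_complex_continuous => x.
  apply: (@continuous_comp _ _ _ (fun y => complex.Re (f y) : R^o) Num.sqrt).
    exact: C0_Re_continuous.
  exact: sqrt_continuous.
move=> e e0; have eE := ge0_ReE (ltW e0).
have [|K cK hK] := vf (e ^+ 2); first by rewrite exprn_gt0.
exists K => // x /hK fx; rewrite ger0_norm ?ler0c ?sqrtr_ge0// eE ltcR.
have er0 : 0 < complex.Re e by rewrite -ltcR -eE.
rewrite -(ltr_pXn2r (_ : 0 < 2)%N) ?nnegrE ?sqrtr_ge0 ?(ltW er0)//.
have : `|complex.Re (f x)| < complex.Re e ^+ 2.
  rewrite -ltcR rmorphXn /= -eE; exact: le_lt_trans (normc_ge_Re _) fx.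
apply: le_lt_trans; have [r0|r0] := leP 0 (complex.Re (f x)).
  by rewrite sqr_sqrtr// ler_norm.
by rewrite ltr0_sqrtr// expr0n /=; exact: normr_ge0.
Qed.
Definition C0_sqrt f : C0 R X := MkC0 (C0_sqrt_subproof f).

Lemma C0_sqrtK f x : 0 <= f x -> C0_sqrt f x * C0_sqrt f x = f x.
Proof.
move=> f0; rewrite /= -rmorphM /= -expr2 sqr_sqrtr -?ge0_ReE//.
by move: f0; rewrite lecE => /andP[].
Qed.

Lemma C0_sqrt_conj f x : (C0_sqrt f x : R[i])^* = C0_sqrt f x.
Proof. exact: conjC_real. Qed.

End C0Facts.

(** * The crossed product as a star algebra *)

Section CrossedProduct.
Variables (R : realType) (X : topologicalType) (W : finGroupType).
Variable T : twisted_action R X W.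
Local Notation C := R[i].
Local Notation act := (ta_act T).
Local Notation gamma := (ta_gamma T).
Implicit Types f g h : {ffun W -> C0 R X}.

Lemma ta_actV w x : act w^-1%g (act w x) = x.
Proof. exact: ta_actK. Qed.

Lemma ta_actVr w x : act w (act w^-1%g x) = x.
Proof. by have := ta_actV w^-1%g x; rewrite invgK. Qed.

Lemma gamma_mulJ u v x : gamma u v x * (gamma u v x : C)^* = 1.
Proof. by rewrite -normCK uf_norm expr1n. Qed.

Lemma gamma_mulJl u v x : (gamma u v x : C)^* * gamma u v x = 1.
Proof. by rewrite mulrC gamma_mulJ. Qed.

Lemma tc_mulE f g t x : tc_mul T f g t x =
  \sum_u gamma u (u^-1 * t)%g x * (f u x * g (u^-1 * t)%g (act u^-1%g x)).
Proof.
rewrite ffunE C0_sum; apply: eq_bigr => u _; rewrite C0_sum.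
rewrite (big_pred1 (u^-1 * t)%g)// => v /=.
by rewrite (canF_eq (mulKg u)).
Qed.

Lemma tc_starE f t x : tc_star T f t x =
  (gamma t t^-1%g x : C)^* * (f t^-1%g (act t^-1%g x) : C)^*.
Proof. by rewrite ffunE. Qed.

Lemma tcD f g t x : (f + g) t x = f t x + g t x.
Proof. by rewrite ffunE. Qed.
Lemma tcZ (z : C) f t x : (z *: f) t x = z * f t x.
Proof. by rewrite ffunE. Qed.
Lemma tcN f t x : (- f) t x = - f t x.
Proof. by rewrite ffunE. Qed.
Lemma tcB f g t x : (f - g) t x = f t x - g t x.
Proof. by rewrite tcD tcN. Qed.
Lemma tc0 t x : (0 : {ffun W -> C0 R X}) t x = 0.
Proof. by rewrite ffunE. Qed.
Lemma tc_sum I (r : seq I) (P : pred I) (F : I -> {ffun W -> C0 R X}) t x :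
  (\sum_(i <- r | P i) F i) t x = \sum_(i <- r | P i) F i t x.
Proof. by rewrite sum_ffunE C0_sum. Qed.

Lemma tc_ext f g : (forall t x, f t x = g t x) -> f = g.
Proof. by move=> fg; apply/ffunP => t; apply: C0_ext => x. Qed.

Lemma tc_mulA f g h : tc_mul T f (tc_mul T g h) = tc_mul T (tc_mul T f g) h.
Proof.
apply: tc_ext => t x; rewrite !tc_mulE.
under [in RHS]eq_bigr => s _ do rewrite tc_mulE mulr_suml mulr_sumr.
rewrite [RHS]exchange_big /=; apply: eq_bigr => u _.
rewrite tc_mulE !mulr_sumr [RHS](reindex_inj (mulgI u)) /=; apply: eq_bigr => v _.
have := ta_cocycle T u v ((u * v)^-1 * t)%g x.
rewrite !invMg !mulgA mulgV mul1g mulVg mul1g ta_actM => co.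
rewrite -!mulgA in co *.
transitivity ((gamma v (v^-1 * (u^-1 * t))%g (act u^-1%g x) * gamma u (u^-1 * t)%g x) *
   (f u x * g v (act u^-1%g x) * h (v^-1 * (u^-1 * t))%g (act v^-1%g (act u^-1%g x)))).
  ring.
rewrite co; ring.
Qed.

Lemma tc_mull (z : C) f g h :
  tc_mul T (z *: f + g) h = z *: tc_mul T f h + tc_mul T g h.
Proof.
apply: tc_ext => t x; rewrite tcD tcZ !tc_mulE mulr_sumr -big_split /=.
by apply: eq_bigr => u _; rewrite tcD tcZ; ring.
Qed.

Lemma tc_mulr (z : C) f g h :
  tc_mul T h (z *: f + g) = z *: tc_mul T h f + tc_mul T h g.
Proof.
apply: tc_ext => t x; rewrite tcD tcZ !tc_mulE mulr_sumr -big_split /=.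
by apply: eq_bigr => u _; rewrite tcD tcZ; ring.
Qed.

Lemma tc_star_semilinear (z : C) f g :
  tc_star T (z *: f + g) = (z^* : C) *: tc_star T f + tc_star T g.
Proof.
apply: tc_ext => t x; rewrite tcD tcZ !tc_starE tcD tcZ rmorphD rmorphM /=; ring.
Qed.

Lemma tc_starK f : tc_star T (tc_star T f) = f.
Proof.
apply: tc_ext => t x; rewrite !tc_starE invgK ta_actVr rmorphM /= !conjCK.
have := ta_cocycle T t t^-1%g t x; rewrite mulVg mulgV ta_gamma1l ta_gamma1r mulr1 mulr1.
by move=> ->; rewrite mulrA gamma_mulJl mul1r.
Qed.

Lemma tc_starM f g :
  tc_star T (tc_mul T f g) = tc_mul T (tc_star T g) (tc_star T f).
Proof.
apply: tc_ext => t x; rewrite tc_starE !tc_mulE.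
rewrite rmorph_sum mulr_sumr /= [RHS](reindex_inj (mulgI t)) /=.
apply: eq_bigr => u _; rewrite !rmorphM /= !tc_starE.
rewrite !invMg !invgK !mulgA mulgKV -!ta_actM.
have -> : (t^-1 * t * u = u)%g by rewrite mulVg mul1g.
rewrite mulKVg.
set c1 := gamma t t^-1%g x; set c2 := gamma u (u^-1 * t^-1)%g (act t^-1%g x).
set c3 := gamma (t * u)%g u^-1%g x; set c4 := gamma (t * u)%g (u^-1 * t^-1)%g x.
set c5 := gamma u^-1%g u (act (u^-1 * t^-1)%g x).
have co1 := ta_cocycle T (t * u)%g u^-1%g u x.
have co2 := ta_cocycle T t u (u^-1 * t^-1)%g x.
move: co1 co2; rewrite mulVg ta_gamma1r mulr1 mulgK invMg mulKVg -/c1 -/c2 -/c3 -/c4 -/c5.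
move=> co1 co2.
suff e : (c1 : C)^* * (c2 : C)^* = c3 * ((c4 : C)^* * (c5 : C)^*).
  by rewrite mulrA e; ring.
have n1 : (c1 : C)^* * c1 = 1 by exact: gamma_mulJl.
have n2 : (c2 : C)^* * c2 = 1 by exact: gamma_mulJl.
have n4 : (c4 : C)^* * c4 = 1 by exact: gamma_mulJl.
have n5 : (c5 : C)^* * c5 = 1 by exact: gamma_mulJl.
have key : c3 * (c2 * c1) = c4 * c5 by rewrite co1 co2; ring.
transitivity ((c1 : C)^* * (c2 : C)^* * ((c4 : C)^* * c4) * ((c5 : C)^* * c5)).
  by rewrite n4 n5 !mulr1.
transitivity ((c1 : C)^* * (c2 : C)^* * (c4 : C)^* * (c5 : C)^* * (c4 * c5)); first by ring.
rewrite -key.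
transitivity (((c1 : C)^* * c1) * ((c2 : C)^* * c2) * (c3 * ((c4 : C)^* * (c5 : C)^*))).
  ring.
by rewrite n1 n2 !mul1r.
Qed.

Lemma tc_star_algebra (N : twisted_crossed R X W -> R) :
  @star_algebra_on R (tc_alg T N) setT.
Proof.
split => //.
- by move=> a b c _ _ _; exact: (tc_mulA a b c).
- by move=> z a b c _ _ _; exact: (tc_mull z a b c).
- by move=> z a b c _ _ _; exact: (tc_mulr z a b c).
- by move=> z a b _ _; exact: tc_star_semilinear.
- by move=> a _; exact: (tc_starK a).
- by move=> a b _ _; exact: (tc_starM a b).
Qed.

(** The inner product of the regular representation induced from evaluation at [x],
    written as the [1]-coefficient of [f^* g]. *)
Definition tc_form (x : X) f g : C := tc_mul T (tc_star T f) g 1%g x.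

Lemma tc_formE x f g : tc_form x f g =
  \sum_u (f u (act u x) : C)^* * g u (act u x).
Proof.
rewrite /tc_form tc_mulE (reindex_inj invg_inj) /=; apply: eq_bigr => u _.
rewrite invgK mulg1 tc_starE !invgK.
transitivity ((gamma u^-1%g u x : C)^* * gamma u^-1%g u x *
  ((f u (act u x) : C)^* * g u (act u x))); first by ring.
by rewrite gamma_mulJl mul1r.
Qed.

Lemma tc_form_semi x : semi_inner (V := twisted_crossed R X W) (tc_form x).
Proof.
split=> [z f g h|f g|f].
- rewrite !tc_formE mulr_sumr -big_split /=; apply: eq_bigr => u _.
  by rewrite tcD tcZ; ring.
- rewrite !tc_formE rmorph_sum /=; apply: eq_bigr => u _.
  by rewrite rmorphM /= conjCK mulrC.
- by rewrite tc_formE sumr_ge0// => u _; rewrite mulrC mul_conjC_ge0.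
Qed.

Lemma tc_form_adj x f g h :
  tc_form x (tc_mul T f g) h = tc_form x g (tc_mul T (tc_star T f) h).
Proof. by rewrite /tc_form tc_starM tc_mulA. Qed.

Definition tc_single (w : W) (b : C0 R X) : {ffun W -> C0 R X} :=
  [ffun t => if t == w then b else 0].

Lemma tc_singleE w b t x : tc_single w b t x = if t == w then b x else 0.
Proof. by rewrite ffunE; case: eqP. Qed.

Lemma tc_mul_single f w b t x :
  tc_mul T f (tc_single w b) t x =
  gamma (t * w^-1)%g w x * (f (t * w^-1)%g x * b (act (w * t^-1)%g x)).
Proof.
rewrite tc_mulE (bigD1 (t * w^-1)%g)//= big1 ?addr0; last first.
  move=> u uw; rewrite tc_singleE ifN ?mulr0//; apply: contraNN uw => /eqP <-.
  by rewrite invMg invgK mulgA mulgV mul1g.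
by rewrite invMg invgK -mulgA mulVg mulg1 tc_singleE eqxx.
Qed.

Lemma tc_mul_single1 f b t x :
  tc_mul T f (tc_single 1%g b) t x = f t x * b (act t^-1%g x).
Proof. by rewrite tc_mul_single invg1 mulg1 mul1g ta_gamma1r mul1r. Qed.

Lemma tc_sum_single f : f = \sum_w tc_single w (f w).
Proof.
apply: tc_ext => t x; rewrite tc_sum (bigD1 t)//= big1 ?addr0 ?tc_singleE ?eqxx//.
by move=> w wt; rewrite tc_singleE eq_sym (negPf wt).
Qed.

End CrossedProduct.

(** * The iteration for square roots and limits in a C*-algebra *)

Section ScalarIteration.
Variable R : realType.

(** The value of the iteration [op_iter] for the identity operator; it increases to
    [1] and dominates the norms in the general case. *)
Fixpoint sqrt_scalar (n : nat) : R :=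
  if n is k.+1 then (1 + sqrt_scalar k ^+ 2) / 2 else 0.
Local Notation q := sqrt_scalar.

Lemma sqrt_scalar_bounds n : 0 <= q n <= 1.
Proof.
elim: n => [|n /andP[q0 q1]] /=; first by rewrite lexx ler01.
apply/andP; split; nra.
Qed.

Lemma sqrt_scalar_ge0 n : 0 <= q n.
Proof. by have /andP[] := sqrt_scalar_bounds n. Qed.

Lemma sqrt_scalarS n : q n <= q n.+1.
Proof. by have /andP[] := sqrt_scalar_bounds n => /=; nra. Qed.

Lemma sqrt_scalar_homo m n : (m <= n)%N -> q m <= q n.
Proof. by apply: (homo_leq (@lexx _ R) (@le_trans _ R)); exact: sqrt_scalarS. Qed.

Lemma sqrt_scalar_rate n : 1 - q n <= 2 / n.+2%:R.
Proof.
elim: n => [|n IH]; first by rewrite subr0 divff ?pnatr_eq0.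
have /andP[q0 q1] := sqrt_scalar_bounds n.
have e : 1 - q n.+1 = (1 - q n) - (1 - q n) ^+ 2 / 2 by move=> /=; field.
rewrite e; set d := 1 - q n in IH *.
have d0 : 0 <= d by rewrite subr_ge0.
set k : R := n.+2%:R in IH.
have -> : n.+3%:R = k + 1 :> R by rewrite -natr1.
have k2 : 2 <= k by rewrite ler_nat.
have k0 : 0 < k by lra.
have dk : d * k <= 2 by rewrite -ler_pdivlMr.
apply: (@le_trans _ _ (2 / k - (2 / k) ^+ 2 / 2)).
  have w1 : 2 / k <= 1 by rewrite ler_pdivrMr// mul1r.
  set w := 2 / k in IH w1 *.
  have : 0 <= (w - d) * (2 - w - d) by apply: mulr_ge0; lra.
  lra.
have -> : 2 / k - (2 / k) ^+ 2 / 2 = 2 * (k - 1) / k ^+ 2 by field; lra.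
rewrite ler_pdivrMr ?exprn_gt0// mulrAC ler_pdivlMr; last lra.
nra.
Qed.

Lemma sqrt_scalar_near (e : R) : 0 < e ->
  exists n0, forall n, (n0 <= n)%N -> 1 - q n < e.
Proof.
move=> e0; exists (Num.truncn (2 / e)) => n nn0.
apply: le_lt_trans (sqrt_scalar_rate n) _.
rewrite ltr_pdivrMr// mulrC -ltr_pdivrMr//.
apply: lt_le_trans (truncnS_gt _) _; rewrite ler_nat; exact: leqW.
Qed.

End ScalarIteration.
Arguments sqrt_scalar {R}.

Section OperatorIteration.
Variables (R : realType) (V : lmodType R[i]) (m : V -> R) (h : V -> V).
Local Notation q := (@sqrt_scalar R).
Hypothesis mD : forall u v, m (u + v) <= m u + m v.
Hypothesis mZ : forall z u, m (z *: u) = cabs z * m u.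
Hypothesis hD : forall (z : R[i]) u v, h (z *: u + v) = z *: h u + h v.
Hypothesis hm : forall v, m (h v) <= m v.

(** If [t = (h + t^2) / 2], then [1 - t] is a square root of [1 - h]. The iterates that
    start from [0] are polynomials in [h] with nonnegative coefficients, and so are
    their increments; this is why their norms are bounded by those for [h = 1]. *)
Fixpoint op_iter (n : nat) (v : V) : V :=
  if n is k.+1 then (2^-1 : R[i]) *: (h v + op_iter k (op_iter k v)) else 0.
Local Notation t := op_iter.

Lemma op_iterD n (z : R[i]) u v : t n (z *: u + v) = z *: t n u + t n v.
Proof.
elim: n z u v => [|n IH] z u v /=; first by rewrite scaler0 addr0.
rewrite hD !IH scalerA mulrC -scalerA -scalerDr; congr (_ *: _).
by rewrite scalerDr addrACA.
Qed.

Let tB n u v : t n (u - v) = t n u - t n v.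
Proof. by rewrite addrC -scaleN1r op_iterD scaleN1r addrC. Qed.

Lemma op_iter_bound n v : m (t n v) <= q n * m v.
Proof.
elim: n v => [|n IH] v /=.
  by rewrite mul0r -(scale0r (0 : V)) mZ cabs0 mul0r.
rewrite mZ cabs_half.
have a1 := mD (h v) (t n (t n v)); have a2 := hm v.
have a3 := IH (t n v); have a4 := IH v.
have a5 := ler_wpM2l (sqrt_scalar_ge0 R n) a4.
rewrite mulrC ler_pdivrMr//; nra.
Qed.

Lemma op_iter_step n v : m (t n.+1 v - t n v) <= (q n.+1 - q n) * m v.
Proof.
elim: n v => [|n IH] v.
  have := op_iter_bound 1 v; rewrite [t 0 v]/= subr0 [q 0]/=; lra.
(* With d the difference of t' and t, t'^2 - t^2 = t' d + d t, commuting or not. *)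
have -> : t n.+2 v - t n.+1 v = (2^-1 : R[i]) *: (t n.+1 (t n.+1 v - t n v) +
    (t n.+1 (t n v) - t n (t n v))).
  rewrite [t n.+2 v]/= [in X in _ - X]/= -scalerBr; congr (_ *: _).
  by rewrite [X in X - _]addrC addrKA tB addrA subrK.
rewrite mZ cabs_half.
have a1 := mD (t n.+1 (t n.+1 v - t n v)) (t n.+1 (t n v) - t n (t n v)).
have a2 := op_iter_bound n.+1 (t n.+1 v - t n v).
have a3 := IH v; have a4 := IH (t n v); have a5 := op_iter_bound n v.
have q0 := sqrt_scalar_ge0 R n.+1; have d0 := sqrt_scalarS R n.
have a6 := ler_wpM2l q0 a3.
have d0' : 0 <= q n.+1 - q n by rewrite subr_ge0.
have a7 := ler_wpM2l d0' a5.
have -> : q n.+2 - q n.+1 = (q n.+1 ^+ 2 - q n ^+ 2) / 2 by rewrite /=; field.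
rewrite mulrC ler_pdivrMr// mulrAC divfK//.
nra.
Qed.

Lemma op_iter_cauchy n k v : m (t (n + k)%N v - t n v) <= (q (n + k)%N - q n) * m v.
Proof.
elim: k => [|k IH].
  by rewrite addn0 !subrr mul0r -(scale0r (0 : V)) mZ cabs0 mul0r.
rewrite addnS (_ : t (n + k).+1 v - _ =
    (t (n + k).+1 v - t (n + k)%N v) + (t (n + k)%N v - t n v)).
  apply: le_trans (mD _ _) _; have := op_iter_step (n + k) v; lra.
by rewrite addrA subrK.
Qed.

End OperatorIteration.

Section CstarLimits.
Variables (R : realType) (A : normedStarData R) (S : set A).
Hypothesis HS : cstar_algebra_on S.
Local Notation C := R[i].
Local Notation "a ** b" := (nsd_mul a b) (at level 40, left associativity).
Local Notation star := (@nsd_star R A).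
Local Notation N := (@nsd_norm R A).
Local Notation q := (@sqrt_scalar R).

Let sa := HS.1.
Let cn := HS.2.

Lemma cs0 : S 0. Proof. exact: (sa_subspace sa).1. Qed.
Lemma csL (z : C) a b : S a -> S b -> S (z *: a + b).
Proof. exact: (sa_subspace sa).2. Qed.
Lemma csD a b : S a -> S b -> S (a + b).
Proof. by move=> Sa Sb; rewrite -[a]scale1r; exact: csL. Qed.
Lemma csZ (z : C) a : S a -> S (z *: a).
Proof. by move=> Sa; rewrite -[_ *: _]addr0; apply: csL => //; exact: cs0. Qed.
Lemma csN a : S a -> S (- a).
Proof. by move=> Sa; rewrite -scaleN1r; exact: csZ. Qed.
Lemma csB a b : S a -> S b -> S (a - b).
Proof. by move=> Sa Sb; apply: csD => //; exact: csN. Qed.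
Lemma csM a b : S a -> S b -> S (a ** b). Proof. exact: (sa_mul_in sa). Qed.
Lemma csS a : S a -> S (star a). Proof. exact: (sa_star_in sa). Qed.

Lemma cs_mulDl a b c : S a -> S b -> S c -> (a + b) ** c = a ** c + b ** c.
Proof. by move=> *; rewrite -[a]scale1r (sa_mull sa)// !scale1r. Qed.
Lemma cs_mulDr a b c : S a -> S b -> S c -> c ** (a + b) = c ** a + c ** b.
Proof. by move=> *; rewrite -[a]scale1r (sa_mulr sa)// !scale1r. Qed.
Lemma cs_mul0l a : S a -> 0 ** a = 0.
Proof.
by move=> Sa; apply: (addrI (0 ** a)); rewrite -cs_mulDl ?addr0//; exact: cs0.
Qed.
Lemma cs_mul0r a : S a -> a ** 0 = 0.
Proof.
by move=> Sa; apply: (addrI (a ** 0)); rewrite -cs_mulDr ?addr0//; exact: cs0.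
Qed.
Lemma cs_mulZl (z : C) a b : S a -> S b -> (z *: a) ** b = z *: (a ** b).
Proof.
move=> Sa Sb; rewrite -[z *: a]addr0 (sa_mull sa) ?cs_mul0l ?addr0//.
exact: cs0.
Qed.
Lemma cs_mulZr (z : C) a b : S a -> S b -> b ** (z *: a) = z *: (b ** a).
Proof.
move=> Sa Sb; rewrite -[z *: a]addr0 (sa_mulr sa) ?cs_mul0r ?addr0//.
exact: cs0.
Qed.
Lemma cs_mulBl a b c : S a -> S b -> S c -> (a - b) ** c = a ** c - b ** c.
Proof.
by move=> Sa Sb Sc; have Sb' := csN Sb; rewrite cs_mulDl// -[- b]scaleN1r cs_mulZl// scaleN1r.
Qed.
Lemma cs_mulBr a b c : S a -> S b -> S c -> c ** (a - b) = c ** a - c ** b.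
Proof.
by move=> Sa Sb Sc; have Sb' := csN Sb; rewrite cs_mulDr// -[- b]scaleN1r cs_mulZr// scaleN1r.
Qed.
Lemma cs_star0 : star 0 = 0.
Proof.
have := sa_star_semilinear sa 1 cs0 cs0.
rewrite scale1r addr0 conjC1 scale1r => e.
by apply: (addrI (star 0)); rewrite addr0 -e.
Qed.
Lemma cs_starD a b : S a -> S b -> star (a + b) = star a + star b.
Proof.
move=> Sa Sb; have := sa_star_semilinear sa 1 Sa Sb.
by rewrite conjC1 !scale1r.
Qed.
Lemma cs_starZ (z : C) a : S a -> star (z *: a) = (z^* : C) *: star a.
Proof.
by move=> Sa; have := sa_star_semilinear sa z Sa cs0; rewrite !addr0 cs_star0 addr0.
Qed.
Lemma cs_starB a b : S a -> S b -> star (a - b) = star a - star b.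
Proof.
move=> Sa Sb; have Sb' := csN Sb; rewrite cs_starD// -[- b]scaleN1r cs_starZ//.
by rewrite rmorphN /= conjC1 scaleN1r.
Qed.

Lemma cs_normN a : S a -> N (- a) = N a.
Proof. by move=> Sa; rewrite -scaleN1r (cn_scale cn)// cabsN normr1 mul1r. Qed.

Lemma cs_norm0 : N 0 = 0.
Proof. by have := cn_scale cn 0 cs0; rewrite scale0r cabs0 mul0r. Qed.

Lemma cs_norm_star a : S a -> N (star a) = N a.
Proof.
have le b : S b -> N b <= N (star b).
  move=> Sb; have Sb' := csS Sb.
  have := cn_cstar cn Sb; have := cn_submult cn Sb' Sb.
  have [b0|bn0] := eqVneq (N b) 0; first by rewrite b0 (cn_ge0 cn).
  have b0 : 0 < N b by rewrite lt_def bn0 (cn_ge0 cn).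
  by move=> h e; move: h; rewrite e expr2 ler_pM2r.
move=> Sa; apply/eqP; rewrite eq_le (le a Sa) andbT.
by have := le _ (csS Sa); rewrite (sa_starK sa).
Qed.

Lemma cs_norm_dist a b : S a -> S b -> N (a - b) = N (b - a).
Proof. by move=> Sa Sb; rewrite -opprB cs_normN//; exact: csB. Qed.

Definition ncvg (u : nat -> A) (l : A) : Prop :=
  forall e : R, 0 < e -> exists n0, forall n, (n0 <= n)%N -> N (u n - l) < e.

Lemma ncvg_unique u l l' : (forall n, S (u n)) -> S l -> S l' ->
  ncvg u l -> ncvg u l' -> l = l'.
Proof.
move=> Su Sl Sl' ul ul'; apply/eqP; rewrite -subr_eq0; apply/eqP.
apply: (cn_eq0 cn); first exact: csB.
apply/eqP; rewrite eq_le (cn_ge0 cn) ?andbT; last exact: csB.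
apply/ler_addgt0Pr => e e0; rewrite add0r.
have e2 : 0 < e / 2 by rewrite divr_gt0.
have [n1 h1] := ul _ e2; have [n2 h2] := ul' _ e2.
have := h1 (maxn n1 n2) (leq_maxl _ _); have := h2 (maxn n1 n2) (leq_maxr _ _).
set v := u _ => h2' h1'; have Sv : S v by exact: Su.
have -> : l - l' = (l - v) + (v - l') by rewrite addrA subrK.
apply: le_trans (cn_triangle cn _ _) _; [exact: csB|exact: csB|].
by rewrite (cs_norm_dist Sl Sv); lra.
Qed.

Lemma ncvg_eq u v l : (forall n, u n = v n) -> ncvg u l -> ncvg v l.
Proof. by move=> uv ul e /ul[n0 h]; exists n0 => n /h; rewrite uv. Qed.

Lemma ncvg_shift u l : ncvg u l -> ncvg (fun n => u n.+1) l.
Proof. by move=> ul e /ul[n0 h]; exists n0 => n nn; apply: h; exact: leqW. Qed.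

Lemma ncvg_cst l : ncvg (fun=> l) l.
Proof. by move=> e e0; exists 0 => n _; rewrite subrr cs_norm0. Qed.

Lemma ncvgD u v l l' : (forall n, S (u n)) -> (forall n, S (v n)) -> S l -> S l' ->
  ncvg u l -> ncvg v l' -> ncvg (fun n => u n + v n) (l + l').
Proof.
move=> Su Sv Sl Sl' ul vl e e0.
have e2 : 0 < e / 2 by rewrite divr_gt0.
have [n1 h1] := ul _ e2; have [n2 h2] := vl _ e2.
exists (maxn n1 n2) => n; rewrite geq_max => /andP[/h1 a1 /h2 a2].
rewrite opprD addrACA; apply: le_lt_trans (cn_triangle cn _ _) _.
- exact: csB.
- exact: csB.
- lra.
Qed.

Lemma ncvgZ (c : nat -> C) (z : C) u l : (forall n, S (u n)) -> S l ->
  (forall e : R, 0 < e -> exists n0, forall n, (n0 <= n)%N -> cabs (c n - z) < e) ->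
  ncvg u l -> ncvg (fun n => c n *: u n) (z *: l).
Proof.
move=> Su Sl cz ul e e0.
have d0 : 0 < e / 2 / (cabs z + 1).
  by rewrite !divr_gt0// ltr_wpDl// cabs_ge0.
have e0' : 0 < e / 2 / (N l + 1).
  by rewrite !divr_gt0// ltr_wpDl// (cn_ge0 cn).
have [n1 h1] := cz _ (ltr01); have [n2 h2] := cz _ e0'; have [n3 h3] := ul _ d0.
exists (maxn n1 (maxn n2 n3)) => n; rewrite !geq_max => /and3P[/h1 a1 /h2 a2 /h3 a3].
have -> : c n *: u n - z *: l = c n *: (u n - l) + (c n - z) *: l.
  by rewrite scalerBr scalerBl addrA subrK.
have Sul : S (u n - l) by exact: csB.
apply: le_lt_trans (cn_triangle cn _ _) _; [exact: csZ|exact: csZ|].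
rewrite !(cn_scale cn)//.
have b1 : cabs (c n) <= cabs z + 1.
  have := cabsD (c n - z) z; rewrite subrK; lra.
have g1 := cabs_ge0 (c n - z); have g2 := cn_ge0 cn Sl; have g3 := cn_ge0 cn Sul.
have z0 := cabs_ge0 z.
have a3' : N (u n - l) * (cabs z + 1) < e / 2 by rewrite -ltr_pdivlMr//; lra.
have a2' : cabs (c n - z) * (N l + 1) < e / 2 by rewrite -ltr_pdivlMr//; lra.
have := ler_wpM2r g3 b1; lra.
Qed.

Lemma ncvgM u v l l' : (forall n, S (u n)) -> (forall n, S (v n)) -> S l -> S l' ->
  ncvg u l -> ncvg v l' -> ncvg (fun n => u n ** v n) (l ** l').
Proof.
move=> Su Sv Sl Sl' ul vl e e0.
have d0 : 0 < e / 2 / (N l' + 1).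
  by rewrite !divr_gt0// ltr_wpDl// (cn_ge0 cn).
have e0' : 0 < e / 2 / (N l + 1).
  by rewrite !divr_gt0// ltr_wpDl// (cn_ge0 cn).
have [n1 h1] := ul _ (ltr01); have [n2 h2] := vl _ e0'; have [n3 h3] := ul _ d0.
exists (maxn n1 (maxn n2 n3)) => n; rewrite !geq_max => /and3P[/h1 a1 /h2 a2 /h3 a3].
have -> : u n ** v n - l ** l' = u n ** (v n - l') + (u n - l) ** l'.
  by rewrite cs_mulBr// cs_mulBl// addrA subrK.
have Sul : S (u n - l) by exact: csB.
have Svl : S (v n - l') by exact: csB.
apply: le_lt_trans (cn_triangle cn _ _) _; [exact: csM|exact: csM|].
have m1 := cn_submult cn (Su n) Svl; have m2 := cn_submult cn Sul Sl'.
have b1 : N (u n) <= N l + 1.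
  have := cn_triangle cn Sul Sl; rewrite subrK; lra.
have g1 := cn_ge0 cn Sul; have g2 := cn_ge0 cn Svl; have g3 := cn_ge0 cn Sl'.
have g4 := cn_ge0 cn Sl.
have a3' : N (u n - l) * (N l' + 1) < e / 2 by rewrite -ltr_pdivlMr//; lra.
have a2' : N (v n - l') * (N l + 1) < e / 2 by rewrite -ltr_pdivlMr//; lra.
have := ler_wpM2r g2 b1; lra.
Qed.

Lemma ncvg_star u l : (forall n, S (u n)) -> S l -> ncvg u l ->
  ncvg (fun n => star (u n)) (star l).
Proof.
move=> Su Sl ul e /ul[n0 h]; exists n0 => n /h.
by rewrite -cs_starB// cs_norm_star//; exact: csB.
Qed.

End CstarLimits.

(** * Square roots in a C*-algebra *)

Section SquareRoots.
Variables (R : realType) (A : normedStarData R) (S : set A).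
Hypothesis HS : cstar_algebra_on S.
Local Notation C := R[i].
Local Notation "a ** b" := (nsd_mul a b) (at level 40, left associativity).
Local Notation star := (@nsd_star R A).
Local Notation N := (@nsd_norm R A).
Local Notation q := (@sqrt_scalar R).

Let sa := HS.1.
Let cn := HS.2.

(** With [y_n] for its terms and [q_n] for [sqrt_scalar n], [q_n - y_n] is the iteration
    [op_iter] for [1 - a]. The terms [y_n] make sense in an algebra without unit. *)
Fixpoint root_seq (a : A) (n : nat) : A :=
  if n is k.+1 then
    (2^-1 : C) *: (a + ((2 * q k)%:C)%C *: root_seq a k - root_seq a k ** root_seq a k)
  else 0.

Lemma root_seq_in a n : S a -> S (root_seq a n).
Proof.
move=> Sa; elim: n => [|n IH] /=; first exact: (cs0 HS).
apply: (csZ HS); apply: (csB HS); last exact: (csM HS).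
by apply: (csD HS) => //; exact: (csZ HS).
Qed.

Lemma root_seq_star a n : S a -> star a = a -> star (root_seq a n) = root_seq a n.
Proof.
move=> Sa aa; elim: n => [|n IH] /=; first exact: (cs_star0 HS).
have Sy := root_seq_in n Sa; have Syy := csM HS Sy Sy.
have Szy := csZ HS (((2 * q n)%:C)%C) Sy; have Sayz := csD HS Sa Szy.
rewrite (cs_starZ HS); last exact: (csB HS).
rewrite (cs_starB HS)// (cs_starD HS)// (cs_starZ HS)// (sa_starM sa)// IH aa.
by rewrite conjC_real fmorphV rmorph_nat.
Qed.

(** As [q_n] tends to [1], the limit satisfies [2 b = a + 2 b - b^2]. *)
Lemma root_seq_limit a : S a -> star a = a ->
  (forall e : R, 0 < e -> exists n0, forall m n,
     (n0 <= m)%N -> (n0 <= n)%N -> N (root_seq a m - root_seq a n) < e) ->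
  exists b, [/\ S b, star b = b & b ** b = a].
Proof.
move=> Sa aa ca; have Sy n := root_seq_in n Sa.
have [b Sb yb] := cn_complete cn Sy ca.
have {}yb : ncvg (root_seq a) b by [].
exists b; split => //.
  apply: (@ncvg_unique _ _ _ HS (root_seq a)) => //; first exact: (csS HS).
  apply: ncvg_eq (ncvg_star HS Sy Sb yb) => n; exact: root_seq_star.
have q1 e : 0 < e -> exists n0, forall n, (n0 <= n)%N ->
    cabs (((2 * q n)%:C)%C - (2 : C)) < e.
  move=> e0; have e2 : 0 < e / 2 by rewrite divr_gt0.
  have [n0 h] := sqrt_scalar_near e2; exists n0 => n /h {}h.
  have -> : ((2 * q n)%:C)%C - (2 : C) = - ((2 - 2 * q n)%:C)%C.
    by rewrite -opprB rmorphB rmorph_nat.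
  by have /andP[_ qn] := sqrt_scalar_bounds R n; rewrite cabsN cabs_real; lra.
have Szy n : S (((2 * q n)%:C)%C *: root_seq a n) by exact: (csZ HS).
have Syy n : S (root_seq a n ** root_seq a n) by exact: (csM HS).
have S2b : S ((2 : C) *: b) by exact: (csZ HS).
have Sbb : S (b ** b) by exact: (csM HS).
have h1 : ncvg (fun n => a + ((2 * q n)%:C)%C *: root_seq a n) (a + (2 : C) *: b).
  apply: (ncvgD HS) => //; first exact: (ncvg_cst HS).
  exact: (ncvgZ HS).
have h2 : ncvg (fun n => (-1 : C) *: (root_seq a n ** root_seq a n)) ((-1 : C) *: (b ** b)).
  apply: (ncvgZ HS) => //; last exact: (ncvgM HS).
  by move=> e e0; exists 0%N => n _; rewrite subrr cabs0.
have h3 : ncvg (fun n => (2^-1 : C) *: ((a + ((2 * q n)%:C)%C *: root_seq a n) +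
    (-1 : C) *: (root_seq a n ** root_seq a n)))
    ((2^-1 : C) *: ((a + (2 : C) *: b) + (-1 : C) *: (b ** b))).
  apply: (ncvgZ HS).
  - by move=> n; apply: (csD HS); [exact: (csD HS)|exact: (csZ HS)].
  - by apply: (csD HS); [exact: (csD HS)|exact: (csZ HS)].
  - by move=> e e0; exists 0%N => n _; rewrite subrr cabs0.
  - apply: (ncvgD HS) => //.
    + by move=> n; exact: (csD HS).
    + by move=> n; exact: (csZ HS).
    + exact: (csD HS).
    + exact: (csZ HS).
have e : b = (2^-1 : C) *: ((a + (2 : C) *: b) + (-1 : C) *: (b ** b)).
  apply: (@ncvg_unique _ _ _ HS (fun n => root_seq a n.+1)) => //.
  - by apply: (csZ HS); apply: (csD HS); [exact: (csD HS)|exact: (csZ HS)].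
  - exact: ncvg_shift.
  - by apply: ncvg_eq h3 => n; rewrite scaleN1r.
have {}e : (2 : C) *: b = a + (2 : C) *: b - b ** b.
  by rewrite {1}e scalerA divff ?scale1r ?scaleN1r// pnatr_eq0.
apply/esym/eqP; rewrite -subr_eq0; apply/eqP.
apply: (addrI ((2 : C) *: b)); rewrite addr0 {2}e.
by rewrite addrA [_ + a]addrC.
Qed.

(** The iteration [op_iter] for an element [h] of the algebra. *)
Fixpoint contr_seq (h : A) (n : nat) : A :=
  if n is k.+1 then (2^-1 : C) *: (h + contr_seq h k ** contr_seq h k) else 0.

Lemma contr_seq_in h n : S h -> S (contr_seq h n).
Proof.
move=> Sh; elim: n => [|n IH] /=; first exact: (cs0 HS).
by apply: (csZ HS); apply: (csD HS) => //; exact: (csM HS).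
Qed.

Lemma contr_seq_bound h n : S h -> N h <= 1 -> N (contr_seq h n) <= q n.
Proof.
move=> Sh h1; elim: n => [|n IH] /=; first by rewrite (cs_norm0 HS).
have Sy := contr_seq_in n Sh; have Syy := csM HS Sy Sy.
rewrite (cn_scale cn) ?cabs_half; last exact: (csD HS).
have := cn_triangle cn Sh Syy; have := cn_submult cn Sy Sy.
have y0 := cn_ge0 cn Sy; have := ler_pM y0 y0 IH IH; lra.
Qed.

Lemma contr_seq_step h n : S h -> N h <= 1 ->
  N (contr_seq h n.+1 - contr_seq h n) <= q n.+1 - q n.
Proof.
move=> Sh h1; elim: n => [|n IH].
  have := contr_seq_bound 1 Sh h1; rewrite [contr_seq h 0]/= subr0 [q 0]/=; lra.
have Sy := contr_seq_in n Sh; have Sy' := contr_seq_in n.+1 Sh.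
set y := contr_seq h n in IH Sy *; set y' := contr_seq h n.+1 in IH Sy' *.
have SB := csB HS Sy' Sy.
have -> : contr_seq h n.+2 - y' = (2^-1 : C) *: (y' ** (y' - y) + (y' - y) ** y).
  rewrite [contr_seq h n.+2]/= [in X in _ - X]/y' /= -scalerBr; congr (_ *: _).
  rewrite -/y -/y' [X in X - _]addrC addrKA (cs_mulBr HS)// (cs_mulBl HS)//.
  by rewrite addrA subrK.
rewrite (cn_scale cn); last by apply: (csD HS); exact: (csM HS).
have a0 := cn_triangle cn (csM HS Sy' SB) (csM HS SB Sy).
have a1 := cn_submult cn Sy' SB; have a2 := cn_submult cn SB Sy.
have a3 := contr_seq_bound n Sh h1; have a4 := contr_seq_bound n.+1 Sh h1.
have n0 := cn_ge0 cn SB; have n1 := cn_ge0 cn Sy; have n2 := cn_ge0 cn Sy'.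
have q0 := sqrt_scalar_ge0 R n.
rewrite -/y in a3; rewrite -/y' in a4.
have a5 := ler_pM n2 n0 a4 IH; have a6 := ler_pM n0 n1 IH a3.
have -> : q n.+2 - q n.+1 = (q n.+1 ^+ 2 - q n ^+ 2) / 2 by rewrite /=; field.
rewrite cabs_half; lra.
Qed.

(** [1 - s] is the square root of [1 - h], in a form that needs no unit. *)
Lemma contraction_root h : S h -> star h = h -> N h <= 1 ->
  exists s, [/\ S s, star s = s & (2 : C) *: s = h + s ** s].
Proof.
move=> Sh hh h1; have Sy n := contr_seq_in n Sh.
have step n k : N (contr_seq h (n + k)%N - contr_seq h n) <= q (n + k)%N - q n.
  elim: k => [|k IH]; first by rewrite addn0 !subrr (cs_norm0 HS).
  rewrite addnS (_ : contr_seq h (n + k).+1 - _ = (contr_seq h (n + k).+1 -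
     contr_seq h (n + k)%N) + (contr_seq h (n + k)%N - contr_seq h n)).
    apply: le_trans (cn_triangle cn _ _) _; [exact: (csB HS)|exact: (csB HS)|].
    have := contr_seq_step (n + k) Sh h1; lra.
  by rewrite addrA subrK.
have cau : forall e : R, 0 < e -> exists n0, forall m n,
     (n0 <= m)%N -> (n0 <= n)%N -> N (contr_seq h m - contr_seq h n) < e.
  move=> e e0; have [n0 hn] := sqrt_scalar_near e0; exists n0 => m n.
  wlog mn : m n / (n <= m)%N.
    move=> H; case/orP: (leq_total n m) => mn a b; first exact: H.
    by rewrite (cs_norm_dist HS)//; exact: H.
  move=> _ /hn hq; have := step n (m - n)%N; rewrite subnKC//.
  have /andP[_ ] := sqrt_scalar_bounds R m; lra.
have [s Ss ys] := cn_complete cn Sy cau.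
have {}ys : ncvg (contr_seq h) s by [].
exists s; split => //.
  apply: (@ncvg_unique _ _ _ HS (contr_seq h)) => //; first exact: (csS HS).
  apply: ncvg_eq (ncvg_star HS Sy Ss ys) => n.
  elim: n => [|n IH] /=; first exact: (cs_star0 HS).
  have Syy := csM HS (Sy n) (Sy n).
  rewrite (cs_starZ HS) ?(cs_starD HS)// ?(sa_starM sa)// ?IH ?hh; last exact: (csD HS).
  by rewrite fmorphV rmorph_nat.
have Sss := csM HS Ss Ss.
have e : s = (2^-1 : C) *: (h + s ** s).
  apply: (@ncvg_unique _ _ _ HS (fun n => contr_seq h n.+1)) => //.
  - by apply: (csZ HS); exact: (csD HS).
  - exact: ncvg_shift.
  - apply: (@ncvgZ _ _ _ HS (fun=> 2^-1) 2^-1 (fun n => h + contr_seq h n ** contr_seq h n)).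
    + by move=> n; apply: (csD HS) => //; exact: (csM HS).
    + exact: (csD HS).
    + by move=> e e0; exists 0%N => n _; rewrite subrr cabs0.
    + apply: (ncvgD HS) => //.
      * by move=> n; exact: (csM HS).
      * exact: (ncvg_cst HS).
      * exact: (ncvgM HS).
by rewrite {1}e scalerA divff ?scale1r// pnatr_eq0.
Qed.

(** [z = a + i b] is normal with [z^* z = a^2 + b^2], and [a] is the mean of [z] and its
    adjoint, which have the same norm. *)
Lemma cs_norm_sum_squares a b : S a -> S b -> star a = a -> star b = b ->
  a ** b = b ** a -> N a ^+ 2 <= N (a ** a + b ** b).
Proof.
move=> Sa Sb aa bb ab.
have Sib := csZ HS ('i : C) Sb; have Sz := csD HS Sa Sib.
have Szs := csS HS Sz.
have ii : ('i : C) * 'i = -1 by rewrite -expr2 sqrCi.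
have zsE : star (a + ('i : C) *: b) = a - ('i : C) *: b.
  by rewrite (cs_starD HS)// (cs_starZ HS)// aa bb conjCi scaleNr.
have <- : star (a + ('i : C) *: b) ** (a + ('i : C) *: b) = a ** a + b ** b.
  rewrite zsE (cs_mulBl HS)// !(cs_mulDr HS)// !(cs_mulZl HS)// !(cs_mulZr HS)//.
  by rewrite scalerA ii scaleN1r ab opprD opprK addrA addrK.
rewrite (cn_cstar cn)//; apply: lerXn2r; rewrite ?nnegrE ?(cn_ge0 cn)//.
have e : (2 : C) *: a = (a + ('i : C) *: b) + star (a + ('i : C) *: b).
  by rewrite zsE addrACA subrr addr0 scaler_nat.
have := cn_scale cn (2 : C) Sa; rewrite e => e'.
have := cn_triangle cn Sz Szs; rewrite (cs_norm_star HS)// e'.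
by rewrite -(rmorph_nat (real_complex R) 2) cabs_real//; lra.
Qed.

End SquareRoots.

(** * Positivity from semi-inner products *)

Section PositiveOperators.
Variables (R : realType) (V : lmodType R[i]) (s : V -> V -> R[i]).
Hypothesis sP : semi_inner s.
Variable a : V -> V.
Hypothesis aL : forall (z : R[i]) u v, a (z *: u + v) = z *: a u + a v.
Hypothesis a_sym : forall u v, s (a u) v = s u (a v).
Hypothesis a_pos : forall u, 0 <= s u (a u).
Hypothesis a_contr : forall u, s (a u) (a u) <= s u u.

Let B u v := s u (a v).

Let BP : semi_inner B.
Proof.
split=> [z h k k'|h k|h]; last exact: a_pos.
- by rewrite /B aL (si_linear sP).
- by rewrite /B (si_conj sP) a_sym.
Qed.

Let le_of_sq (z w : R[i]) : 0 <= w -> `|z| ^+ 2 <= w * w -> `|z| <= w.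
Proof.
by move=> w0; rewrite -expr2 ler_pXn2r// ?nnegrE.
Qed.

(** Since [a^2 <= a], as follows from two applications of Cauchy-Schwarz. *)
Lemma positive_contraction_compl u : s (u - a u) (u - a u) <= s u u.
Proof.
have BB w : B w w <= s w w.
  rewrite -[B w w]ger0_norm ?a_pos//; apply: le_of_sq; first exact: (si_ge0 sP).
  apply: le_trans (si_CS sP _ _) _.
  by rewrite ler_wpM2l ?(si_ge0 sP).
have tB : s (a u) (a u) <= B u u.
  have [->|t0] := eqVneq (s (a u) (a u)) 0; first exact: a_pos.
  have tp : 0 < s (a u) (a u) by rewrite lt_def t0 (si_ge0 sP).
  have := si_CS BP (a u) u; rewrite {1}/B ger0_norm ?(si_ge0 sP)// expr2.
  move=> /le_trans/(_ (ler_wpM2r (a_pos u) (BB (a u)))).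
  by rewrite ler_pM2l.
rewrite (si_Br sP) !(si_Bl sP) a_sym -/(B u u) opprB -addrA gerDl.
rewrite -[leRHS]addr0; apply: lerD; last by rewrite subr_le0.
rewrite oppr_le0; exact: a_pos.
Qed.

End PositiveOperators.

Section PositiveElements.
Variables (R : realType) (A : normedStarData R) (S : set A).
Hypothesis HS : cstar_algebra_on S.
Local Notation C := R[i].
Local Notation "a ** b" := (nsd_mul a b) (at level 40, left associativity).
Local Notation star := (@nsd_star R A).
Local Notation N := (@nsd_norm R A).
Local Notation q := (@sqrt_scalar R).
Variables (V : lmodType C) (P : Type) (s : P -> V -> V -> C) (rho : A -> V -> V).
Hypothesis sP : forall p, semi_inner (s p).
Hypothesis rhoL : forall (z : C) g u v, S g ->
  rho g (z *: u + v) = z *: rho g u + rho g v.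
Hypothesis rho_lin : forall (z : C) g g' v, S g -> S g' ->
  rho (z *: g + g') v = z *: rho g v + rho g' v.
Hypothesis rhoM : forall g g' v, S g -> S g' -> rho (g ** g') v = rho g (rho g' v).
Variable K : R.
Hypothesis K0 : 0 <= K.
Hypothesis normK : forall g (e : R), S g -> 0 <= e ->
  (forall p u, semi_norm (s p) (rho g u) <= e * semi_norm (s p) u) -> N g <= K * e.

Let sa := HS.1.
Let cn := HS.2.

Let rho0 g : S g -> rho g 0 = 0.
Proof.
move=> Sg; have := rhoL 1 0 0 Sg; rewrite !scale1r addr0 => e.
by apply: (addrI (rho g 0)); rewrite addr0 -e.
Qed.
Let rho0l v : rho 0 v = 0.
Proof.
have := rho_lin 1 v (cs0 HS) (cs0 HS); rewrite !scale1r addr0 => e.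
by apply: (addrI (rho 0 v)); rewrite addr0 -e.
Qed.
Let rhoZ (z : C) g u : S g -> rho g (z *: u) = z *: rho g u.
Proof. by move=> Sg; rewrite -[z *: u]addr0 rhoL// rho0// addr0. Qed.
Let rhoB g u v : S g -> rho g (u - v) = rho g u - rho g v.
Proof. by move=> Sg; rewrite addrC -scaleN1r rhoL// scaleN1r addrC. Qed.
Let rhoZl (z : C) g u : S g -> rho (z *: g) u = z *: rho g u.
Proof.
by move=> Sg; have := rho_lin z u Sg (cs0 HS); rewrite addr0 rho0l addr0.
Qed.
Let rhoDl g g' u : S g -> S g' -> rho (g + g') u = rho g u + rho g' u.
Proof. by move=> Sg Sg'; have := rho_lin 1 u Sg Sg'; rewrite !scale1r. Qed.
Let rhoBl g g' u : S g -> S g' -> rho (g - g') u = rho g u - rho g' u.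
Proof.
move=> Sg Sg'; rewrite rhoDl//; last exact: (csN HS).
by rewrite -[- g']scaleN1r rhoZl// scaleN1r.
Qed.

Section Contraction.
Variable a : A.
Hypotheses (Sa : S a) (aa : star a = a).
Hypothesis a_sym : forall p u v, s p (rho a u) v = s p u (rho a v).
Hypothesis a_pos : forall p u, 0 <= s p u (rho a u).
Hypothesis a_contr : forall p u, s p (rho a u) (rho a u) <= s p u u.

Let h v := v - rho a v.

Let root_rho n v : rho (root_seq a n) v = ((q n)%:C)%C *: v - op_iter h n v.
Proof.
elim: n v => [|n IH] v /=; first by rewrite rho0l scale0r subr0.
have Sy := root_seq_in HS n Sa; set y := root_seq a n in IH Sy *.
have Syy : S (y ** y) by exact: (csM HS).
have Szy (z : C) : S (z *: y) by exact: (csZ HS).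
rewrite rhoZl; last by apply: (csB HS) => //; exact: (csD HS).
rewrite rhoBl//; last exact: (csD HS).
rewrite rhoDl// rhoZl// rhoM//.
have -> : ((((1 + q n ^+ 2) / 2)%:C)%C : C) = 2^-1 * (1 + (q n)%:C%C ^+ 2).
  by rewrite mulrC rmorphM rmorphD rmorphXn rmorph1 fmorphV rmorph_nat.
rewrite -scalerA -scalerBr; congr (_ *: _).
have -> : ((2 * q n)%:C)%C = 2 * (q n)%:C%C :> C by rewrite rmorphM rmorph_nat.
set c : C := (q n)%:C%C.
have tE w : op_iter h n w = c *: w - rho y w by rewrite IH -/c opprB addrC subrK.
rewrite !tE /h rhoB// rhoZ// scalerBr scalerA scalerDl scale1r -expr2 -scalerA scaler_nat mulr2n.
set x := c *: rho y v; set w := c ^+ 2 *: v; set z := rho y (rho y v).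
apply/esym; rewrite opprD addrACA opprB [v + _]addrCA subrr addr0 -[RHS]addrA; congr (_ + _).
by rewrite opprB opprB addrC -addrA subrK addrAC.
Qed.

Lemma root_seq_of_forms : exists b, [/\ S b, star b = b & b ** b = a].
Proof.
apply: (root_seq_limit HS) => // e e0.
have e4 : 0 < e / (2 * (K + 1)) by rewrite divr_gt0// mulr_gt0// ltr_wpDl.
have [n0 hn] := sqrt_scalar_near e4; exists n0 => m n.
wlog mn : m n / (n <= m)%N.
  move=> H; case/orP: (leq_total n m) => mn i j; first exact: H.
  by rewrite (cs_norm_dist HS) ?H//; exact: root_seq_in.
move=> _ /hn hq.
have qmn := sqrt_scalar_homo R mn; have /andP[_ qm] := sqrt_scalar_bounds R m.
have Sm := root_seq_in HS m Sa; have Sn := root_seq_in HS n Sa.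
apply: le_lt_trans (_ : K * (2 * (q m - q n)) < e); last first.
  have : (q m - q n) * (2 * (K + 1)) < e.
    rewrite -ltr_pdivlMr; last by rewrite mulr_gt0// ltr_wpDl.
    by apply: le_lt_trans hq; rewrite lerB.
  have := mulr_ge0 K0 (_ : 0 <= q m - q n); rewrite subr_ge0 => /(_ qmn); lra.
apply: normK; [exact: (csB HS)|lra|] => p u.
have -> : rho (root_seq a m - root_seq a n) u = ((q m - q n)%:C)%C *: u +
    (-1 : C) *: (op_iter h m u - op_iter h n u).
  rewrite rhoBl// !root_rho rmorphB scalerBl scaleN1r !opprB addrACA [RHS]addrACA.
  by congr (_ + _); rewrite addrC.
apply: le_trans (si_normD (sP p) _ _) _.
rewrite !(si_normZ (sP p)) cabs_real ?subr_ge0// cabsN normr1 mul1r.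
have hD (z : C) v w : h (z *: v + w) = z *: h v + h w.
  by rewrite /h rhoL// scalerBr opprD addrACA.
have hm v : semi_norm (s p) (h v) <= semi_norm (s p) v.
  rewrite -[leRHS]mul1r; apply/(si_norm_le (sP p)) => //.
  rewrite expr1n mul1r.
  exact: (positive_contraction_compl (sP p) (fun z u v => rhoL z u v Sa)
    (a_sym p) (a_pos p) (a_contr p)).
have := op_iter_cauchy (si_normD (sP p)) (si_normZ (sP p)) hD hm n (m - n) u.
rewrite subnKC// -/(op_iter h).
lra.
Qed.
End Contraction.

(** Square roots without spectral theory: for each semi-inner product [s p], the
    representation [rho] turns [root_seq] into [op_iter] for a contraction, and
    [normK] carries the Cauchy estimate back to the norm of the algebra. *)
Lemma positive_in_of_forms (a : A) (M : R) : S a -> star a = a ->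
  (forall p u v, s p (rho a u) v = s p u (rho a v)) ->
  (forall p u, 0 <= s p u (rho a u)) -> 0 <= M ->
  (forall p u, semi_norm (s p) (rho a u) <= M * semi_norm (s p) u) ->
  positive_in S a.
Proof.
move=> Sa aa a_sym a_pos M0 a_bd.
have M1 : 0 < M + 1 by rewrite ltr_wpDl.
pose c : C := (((M + 1)^-1)%:C)%C.
have c0 : 0 <= c by rewrite ler0c invr_ge0 ltW.
have Sca : S (c *: a) by exact: (csZ HS).
have [||p u v|p u|p u|b [Sb bb b2]] := @root_seq_of_forms (c *: a).
- exact: Sca.
- by rewrite (cs_starZ HS)// conjC_real aa.
- by rewrite !rhoZl// (si_Zr (sP p)) (si_Zl (sP p)) conjC_real a_sym.
- by rewrite rhoZl// (si_Zr (sP p)) mulr_ge0.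
- rewrite -[leRHS]mul1r -(expr1n _ 2).
  have /(si_norm_le (sP p) _ _ ler01) :
      semi_norm (s p) (rho (c *: a) u) <= 1 * semi_norm (s p) u.
    rewrite rhoZl// (si_normZ (sP p)) cabs_real ?invr_ge0 ?(ltW M1)// mul1r.
    rewrite ler_pdivrMl//; have := a_bd p u; have := si_norm_ge0 (s p) u; lra.
  by rewrite !expr1n.
exists (((Num.sqrt (M + 1))%:C)%C *: b); first exact: (csZ HS).
rewrite (cs_starZ HS)// conjC_real bb (cs_mulZl HS)//; last exact: (csZ HS).
rewrite (cs_mulZr HS)// b2 !scalerA -!rmorphM /= -expr2 sqr_sqrtr ?(ltW M1)//.
by rewrite mulfV ?gt_eqF// scale1r.
Qed.

End PositiveElements.

(** * The norm of the crossed product *)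

Section CrossedNorm.
Variables (R : realType) (X : topologicalType) (W : finGroupType).
Variables (T : twisted_action R X W) (N : twisted_crossed R X W -> R).
Hypothesis N_cstar : @cstar_norm_on R (tc_alg T N) setT.
Local Notation C := R[i].
Local Notation act := (ta_act T).
Local Notation gamma := (ta_gamma T).
Local Notation A := (tc_alg T N).
Implicit Types (f g h : {ffun W -> C0 R X}) (b c : C0 R X).

Lemma tc_cstar : @cstar_algebra_on R A setT.
Proof. by split => //; exact: tc_star_algebra. Qed.

Let e b : {ffun W -> C0 R X} := tc_single 1%g b.

Let eM b c : tc_mul T (e b) (e c) = e (C0_mul b c).
Proof.
apply: tc_ext => t x; rewrite tc_mul_single1 !tc_singleE.
by case: eqP => [->|_]; rewrite ?invg1 ?ta_act1 ?mul0r.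
Qed.

Let eS b : tc_star T (e b) = e (C0_conj b).
Proof.
apply: tc_ext => t x; rewrite tc_starE !tc_singleE invg_eq1.
case: eqP => [->|_]; last by rewrite conjC0 mulr0.
by rewrite invg1 ta_act1 ta_gamma1l conjC1 mul1r.
Qed.

(** As [b^2 <= b], the norm of a sum of squares gives [N(b)^2 <= N(b)]. *)
Let e_norm_le1 b : (forall x, 0 <= b x) -> (forall x, b x <= 1) -> N (e b) <= 1.
Proof.
move=> b0 b1.
have bc x : (b x : C)^* = b x by apply: CrealP; exact: ger0_real.
pose d := C0_sqrt (b - C0_mul b b).
have dd : C0_mul d d = b - C0_mul b b.
  apply: C0_ext => x; rewrite /= -[LHS]/(d x * d x) C0_sqrtK// C0B subr_ge0.
  by rewrite /= ler_piMr.
have := cs_norm_sum_squares tc_cstar (a := e b) (b := e d) I I.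
rewrite /= !eS !eM dd.
have -> : C0_conj b = b by apply: C0_ext => x; exact: bc.
have -> : C0_conj d = d by apply: C0_ext => x; exact: C0_sqrt_conj.
have -> : C0_mul b d = C0_mul d b by apply: C0_ext => x /=; rewrite mulrC.
move=> /(_ erefl erefl erefl).
have -> : (e (C0_mul b b) + e (b - C0_mul b b) : {ffun W -> C0 R X}) = e b.
  apply: tc_ext => t x; rewrite tcD !tc_singleE; case: eqP => _; last by rewrite addr0.
  by rewrite C0B addrC subrK.
have := cn_ge0 N_cstar (a := e b) I; rewrite -[nsd_norm _]/(N (e b)); nra.
Qed.

Let e_norm_ge0 b : (forall x, 0 <= b x) -> N (e b) <= C0_norm b.
Proof.
move=> b0; have n0 := C0_norm_ge0 b.
have [bn0|bn] := eqVneq (C0_norm b) 0.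
  have -> : e b = 0.
    apply: tc_ext => t x; rewrite tc_singleE tc0; case: eqP => // _.
    by apply: cabs_eq0; apply/eqP; rewrite eq_le cabs_ge0 andbT -bn0 C0_norm_ge.
  by have -> : N 0 = 0 by exact: (cs_norm0 tc_cstar).
have np : 0 < C0_norm b by rewrite lt_def bn n0.
pose z : C := (((C0_norm b)^-1)%:C)%C.
have z0 : 0 <= z by rewrite ler0c invr_ge0.
have : N (e (z *: b)) <= 1.
  apply: e_norm_le1 => x; rewrite C0Z; first by rewrite mulr_ge0.
  rewrite -[b x]ger0_norm// cabsE -rmorphM /= -[1]/((1 : R)%:C%C) lecR.
  by rewrite mulrC ler_pdivrMr// mul1r C0_norm_ge.
have -> : e (z *: b) = z *: (e b : twisted_crossed R X W).
  by apply: tc_ext => t x; rewrite tcZ !tc_singleE; case: eqP; rewrite ?mulr0.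
have -> : N (z *: (e b : twisted_crossed R X W)) = cabs z * N (e b).
  exact: (cn_scale N_cstar z (I : [set: A] (e b))).
rewrite cabs_real ?invr_ge0//.
by rewrite mulrC ler_pdivrMr// mul1r.
Qed.

(** The C*-identity leads back to [C_0(X)], where [(b w)^* (b w)] lies. *)
Lemma tc_single_norm w b : N (tc_single w b) <= C0_norm b.
Proof.
have n0 : 0 <= N (tc_single w b) := cn_ge0 N_cstar (I : [set: A] (tc_single w b)).
have E : N (e (C0_translate T w^-1%g (C0_mul (C0_conj b) b))) = N (tc_single w b) ^+ 2.
  rewrite -[RHS](cn_cstar N_cstar (I : [set: A] (tc_single w b))).
  congr N; apply/esym.
  apply: tc_ext => t x.
  rewrite -[LHS]/(tc_mul T (tc_star T (tc_single w b)) (tc_single w b) t x).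
  rewrite tc_mul_single tc_starE !tc_singleE invMg invgK.
  rewrite -[X in _ == X]mulg1 (inj_eq (mulgI w)) invg_eq1.
  case: eqP => [->|_]; last by rewrite conjC0 !(mulr0, mul0r).
  by rewrite invg1 mulg1 mul1g /= invgK !mulrA gamma_mulJ mul1r.
rewrite -(@ler_pXn2r _ 2)// ?nnegrE ?C0_norm_ge0// -E.
apply: le_trans (e_norm_ge0 _) _ => [x|].
  by rewrite /= mulrC mul_conjC_ge0.
apply: C0_norm_le => [|x]; first by rewrite exprn_ge0// C0_norm_ge0.
set p := act w^-1^-1 x; rewrite -[C0_fun _ _]/((b p : C)^* * b p).
rewrite cabsM cabs_conj -expr2; apply: lerXn2r; rewrite ?nnegrE ?cabs_ge0 ?C0_norm_ge0//.
exact: C0_norm_ge.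
Qed.

Lemma tc_norm_le f (M : R) : 0 <= M -> (forall w x, cabs (f w x) <= M) ->
  N f <= #|W|%:R * M.
Proof.
move=> M0 fM; rewrite [f in N f]tc_sum_single.
have : N (\sum_w (tc_single w (f w) : twisted_crossed R X W)) <=
    \sum_(w : W) C0_norm (f w).
  elim/big_rec2: _ => [|w y1 y2 _ IH]; first by rewrite [N _](cs_norm0 tc_cstar).
  apply: le_trans (cn_triangle N_cstar (I : [set: A] _) (I : [set: A] _)) _.
  by apply: lerD => //; exact: tc_single_norm.
move=> /le_trans; apply; rewrite -sum1_card natr_sum mulr_suml.
by apply: ler_sum => w _; rewrite mul1r; apply: C0_norm_le.
Qed.

(** The coefficient of [w] at [x] is read off at the point [w^-1 x], from a vector
    supported at the neutral element. *)
Lemma tc_entry_bound f (eps : R) : 0 <= eps ->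
  (forall p (c : {ffun W -> C0 R X}),
     semi_norm (tc_form T p) (tc_mul T f c) <= eps * semi_norm (tc_form T p) c) ->
  forall w x, cabs (f w x) <= eps.
Proof.
move=> e0 fe w x.
have [->|f0] := eqVneq (f w x) 0; first by rewrite cabs0.
pose b := C0_translate T w^-1%g (f w).
pose p := act w^-1%g x.
have bp : b p = f w x by rewrite /b /p /= invgK ta_actVr.
have := fe p (e b); move/(si_norm_le (tc_form_semi T p) _ _ e0).
rewrite !tc_formE.
have -> : \sum_u (e b u (act u p) : C)^* * e b u (act u p) = (f w x : C)^* * f w x.
  rewrite (bigD1 1%g)//= big1 ?addr0 ?tc_singleE ?eqxx ?ta_act1 ?bp// => u u1.
  by rewrite tc_singleE (negPf u1) mulr0.
rewrite (bigD1 w)//= tc_mul_single1 ta_actV bp.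
rewrite {1 2}/p ta_actVr; set S := \sum_(_ | _) _ => le1.
have S0 : 0 <= S by apply: sumr_ge0 => u _; rewrite mulrC mul_conjC_ge0.
have {}le1 : (f w x * f w x : C)^* * (f w x * f w x) <=
    (eps ^+ 2)%:C%C * ((f w x : C)^* * f w x).
  by apply: le_trans le1; rewrite lerDl.
move: le1; rewrite -!cabs_sq -rmorphM lecR cabsM exprMn.
have fp : 0 < cabs (f w x).
  by rewrite lt_def cabs_ge0 andbT; apply: contraNneq f0 => /cabs_eq0 ->.
by rewrite ler_pM2r ?exprn_gt0// ler_pXn2r// nnegrE cabs_ge0.
Qed.

(** With [f^* f] a contraction, [1 - f^* f] is a square in the unitization, and
    hence positive for [tc_form]. *)
Lemma tc_form_contraction f p (c : {ffun W -> C0 R X}) :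
  semi_norm (tc_form T p) (tc_mul T f c) <= N f * semi_norm (tc_form T p) c.
Proof.
have sP := tc_form_semi T p; have HA := tc_cstar.
have contr g d : N g <= 1 -> tc_form T p (tc_mul T g d) (tc_mul T g d) <= tc_form T p d d.
  move=> g1; have g0 : 0 <= N g := cn_ge0 N_cstar (I : [set: A] g).
  pose k := tc_mul T (tc_star T g) g.
  have kk : tc_star T k = k by rewrite /k tc_starM tc_starK.
  have k1 : N k <= 1.
    by rewrite [N k](cn_cstar N_cstar (I : [set: A] g)) expr_le1.
  have [s [_ ss s2]] := contraction_root HA (I : [set: A] k) kk k1.
  rewrite -[nsd_star s]/(tc_star T s) -[nsd_mul s s]/(tc_mul T s s) in ss s2.
  rewrite tc_form_adj tc_mulA -/k.
  have := si_ge0 sP (d - tc_mul T s d).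
  rewrite (si_Br sP) !(si_Bl sP) !tc_form_adj ss.
  have e2 : tc_mul T k d = (2 : C) *: (tc_mul T s d : twisted_crossed R X W) -
      tc_mul T s (tc_mul T s d).
    have kE : k = (2 : C) *: (s : twisted_crossed R X W) - tc_mul T s s.
      by rewrite s2 addrK.
    rewrite kE; apply: tc_ext => t x; rewrite tcB tcZ tc_mulA !tc_mulE.
    rewrite mulr_sumr -sumrB; apply: eq_bigr => u _; rewrite tcB tcZ; ring.
  rewrite e2 (si_Br sP) (si_Zr sP) subr_ge0.
  rewrite lerBrDr => le1; apply: le_trans le1.
  by rewrite le_eqVlt; apply/orP; left; apply/eqP; ring.
have n0 : 0 <= N f := cn_ge0 N_cstar (I : [set: A] f).
have [fn0|fn] := eqVneq (N f) 0.
  have -> : f = 0 by exact: (cn_eq0 N_cstar (I : [set: A] f)).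
  rewrite [X in semi_norm _ X](cs_mul0l HA (I : [set: A] c)).
  rewrite /semi_norm (si_0r sP) sqrtr0 mulr_ge0 ?si_norm_ge0//.
  exact: (cn_ge0 N_cstar (I : [set: A] 0)).
have np : 0 < N f by rewrite lt_def fn n0.
pose z : C := (((N f)^-1)%:C)%C.
have zn : cabs z = (N f)^-1 by rewrite cabs_real ?invr_ge0.
have g1 : N (z *: (f : twisted_crossed R X W)) <= 1.
  by rewrite [N _](cn_scale N_cstar z (I : [set: A] f)) zn mulVf.
have := contr _ c g1.
have -> : tc_mul T (z *: (f : twisted_crossed R X W)) c =
    z *: (tc_mul T f c : twisted_crossed R X W).
  exact: (cs_mulZl HA z (I : [set: A] f) (I : [set: A] c)).
rewrite -[leRHS]mul1r -(expr1n _ 2) -[1 ^+ 2]/((1 : R[i]) ^+ 2).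
rewrite -(rmorph1 (real_complex R)) -rmorphXn.
move=> /(si_norm_le sP _ _ ler01).
by rewrite (si_normZ sP) zn mul1r ler_pdivrMl.
Qed.

Lemma tc_coef_le f w x : cabs (f w x) <= N f.
Proof.
apply: tc_entry_bound => [|p c]; last exact: tc_form_contraction.
exact: (cn_ge0 N_cstar (I : [set: A] f)).
Qed.

End CrossedNorm.

(** * The module over the crossed product *)

Section CrossedModule.
Variables (R : realType) (X : topologicalType) (W : finGroupType).
Variables (T : twisted_action R X W) (E : hilbertModule R X).
Variable U : twisted_module_action T E.
Local Notation C := R[i].
Local Notation act := (ta_act T).
Local Notation gamma := (ta_gamma T).
Local Notation "'U_ w" := (tm_U U w) (at level 8, w at level 2, format "''U_' w").
Local Notation "'V_ w" := (tm_Uinv U w) (at level 8, w at level 2, format "''V_' w").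
Implicit Types (xi eta zeta : E) (f g : {ffun W -> C0 R X}) (b : C0 R X).

Lemma hm_semi y : semi_inner (@ip_at R X E y).
Proof. by split; [exact: ip_at_linear|exact: ip_at_conj|exact: ip_at_ge0]. Qed.

Lemma hm_ext xi eta : (forall zeta y, ip_at y zeta xi = ip_at y zeta eta) -> xi = eta.
Proof.
move=> e; apply/eqP; rewrite -subr_eq0; apply/eqP.
apply: (rhm_ip_def (hm_ax E)); apply: C0_ext => y.
by rewrite -[LHS]/(ip_at y _ _) (si_Br (hm_semi y)) e subrr.
Qed.

Lemma ip_at_actl y xi eta b : ip_at y (hm_act xi b) eta = (b y : C)^* * ip_at y xi eta.
Proof. by rewrite -ip_at_conj ip_at_act rmorphM /= ip_at_conj mulrC. Qed.

Lemma hm_actDl (z : C) xi eta b :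
  hm_act (z *: xi + eta) b = z *: hm_act xi b + hm_act eta b.
Proof. exact: (rhm_actl (hm_ax E)). Qed.

Lemma ip_U w y xi eta : ip_at y ('U_w xi) ('U_w eta) = ip_at (act w^-1%g y) xi eta.
Proof. by rewrite /ip_at tm_ip. Qed.

Lemma ip_V w y xi eta : ip_at y eta ('V_w xi) = ip_at (act w y) ('U_w eta) xi.
Proof. by rewrite -{2}[xi](tm_UVK U w) ip_U ta_actV. Qed.

Lemma ip_UU u v y xi eta : ip_at y eta ('U_u ('U_v xi)) =
  (gamma u v y : C)^* * ip_at y eta ('U_(u * v)%g xi).
Proof.
(* The action axiom says that D is annihilated by C_0(X), in particular by its own
   conjugate. *)
pose D : C0 R X := hm_ip eta ('U_u ('U_v xi)) -
  C0_umul (unitary_conj (gamma u v)) (hm_ip eta ('U_(u * v)%g xi)).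
suff : D y = 0 by rewrite C0B => /eqP; rewrite subr_eq0 => /eqP.
have := congr1 (ip_at y eta) (tm_mul U u v xi (C0_conj D)).
rewrite !ip_at_act /= => /eqP; rewrite mulrA -subr_eq0 -mulrBl [_ * (unitary_conj _ _)]mulrC.
rewrite -[X in X * _]/(D y) mulf_eq0 => /orP[/eqP //|].
by rewrite conjC_eq0 => /eqP.
Qed.

Lemma ip_UUl u v y xi eta : ip_at y ('U_u ('U_v xi)) eta =
  gamma u v y * ip_at y ('U_(u * v)%g xi) eta.
Proof. by rewrite -ip_at_conj ip_UU rmorphM /= conjCK ip_at_conj. Qed.

Lemma ip_Umul u v y xi eta : ip_at y eta ('U_(u * v)%g xi) =
  gamma u v y * ip_at y eta ('U_u ('U_v xi)).
Proof. by rewrite ip_UU mulrA gamma_mulJ mul1r. Qed.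

Lemma tm_U1 xi : 'U_1%g xi = xi.
Proof.
apply: (can_inj (tm_UK U 1%g)); apply: hm_ext => eta y.
by rewrite ip_UU ta_gamma1l conjC1 mul1r mulg1.
Qed.

Lemma tm_UD w xi eta : 'U_w (xi + eta) = 'U_w xi + 'U_w eta.
Proof. by rewrite -[xi]scale1r tm_linear !scale1r. Qed.
Lemma tm_U0 w : 'U_w 0 = 0.
Proof. by apply: (addrI ('U_w 0)); rewrite -tm_UD !addr0. Qed.
Lemma tm_UZ w (z : C) xi : 'U_w (z *: xi) = z *: 'U_w xi.
Proof. by rewrite -[z *: xi]addr0 tm_linear tm_U0 addr0. Qed.
Lemma tm_U_sum w I (r : seq I) (P : pred I) (F : I -> E) :
  'U_w (\sum_(i <- r | P i) F i) = \sum_(i <- r | P i) 'U_w (F i).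
Proof. by apply: (big_morph 'U_w); [exact: tm_UD|exact: tm_U0]. Qed.

Lemma tm_V_linear w (z : C) xi eta : 'V_w (z *: xi + eta) = z *: 'V_w xi + 'V_w eta.
Proof. by apply: (can_inj (tm_UK U w)); rewrite tm_linear !tm_UVK. Qed.

Lemma crossed_ipE xi eta w x : crossed_ip U xi eta w x = ip_at x xi ('U_w eta).
Proof. by rewrite ffunE. Qed.

Lemma crossed_ip1 xi eta x : crossed_ip U xi eta 1%g x = ip_at x xi eta.
Proof. by rewrite crossed_ipE tm_U1. Qed.

Lemma ip_crossed_act y eta xi f : ip_at y eta (crossed_act U xi f) =
  \sum_w ip_at (act w y) ('U_w eta) xi * f w (act w y).
Proof.
rewrite /crossed_act (si_sumr (hm_semi y)); apply: eq_bigr => w _.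
by rewrite ip_V ip_at_act.
Qed.

Lemma crossed_ip_linear (z : C) xi eta zeta : crossed_ip U xi (z *: eta + zeta) =
  z *: (crossed_ip U xi eta : {ffun W -> C0 R X}) + crossed_ip U xi zeta.
Proof.
apply: tc_ext => t x; rewrite tcD tcZ !crossed_ipE tm_linear; exact: ip_at_linear.
Qed.

Lemma crossed_ip_act xi eta f :
  crossed_ip U xi (crossed_act U eta f) = tc_mul T (crossed_ip U xi eta) f.
Proof.
apply: tc_ext => t x; rewrite crossed_ipE tc_mulE /crossed_act tm_U_sum.
rewrite (si_sumr (hm_semi x)) (reindex_inj (inj_comp (mulIg t) invg_inj)) /=.
apply: eq_bigr => u _; set v := (u^-1 * t)%g.
have -> : t = (u * v)%g by rewrite mulKVg.
by rewrite ip_Umul tm_UVK tm_act ip_at_act crossed_ipE.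
Qed.

Lemma crossed_ip_star xi eta : tc_star T (crossed_ip U xi eta) = crossed_ip U eta xi.
Proof.
apply: tc_ext => t x; rewrite tc_starE !crossed_ipE ip_at_conj -ip_U ip_UUl.
by rewrite mulgV tm_U1 mulrA gamma_mulJl mul1r.
Qed.

Lemma crossed_ip_actl xi eta f :
  crossed_ip U (crossed_act U xi f) eta = tc_mul T (tc_star T f) (crossed_ip U xi eta).
Proof. by rewrite -crossed_ip_star crossed_ip_act tc_starM crossed_ip_star. Qed.

Lemma crossed_act_linearl (z : C) xi eta f :
  crossed_act U (z *: xi + eta) f = z *: crossed_act U xi f + crossed_act U eta f.
Proof.
rewrite /crossed_act scaler_sumr -big_split /=; apply: eq_bigr => w _.
by rewrite hm_actDl tm_V_linear.
Qed.

Lemma crossed_act_linearr (z : C) xi f g :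
  crossed_act U xi (z *: (f : twisted_crossed R X W) + g) =
  z *: crossed_act U xi f + crossed_act U xi g.
Proof.
rewrite /crossed_act scaler_sumr -big_split /=; apply: eq_bigr => w _.
by rewrite !ffunE (rhm_actr (hm_ax E))// tm_V_linear.
Qed.

Lemma crossed_ip_ext xi eta :
  (forall zeta, crossed_ip U zeta xi = crossed_ip U zeta eta) -> xi = eta.
Proof. by move=> e; apply: hm_ext => zeta y; rewrite -!crossed_ip1 e. Qed.

(** Both sides have the same inner products, by associativity in the crossed product. *)
Lemma crossed_actM xi f g :
  crossed_act U xi (tc_mul T f g) = crossed_act U (crossed_act U xi f) g.
Proof. by apply: crossed_ip_ext => zeta; rewrite !crossed_ip_act tc_mulA. Qed.

Lemma tc_form_crossed_ip x xi f g : tc_form T x f (tc_mul T (crossed_ip U xi xi) g) =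
  ip_at x (crossed_act U xi f) (crossed_act U xi g).
Proof.
by rewrite -crossed_ip1 crossed_ip_act crossed_ip_actl -tc_mulA.
Qed.

Lemma snorm_act y xi b : snorm_at y (hm_act xi b) = cabs (b y) * snorm_at y xi.
Proof.
rewrite /snorm_at /semi_norm ip_at_act ip_at_actl.
have -> : (b y : C)^* * ip_at y xi xi * b y = ((cabs (b y) ^+ 2)%:C)%C * ip_at y xi xi.
  by rewrite cabs_sq; ring.
rewrite [ip_at y xi xi](ge0_ReE (ip_at_ge0 y xi)) -rmorphM /= sqrtrM ?sqr_ge0//.
by rewrite sqrtr_sqr ger0_norm ?cabs_ge0.
Qed.

Lemma cabs_ip_snorm y xi eta : cabs (ip_at y xi eta) <= snorm_at y xi * snorm_at y eta.
Proof.
have CS := si_CS (hm_semi y) xi eta.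
rewrite -(@ler_pXn2r _ 2)// ?nnegrE ?cabs_ge0 ?mulr_ge0 ?sqrtr_ge0//.
rewrite -lecR rmorphXn /= -cabsE exprMn rmorphM /=.
by rewrite !(si_norm_sq (hm_semi y)).
Qed.

Lemma cabs_ip_at y xi eta : cabs (ip_at y xi eta) <= hm_norm xi * hm_norm eta.
Proof.
apply: le_trans (cabs_ip_snorm y xi eta) _.
by apply: ler_pM; rewrite ?sqrtr_ge0 ?snorm_at_le.
Qed.

Lemma snorm_U y w xi : snorm_at y ('U_w xi) = snorm_at (act w^-1%g y) xi.
Proof. by rewrite /snorm_at /semi_norm ip_U. Qed.

Lemma hm_norm_U w xi : hm_norm ('U_w xi) <= hm_norm xi.
Proof.
apply: hm_norm_le => [|y]; first exact: sqrtr_ge0.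
by rewrite snorm_U; exact: snorm_at_le.
Qed.

Lemma cabs_crossed_ip xi eta w x : cabs (crossed_ip U xi eta w x) <= hm_norm xi * hm_norm eta.
Proof.
rewrite crossed_ipE; apply: le_trans (cabs_ip_at _ _ _) _.
by rewrite ler_wpM2l ?sqrtr_ge0// hm_norm_U.
Qed.

Section Norm.
Variable N : twisted_crossed R X W -> R.
Hypothesis N_cstar : @cstar_norm_on R (tc_alg T N) setT.
Local Notation A := (tc_alg T N).

Lemma crossed_ip_norm_ge xi : hm_norm xi <= Num.sqrt (N (crossed_ip U xi xi)).
Proof.
rewrite /hm_norm; apply: ler_wsqrtr; apply: C0_norm_le.
  exact: (cn_ge0 N_cstar (I : [set: A] _)).
by move=> x; have := tc_coef_le N_cstar (crossed_ip U xi xi) 1%g x; rewrite crossed_ip1.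
Qed.

Lemma crossed_ip_norm_le xi eta :
  N (crossed_ip U xi eta) <= #|W|%:R * (hm_norm xi * hm_norm eta).
Proof.
apply: (tc_norm_le N_cstar) => [|w x]; first by rewrite mulr_ge0 ?sqrtr_ge0.
exact: cabs_crossed_ip.
Qed.

(** This norm is equivalent to the norm of [E]. *)
Lemma crossed_ip_complete :
  norm_complete (fun xi : E => Num.sqrt (N (crossed_ip U xi xi))) setT.
Proof.
move=> u _ uC.
have [|l _ ul] := @rhm_complete _ _ _ _ _ _ (hm_ax E) u (fun=> I).
  move=> e /uC[n0 h]; exists n0 => m n hm hn; apply: le_lt_trans (h m n hm hn).
  exact: crossed_ip_norm_ge.
exists l => // e e0.
have W1 : 0 < Num.sqrt (#|W|%:R + 1 : R) by rewrite sqrtr_gt0 ltr_wpDl.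
have [n0 h] := ul _ (divr_gt0 e0 W1); exists n0 => n /h.
rewrite -[Num.sqrt _ in X in X -> _]/(hm_norm (u n - l)); set d := u n - l => dn.
have d0 : 0 <= hm_norm d by exact: sqrtr_ge0.
apply: (@le_lt_trans _ _ (Num.sqrt (#|W|%:R + 1) * hm_norm d)).
  rewrite -[X in _ * X]ger0_norm// -sqrtr_sqr -sqrtrM ?addr_ge0//; apply: ler_wsqrtr.
  apply: le_trans (crossed_ip_norm_le d d) _; rewrite -expr2 ler_wpM2r ?exprn_ge0//.
  by rewrite lerDl.
by rewrite mulrC -ltr_pdivlMr.
Qed.

(** [<<xi|xi>>] acts on the crossed product as a positive operator, because
    [v^* <<xi|xi>> v = <<xi v|xi v>>]. *)
Lemma crossed_ip_positive (S : set A) xi : cstar_algebra_on S ->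
  S (crossed_ip U xi xi) -> positive_in S (crossed_ip U xi xi).
Proof.
move=> HS Sx.
have W0 : 0 <= (#|W|%:R : R) by [].
apply: (@positive_in_of_forms R A S HS (twisted_crossed R X W) X (tc_form T) (tc_mul T)
  _ _ _ _ _ W0 _ _ (N (crossed_ip U xi xi))).
- by move=> p; exact: tc_form_semi.
- by move=> z g u v _; exact: tc_mulr.
- by move=> z g g' v _ _; exact: tc_mull.
- by move=> g g' v _ _; rewrite -tc_mulA.
- move=> g e _ e0 h; apply: (tc_norm_le N_cstar) => // w x.
  exact: (tc_entry_bound e0 h).
- exact: Sx.
- exact: crossed_ip_star.
- by move=> p u v; rewrite tc_form_adj crossed_ip_star.
- by move=> p u; rewrite tc_form_crossed_ip ip_at_ge0.
- exact: (cn_ge0 N_cstar (I : [set: A] _)).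
- by move=> p u; exact: (tc_form_contraction N_cstar).
Qed.

Lemma crossed_right_hilbert (S : set A) : cstar_algebra_on S ->
  (forall xi eta, S (crossed_ip U xi eta)) ->
  right_hilbert_module S (crossed_act U) (crossed_ip U).
Proof.
move=> HS Sip; split.
- by move=> z x y a _; exact: crossed_act_linearl.
- by move=> z x a b _ _; exact: crossed_act_linearr.
- by move=> x a b _ _; exact: crossed_actM.
- exact: Sip.
- by move=> z x y y'; exact: crossed_ip_linear.
- by move=> x y a _; exact: crossed_ip_act.
- by move=> x y; exact: crossed_ip_star.
- by move=> x; apply: crossed_ip_positive.
- move=> x x0; apply: (rhm_ip_def (hm_ax E)); apply: C0_ext => y.
  by rewrite -[LHS]/(ip_at y x x) -crossed_ip1 x0 tc0.
- exact: crossed_ip_complete.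
Qed.

End Norm.

End CrossedModule.

(** * Finite-dimensional Hilbert spaces *)

Section FiniteDimension.
Variable R : realType.
Local Notation C := R[i].

Lemma real_cauchy_limit (u : nat -> R) :
  (forall e : R, 0 < e -> exists n0, forall m n,
     (n0 <= m)%N -> (n0 <= n)%N -> `|u m - u n| < e) ->
  exists l, forall e : R, 0 < e -> exists n0, forall n, (n0 <= n)%N -> `|u n - l| < e.
Proof.
move=> uC.
have /cauchy_cvgP/cvg_ex[/= l ul] : cauchy ((u : nat -> R^o) @ \oo).
  apply: cauchy_exP => e e0; have [n0 h] := uC e e0.
  exists (u n0); exists n0 => // n /= n0n; rewrite /ball /=; exact: h.
exists l => e e0; have /cvgrPdist_lt/(_ e e0)[n0 _ h] := ul.
by exists n0 => n /h; rewrite distrC.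
Qed.

Lemma complex_cauchy_limit (u : nat -> C) :
  (forall e : R, 0 < e -> exists n0, forall m n,
     (n0 <= m)%N -> (n0 <= n)%N -> cabs (u m - u n) < e) ->
  exists l, forall e : R, 0 < e -> exists n0, forall n, (n0 <= n)%N -> cabs (u n - l) < e.
Proof.
have leRe (z : C) : `|complex.Re z| <= cabs z by rewrite -lecR -cabsE normc_ge_Re.
have leIm (z : C) : `|complex.Im z| <= cabs z.
  rewrite -lecR -cabsE; case: z => a b; rewrite normc_def lecR /= -sqrtr_sqr.
  by rewrite ler_wsqrtr// lerDr sqr_ge0.
have leS (z : C) : cabs z <= `|complex.Re z| + `|complex.Im z|.
  case: z => a b; rewrite normc_def /= -[leRHS]ger0_norm ?addr_ge0//.
  rewrite -sqrtr_sqr ler_wsqrtr// sqrrD !real_normK ?num_real//.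
  by rewrite addrAC lerDl mulrn_wge0// mulr_ge0.
move=> uC.
have [|a ha] := @real_cauchy_limit (fun n => complex.Re (u n)).
  move=> e /uC[n0 h]; exists n0 => m n hm hn; rewrite -raddfB.
  exact: le_lt_trans (leRe _) (h _ _ hm hn).
have [|b hb] := @real_cauchy_limit (fun n => complex.Im (u n)).
  move=> e /uC[n0 h]; exists n0 => m n hm hn; rewrite -raddfB.
  exact: le_lt_trans (leIm _) (h _ _ hm hn).
exists (Complex a b) => e e0; have e2 : 0 < e / 2 by rewrite divr_gt0.
have [n1 h1] := ha _ e2; have [n2 h2] := hb _ e2.
exists (maxn n1 n2) => n; rewrite geq_max => /andP[/h1 a1 /h2 a2].
apply: le_lt_trans (leS _) _; rewrite !raddfB /=; lra.
Qed.

Section RowSpaces.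
Variables (n : nat) (A : 'M[C]_n).

Definition dot (u v : 'rV[C]_n) : C := \sum_j (u 0 j)^* * v 0 j.

Lemma dot_semi : semi_inner dot.
Proof.
split=> [z h k k'|h k|h].
- rewrite /dot mulr_sumr -big_split /=; apply: eq_bigr => j _.
  by rewrite !mxE; ring.
- rewrite /dot rmorph_sum /=; apply: eq_bigr => j _.
  by rewrite rmorphM /= conjCK mulrC.
- by rewrite /dot sumr_ge0// => j _; rewrite mulrC mul_conjC_ge0.
Qed.

Lemma dot_def u : dot u u = 0 -> u = 0.
Proof.
move/eqP; rewrite psumr_eq0 => [/allP h|j _]; last by rewrite mulrC mul_conjC_ge0.
apply/rowP => j; rewrite mxE; have := h j; rewrite mem_index_enum => /(_ isT).
by rewrite mulf_eq0 conjC_eq0 orbb => /eqP.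
Qed.

Lemma dot_coord_le (u : 'rV[C]_n) j : cabs (u 0 j) <= semi_norm dot u.
Proof.
rewrite -(@ler_pXn2r _ 2)// ?nnegrE ?cabs_ge0 ?si_norm_ge0// -lecR.
rewrite (si_norm_sq dot_semi) cabs_sq /dot (bigD1 j)//= lerDl sumr_ge0// => k _.
by rewrite mulrC mul_conjC_ge0.
Qed.

Lemma dot_norm_le (u : 'rV[C]_n) (e : R) : 0 <= e -> (forall j, cabs (u 0 j) <= e) ->
  semi_norm dot u <= n%:R * e.
Proof.
move=> e0 ue.
have n0 : 0 <= \sum_j cabs (u 0 j) by apply: sumr_ge0 => j _; exact: cabs_ge0.
apply: (@le_trans _ _ (\sum_j cabs (u 0 j))).
  rewrite -(@ler_pXn2r _ 2)// ?nnegrE ?si_norm_ge0// -lecR.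
  rewrite (si_norm_sq dot_semi) expr2 mulr_suml rmorph_sum /= /dot.
  apply: ler_sum => j _; rewrite -cabs_sq lecR expr2 ler_wpM2l ?cabs_ge0//.
  by rewrite (bigD1 j)//= lerDl sumr_ge0// => k _; exact: cabs_ge0.
apply: le_trans (ler_sum _ (fun j _ => ue j)) _.
by rewrite sumr_const card_ord mulr_natl.
Qed.

Definition row_space_pred : {pred 'rV[C]_n} := fun v => (v <= A)%MS.

Record row_space := RowSpace { row_val :> 'rV[C]_n; row_valP : row_val \in row_space_pred }.

HB.instance Definition _ := [isSub for row_val].
HB.instance Definition _ := [Choice of row_space by <:].

Lemma row_space_submod : submod_closed row_space_pred.
Proof.
split; first exact: sub0mx.
by move=> z u v uA vA; apply: addmx_sub => //; exact: scalemx_sub.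
Qed.

HB.instance Definition _ :=
  GRing.isSubmodClosed.Build C 'rV[C]_n row_space_pred row_space_submod.
HB.instance Definition _ := [SubChoice_isSubLmodule of row_space by <:].

Definition row_ip (u v : row_space) : C := dot u v.

Fact row_ip_linear (z : C) (h k k' : row_space) :
  row_ip h (z *: k + k') = z * row_ip h k + row_ip h k'.
Proof. exact: (si_linear dot_semi). Qed.
Fact row_ip_conj (h k : row_space) : (row_ip h k)^* = row_ip k h.
Proof. exact: (si_conj dot_semi). Qed.
Fact row_ip_ge0 (h : row_space) : 0 <= row_ip h h.
Proof. exact: (si_ge0 dot_semi). Qed.
Fact row_ip_def (h : row_space) : row_ip h h = 0 -> h = 0.
Proof. by move=> /dot_def h0; apply: val_inj. Qed.

(** Coordinatewise limits stay in the row space of [A], which is the solution set of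
    the linear equations given by [cokermx A]. *)
Fact row_complete :
  norm_complete (fun h : row_space => Num.sqrt (complex.Re (row_ip h h))) setT.
Proof.
move=> u _ uC.
have /choice[l hl] j : exists l : C, forall e : R, 0 < e ->
    exists n0, forall k, (n0 <= k)%N -> cabs ((u k : 'rV[C]_n) 0 j - l) < e.
  apply: complex_cauchy_limit => e /uC[n0 h]; exists n0 => k m hk hm.
  have := h _ _ hk hm; apply: le_lt_trans.
  by have := dot_coord_le (val (u k - u m)) j; rewrite !mxE.
pose L : 'rV[C]_n := \row_j l j.
have conv (e : R) : 0 < e -> exists n0, forall k, (n0 <= k)%N ->
    forall j, cabs ((u k : 'rV[C]_n) 0 j - L 0 j) < e.
  move=> e0; have /choice[f hf] j := hl j e e0.
  exists (\max_j f j)%N => k hk j; rewrite mxE; apply: hf.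
  by apply: leq_trans hk; exact: leq_bigmax.
have LA : L \in row_space_pred.
  rewrite -[_ \in _]/(L <= A)%MS submxE; apply/eqP/rowP => i; rewrite [RHS]mxE.
  apply: cabs_eq0; apply/eqP; rewrite eq_le cabs_ge0 andbT; apply/ler_addgt0Pr => e e0.
  rewrite add0r; set K := cokermx A.
  pose M := \sum_j cabs (K j i).
  have M0 : 0 <= M by apply: sumr_ge0 => j _; exact: cabs_ge0.
  have M1 : 0 < M + 1 by rewrite ltr_wpDl.
  have [n0 /(_ n0 (leqnn _)) h] := conv _ (divr_gt0 e0 M1).
  have /eqP/rowP/(_ i) : (val (u n0) *m K) == 0 by rewrite -submxE; exact: row_valP.
  rewrite [RHS]mxE => uK.
  have -> : (L *m K) 0 i = - (((val (u n0) - L) *m K) 0 i).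
    by rewrite mulmxBl !mxE in uK *; rewrite uK sub0r opprK.
  rewrite cabsN mxE; apply: le_trans (cabs_sum _ _ _) _.
  apply: (@le_trans _ _ (\sum_j e / (M + 1) * cabs (K j i))).
    apply: ler_sum => j _; rewrite cabsM ler_wpM2r ?cabs_ge0//.
    by have := h j; rewrite !mxE => /ltW.
  by rewrite -mulr_sumr -/M mulrAC ler_pdivrMr// ler_pM2l// lerDl.
exists (RowSpace LA) => // e e0.
have n1 : 0 < (n%:R + 1 : R) by rewrite ltr_wpDl.
have [n0 h] := conv _ (divr_gt0 e0 n1); exists n0 => k /h {}h.
rewrite -[X in X < _]/(semi_norm dot (val (u k) - L)).
apply: le_lt_trans (@dot_norm_le _ (e / (n%:R + 1)) _ _) _.
- by rewrite divr_ge0// ltW.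
- by move=> j; rewrite !mxE ltW//; have := h j; rewrite !mxE.
- by rewrite mulrA ltr_pdivrMr// mulrC ltr_pM2l// ltrDl.
Qed.

Definition row_hilbert : hilbertSpace R := HilbertSpace row_ip_linear
  row_ip_conj row_ip_ge0 row_ip_def row_complete.

End RowSpaces.

(** A matrix of maximal rank among those with rows in [S] exhausts [S]. *)
Lemma subspace_row_space n (S : set 'rV[C]_n) : lin_subspace S ->
  exists A : 'M[C]_n, forall v, S v <-> (v <= A)%MS.
Proof.
move=> [S0 SL].
have SZ z v : S v -> S (z *: v) by move=> Sv; rewrite -[_ *: _]addr0; exact: SL.
have SD u v : S u -> S v -> S (u + v) by move=> Su Sv; rewrite -[u]scale1r; exact: SL.
pose P k := `[< exists A : 'M[C]_n, (forall v, (v <= A)%MS -> S v) /\ \rank A = k >].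
have P0 : exists k, P k.
  exists 0%N; apply/asboolP; exists 0; rewrite mxrank0; split=> // v.
  by rewrite submx0 => /eqP ->.
have Pn k : P k -> (k <= n)%N by move=> /asboolP[A [_ <-]]; exact: rank_leq_col.
case: (ex_maxnP P0 Pn) => k /asboolP[A [AS rA]] kmax.
exists A => v; split=> [Sv|]; last exact: AS.
have AvS w : (w <= A + v)%MS -> S w.
  by move=> /sub_addsmxP[[u1 u2] /= ->]; apply: SD;
     [apply: AS; exact: submxMl | rewrite [u2]mx11_scalar mul_scalar_mx; exact: SZ].
have : (\rank (A + v)%MS <= \rank A)%N.
  by rewrite rA; apply: kmax; apply/asboolP; exists (A + v)%MS.
rewrite (geq_leqif (mxrank_leqif_sup (addsmxSl A v))) => h.
exact: submx_trans (addsmxSr A v) h.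
Qed.

Lemma subspace_split n (S : set 'rV[C]_n) v : lin_subspace S ->
  exists u, S u /\ forall s, S s -> dot s (v - u) = 0.
Proof.
move=> /subspace_row_space[A SA]; exists (v *m proj_ortho A); split.
  by apply/SA; exact: proj_ortho_sub.
move=> s /SA /submxP[D ->].
have /orthomx1P h := proj_ortho_compl_sub A v.
have := congr1 (fun M => M *m (map_mx Num.conj D^T)) h.
rewrite mul0mx -mulmxA -map_mxM -trmx_mul => /matrixP/(_ 0 0).
rewrite [X in _ = X]mxE mxE => <-; apply: eq_bigr => j _.
by rewrite !mxE mulrC.
Qed.

End FiniteDimension.

(** * Matrix coefficients of a projective representation *)

Section Spans.
Variables (R : realType) (V : lmodType R[i]).
Implicit Types S : set V.

Lemma lin_span_subspace S : lin_subspace (lin_span S).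
Proof.
split; first by exists 0%N, (fun=> 0), (fun=> 0); split; [case|rewrite big_ord0].
move=> z u v [n [a [s [Ss ->]]]] [m [b [t [St ->]]]].
exists (n + m)%N, (fun i => match fintype.split i with inl j => z * a j | inr j => b j end),
  (fun i => match fintype.split i with inl j => s j | inr j => t j end).
split; first by move=> i; case: (fintype.split i).
rewrite big_split_ord /= scaler_sumr; congr (_ + _); apply: eq_bigr => i _.
  by rewrite -[lshift m i]/(unsplit (inl i)) unsplitK scalerA.
by rewrite -[rshift n i]/(unsplit (inr i)) unsplitK.
Qed.

Lemma lin_span_incl S : S `<=` lin_span S.
Proof.
move=> v Sv; exists 1%N, (fun=> 1), (fun=> v); split=> //.
by rewrite big_ord1 scale1r.
Qed.

Lemma lin_subspaceD S u v : lin_subspace S -> S u -> S v -> S (u + v).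
Proof. by move=> [_ SL] Su Sv; rewrite -[u]scale1r; exact: SL. Qed.
Lemma lin_subspaceZ S (z : R[i]) v : lin_subspace S -> S v -> S (z *: v).
Proof. by move=> [S0 SL] Sv; rewrite -[_ *: _]addr0; exact: SL. Qed.
Lemma lin_subspaceB S u v : lin_subspace S -> S u -> S v -> S (u - v).
Proof.
by move=> HS Su Sv; apply: lin_subspaceD => //; rewrite -scaleN1r; exact: lin_subspaceZ.
Qed.
Lemma lin_subspace_sum S I (r : seq I) (P : pred I) (F : I -> V) :
  lin_subspace S -> (forall i, P i -> S (F i)) -> S (\sum_(i <- r | P i) F i).
Proof.
move=> HS SF; elim/big_rec: _ => [|i x Pi Sx]; first exact: HS.1.
by apply: lin_subspaceD => //; exact: SF.
Qed.

Lemma lin_span_min S T : lin_subspace T -> S `<=` T -> lin_span S `<=` T.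
Proof.
move=> HT ST _ [n [a [s [Ss ->]]]]; apply: lin_subspace_sum => // i _.
by apply: lin_subspaceZ => //; exact: ST.
Qed.
End Spans.

Lemma hs_semi (R : realType) (H : hilbertSpace R) : semi_inner (@hs_ip R H).
Proof. by split; [exact: hs_ip_linear|exact: hs_ip_conj|exact: hs_ip_ge0]. Qed.

Section MatrixCoefficients.
Variables (R : realType) (W : finGroupType) (G : set W).
Local Notation C := R[i].
Hypotheses (G1 : G 1%g) (GM : forall g h, G g -> G h -> G (g * h)%g).
Hypothesis GV : forall g, G g -> G g^-1%g.
Variable gamma : W -> W -> C.
Hypothesis gammaJ : forall u v, gamma u v * (gamma u v)^* = 1.
Hypothesis cocycle : forall u v w, G u -> G v -> G w ->
  gamma v w * gamma u (v * w)%g = gamma u v * gamma (u * v)%g w.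
Hypotheses (gamma1l : forall w, gamma 1%g w = 1) (gamma1r : forall w, gamma w 1%g = 1).
Variables (H : hilbertSpace R) (I : W -> H -> H).
Hypothesis I_unitary : forall g, G g -> unitary_op (I g).
Hypothesis I_mul : forall g1 g2 h, G g1 -> G g2 ->
  I g1 (I g2 h) = (gamma g1 g2)^* *: I (g1 * g2)%g h.
Hypothesis H_neq0 : exists h : H, h <> 0.
Variables (G' : set W) (iota : W -> C).
Hypothesis G'P : forall w, G' w <-> G w /\ exists c : C, forall h, I w h = c *: h.
Hypothesis iotaP : forall w h, G' w -> I w h = iota w *: h.
Hypothesis complete : forall (K : hilbertSpace R) (pi : W -> K -> K),
  unitary_proj_rep G gamma pi -> irreducible_rep G pi ->
  (forall w', G' w' -> forall h, pi w' h = (iota w')^* *: h) ->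
  appears_in G pi (fun w (h : conj_hilbert H) => (I w (h : H) : conj_hilbert H)).

Local Notation n := #|W|.
Local Notation rv := 'rV[C]_n.
Let dP : semi_inner (@dot R n). Proof. exact: dot_semi. Qed.
Let ev (v : rv) (g : W) : C := v 0 (enum_rank g).
Let mk (F : W -> C) : rv := \row_j F (enum_val j).

Let ev_mk F g : ev (mk F) g = F g.
Proof. by rewrite /ev mxE enum_rankK. Qed.
Let ev_ext u v : (forall g, ev u g = ev v g) -> u = v.
Proof. by move=> e; apply/rowP => j; rewrite -[j]enum_valK; exact: e. Qed.
Let evL (z : C) u v g : ev (z *: u + v) g = z * ev u g + ev v g.
Proof. by rewrite /ev !mxE. Qed.
Let evZ (z : C) u g : ev (z *: u) g = z * ev u g.
Proof. by rewrite /ev !mxE. Qed.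

Let dotE u v : dot u v = \sum_g (ev u g)^* * ev v g.
Proof. by rewrite /dot (reindex _ (onW_bij _ (@enum_rank_bij W))). Qed.

Let onG (F : W -> C) g : C := if `[< G g >] then F g else 0.
Let onGE F g : G g -> onG F g = F g.
Proof. by move=> Gg; rewrite /onG asboolT. Qed.
Let onGN F g : ~ G g -> onG F g = 0.
Proof. by move=> Gg; rewrite /onG asboolF. Qed.

(** Functions on [G] are encoded as row vectors indexed by [W] that vanish outside
    [G]; [tr] is right translation twisted by [gamma]. *)
Let supp (v : rv) := forall g, ~ G g -> ev v g = 0.

Let tr (g : W) (v : rv) : rv := mk (onG (fun k => gamma k g * ev v (k * g)%g)).

Let ev_tr g v k : G k -> ev (tr g v) k = gamma k g * ev v (k * g)%g.
Proof. by move=> Gk; rewrite ev_mk onGE. Qed.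

Let supp_mk F : supp (mk (onG F)).
Proof. by move=> g Gg; rewrite ev_mk onGN. Qed.

Let supp_ext u v : supp u -> supp v -> (forall g, G g -> ev u g = ev v g) -> u = v.
Proof.
move=> su sv e; apply: ev_ext => g; have [Gg|Gg] := pselect (G g); first exact: e.
by rewrite su// sv.
Qed.

Let trL g (z : C) u v : tr g (z *: u + v) = z *: tr g u + tr g v.
Proof.
apply: ev_ext => k; rewrite evL !ev_mk /onG.
by case: asboolP => _; rewrite ?evL; ring.
Qed.

Let trZ g (z : C) u : tr g (z *: u) = z *: tr g u.
Proof.
apply: ev_ext => k; rewrite evZ !ev_mk /onG.
by case: asboolP => _; rewrite ?evZ; ring.
Qed.

Let trM g1 g2 v : G g1 -> G g2 -> tr g1 (tr g2 v) = gamma g1 g2 *: tr (g1 * g2)%g v.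
Proof.
move=> h1 h2; apply: ev_ext => k; rewrite evZ.
have [Gk|Gk] := pselect (G k); last by rewrite !(supp_mk _ Gk) mulr0.
rewrite !ev_tr//; last exact: GM.
by rewrite mulrA -(cocycle Gk h1 h2) mulgA mulrA.
Qed.

Let tr1 v : supp v -> tr 1%g v = v.
Proof.
move=> sv; apply: supp_ext => // [|g Gg]; first exact: supp_mk.
by rewrite ev_tr// mulg1 gamma1r mul1r.
Qed.

Let dot_tr g u v : G g -> supp u -> supp v -> dot (tr g u) (tr g v) = dot u v.
Proof.
move=> Gg su sv; rewrite !dotE [RHS](reindex_inj (mulIg g)) /=; apply: eq_bigr => k _.
have [Gk|Gk] := pselect (G k).
  rewrite !ev_tr// rmorphM /=.
  transitivity (gamma k g * (gamma k g)^* * ((ev u (k * g)%g)^* * ev v (k * g)%g)).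
    ring.
  by rewrite gammaJ mul1r.
rewrite !(supp_mk _ Gk) su ?conjC0 ?mul0r// => /GM/(_ (GV Gg)).
by rewrite mulgK.
Qed.

Let coef (h k : H) : rv := mk (onG (fun g => hs_ip (I g h) k)).

Let IL g (z : C) h k : G g -> I g (z *: h + k) = z *: I g h + I g k.
Proof. by move=> /I_unitary[]. Qed.
Let IZ g (z : C) h : G g -> I g (z *: h) = z *: I g h.
Proof.
move=> Gg; have I0 : I g 0 = 0.
  by have := IL 1 0 0 Gg; rewrite !scale1r addr0 => e;
     apply: (addrI (I g 0)); rewrite addr0 -e.
by rewrite -[z *: h]addr0 IL// I0 addr0.
Qed.
Let I_surj g k : G g -> exists h, I g h = k.
Proof. by move=> /I_unitary[]. Qed.

Let I_mulr g1 g2 h : G g1 -> G g2 -> I (g1 * g2)%g h = gamma g1 g2 *: I g1 (I g2 h).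
Proof. by move=> h1 h2; rewrite I_mul// scalerA gammaJ scale1r. Qed.

Let tr_coef g h k : G g -> tr g (coef h k) = coef (I g h) k.
Proof.
move=> Gg; apply: supp_ext => [||x Gx]; try exact: supp_mk.
rewrite ev_tr// !ev_mk !onGE//; last exact: GM.
by rewrite I_mulr// (si_Zl (hs_semi H)) mulrA gammaJ mul1r.
Qed.

Let G'G w : G' w -> G w. Proof. by move=> /G'P[]. Qed.

Let Vset : set rv := [set v | supp v /\ forall w' g, G' w' -> G g ->
  ev v (w' * g)%g = (iota w' * gamma w' g)^* * ev v g].

Let Vset_sub : lin_subspace Vset.
Proof.
split; first by split=> [g _|w' g _ _]; rewrite /ev !mxE ?mulr0.
move=> z u v [su hu] [sv hv]; split=> [g Gg|w' g Gw Gg].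
  by rewrite evL su// sv// mulr0 addr0.
by rewrite !evL hu// hv//; ring.
Qed.

Let coef_V h k : Vset (coef h k).
Proof.
split=> [|w' g Gw Gg]; first exact: supp_mk.
have Gw' := G'G Gw; rewrite !ev_mk !onGE//; last exact: GM.
rewrite I_mulr// (iotaP _ Gw) (si_Zl (hs_semi H)) (si_Zl (hs_semi H)).
by rewrite rmorphM /=; ring.
Qed.

Let V_tr g v : G g -> Vset v -> Vset (tr g v).
Proof.
move=> Gg [sv hv]; split=> [|w' k Gw Gk]; first exact: supp_mk.
have Gw' := G'G Gw; rewrite !ev_tr//; last exact: GM.
rewrite -mulgA (hv _ _ Gw); last exact: GM.
have co := cocycle Gw' Gk Gg.
have e : gamma (w' * k)%g g * (gamma w' (k * g)%g)^* = (gamma w' k)^* * gamma k g.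
  transitivity ((gamma w' k * (gamma w' k)^*) * gamma (w' * k)%g g * (gamma w' (k * g)%g)^*).
    by rewrite gammaJ mul1r.
  transitivity ((gamma w' k * gamma (w' * k)%g g) * (gamma w' k)^* * (gamma w' (k * g)%g)^*).
    ring.
  rewrite -co.
  transitivity (gamma k g * (gamma w' k)^* * (gamma w' (k * g)%g * (gamma w' (k * g)%g)^*)).
    ring.
  by rewrite gammaJ; ring.
rewrite !rmorphM /=.
transitivity ((iota w')^* * (gamma (w' * k)%g g * (gamma w' (k * g)%g)^*) * ev v (k * g)%g).
  ring.
by rewrite e; ring.
Qed.

(** [G'] is normal in [G]; comparing [I_k I_w'] with [I_(k w' k^-1) I_k] on a nonzero
    vector relates [iota] at the two conjugate elements. *)
Let V_over v w' : Vset v -> G' w' -> tr w' v = (iota w')^* *: v.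
Proof.
move=> [sv hv] Gw; have Gw' := G'G Gw.
apply: supp_ext => [||k Gk]; first exact: supp_mk.
  by move=> g Gg; rewrite evZ sv// mulr0.
rewrite ev_tr// evZ; pose w2 := (k * w' * k^-1)%g.
have w2k : (w2 * k = k * w')%g by rewrite /w2 mulgKV.
have Gw2 : G w2 by apply: GM; [exact: GM|exact: GV].
pose c : C := (gamma w2 k)^* * gamma k w' * iota w'.
have Ic h : I w2 h = c *: h.
  have [h' <-] := I_surj h Gk.
  rewrite I_mul// w2k I_mulr// (iotaP _ Gw) IZ// !scalerA.
  by congr (_ *: _); rewrite /c; ring.
have G2 : G' w2 by apply/G'P; split=> //; exists c.
have ic : iota w2 = c.
  have [h h0] := H_neq0; have := Ic h; rewrite (iotaP _ G2) => /eqP.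
  by rewrite -subr_eq0 -scalerBl scaler_eq0 subr_eq0 => /orP[/eqP //|/eqP].
rewrite -w2k (hv _ _ G2)// ic /c.
transitivity ((iota w')^* * (gamma k w' * (gamma k w')^*) *
   ((gamma w2 k)^* * (gamma w2 k)^*^*) * ev v k).
  by rewrite !rmorphM /=; ring.
by rewrite conjCK gammaJ [_^* * gamma w2 k]mulrC gammaJ !mulr1.
Qed.

Let M0 : set rv := [set v | Vset v /\ forall h k, dot (coef h k) v = 0].

Let M0_sub : lin_subspace M0.
Proof.
split; first by split=> [|h k]; [exact: Vset_sub.1|exact: (si_0r dP)].
move=> z u v [Vu hu] [Vv hv]; split=> [|h k]; first exact: Vset_sub.2.
by rewrite (si_linear dP) hu hv mulr0 addr0.
Qed.

Let M0_tr g v : G g -> M0 v -> M0 (tr g v).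
Proof.
move=> Gg [Vv hv]; split=> [|h k]; first exact: V_tr.
have [h' <-] := I_surj h Gg; rewrite -tr_coef// dot_tr//; first exact: supp_mk.
exact: Vv.1.
Qed.

Section Irreducible.
Variable A : 'M[C]_n.
Hypothesis A_M0 : forall v : rv, (v <= A)%MS -> M0 v.
Hypothesis A_tr : forall g (v : rv), G g -> (v <= A)%MS -> (tr g v <= A)%MS.
Hypothesis A_neq0 : A != 0.
Hypothesis A_min : forall B : 'M[C]_n, (forall v : rv, (v <= B)%MS -> (v <= A)%MS) ->
  (forall g (v : rv), G g -> (v <= B)%MS -> (tr g v <= B)%MS) -> B != 0 -> (A <= B)%MS.

Let K := row_hilbert A.
Let pi (g : W) (h : K) : K := insubd (0 : row_space A) (tr g (val (h : row_space A))).

Let val_pi g (h : K) : G g -> val (pi g h : row_space A) = tr g (val (h : row_space A)).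
Proof. by move=> Gg; rewrite insubdK//; apply: A_tr => //; exact: row_valP. Qed.

Let suppA (h : row_space A) : supp (val h).
Proof. by have [[]] := A_M0 (row_valP h). Qed.

Let valZ (z : C) (h : row_space A) : val (z *: h) = z *: val h.
Proof. by []. Qed.
Let valL (z : C) (h k : row_space A) : val (z *: h + k) = z *: val h + val k.
Proof. by []. Qed.

Let pi_rep : unitary_proj_rep G gamma pi.
Proof.
split=> [g Gg|g1 g2 h h1 h2].
  split=> [z h k|h k|k].
  - by apply: val_inj; rewrite valL !val_pi// valL trL.
  - by rewrite -[LHS]/(dot (val (pi g h)) (val (pi g k))) !val_pi// dot_tr//; exact: suppA.
  - have GVg := GV Gg.
    exists ((gamma g g^-1%g)^* *: pi g^-1%g k); apply: val_inj.
    rewrite val_pi// valZ val_pi// trZ trM// mulgV scalerA mulrC gammaJ scale1r tr1//.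
apply: val_inj; rewrite valZ !val_pi//; last exact: GM.
exact: trM.
Qed.

Let pi_irreducible : irreducible_rep G pi.
Proof.
split.
  have /rowV0Pn[v vA v0] := A_neq0.
  exists (RowSpace (vA : v \in row_space_pred A)) => /(congr1 val) /= e.
  by rewrite e eqxx in v0.
move=> S S_sub _ S_inv.
pose S' : set rv := [set v | exists2 h : row_space A, S h & v = val h].
have S'_sub : lin_subspace S'.
  split; first by exists 0 => //; exact: S_sub.1.
  move=> z _ _ [h Sh ->] [k Sk ->]; exists (z *: h + k) => //; exact: S_sub.2.
have [B SB] := subspace_row_space S'_sub.
have [B0|B0] := eqVneq B 0.
  left=> h Sh; apply: val_inj; have : S' (val h) by exists h.
  by rewrite SB B0 submx0 => /eqP.
right; apply/seteqP; split=> // h _.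
have AB : (A <= B)%MS.
  apply: A_min => //.
  - by move=> v /SB[k _ ->]; exact: row_valP.
  - move=> g v Gg /SB[k Sk ->]; apply/SB; exists (pi g k); first exact: S_inv.
    by rewrite val_pi.
have /SB[k Sk] : (val h <= B)%MS by apply: submx_trans AB; exact: row_valP.
by move=> /val_inj ->.
Qed.

Let pi_over w' : G' w' -> forall h, pi w' h = (iota w')^* *: h.
Proof.
move=> Gw h; apply: val_inj; rewrite valZ val_pi; last exact: G'G.
by apply: V_over => //; have [] := A_M0 (row_valP h).
Qed.

(** The vectors of an irreducible invariant subspace are matrix coefficients:
    evaluation at [1] is the inner product with some [delta] in the subspace, and
    an isometric intertwiner turns this into a matrix coefficient of [I]. *)
Lemma irreducible_absurd : False.
Proof.
have [J [JL Jip JG]] := complete pi_rep pi_irreducible pi_over.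
have A_sub : lin_subspace [set v : rv | (v <= A)%MS].
  split; first exact: sub0mx.
  by move=> z u v uA vA; apply: addmx_sub => //; exact: scalemx_sub.
have [d [dA dP']] := subspace_split (mk (fun g => (g == 1%g)%:R)) A_sub.
pose dK : K := RowSpace (dA : d \in row_space_pred A).
have evd v : (v <= A)%MS -> dot d v = ev v 1%g.
  move=> /dP'/eqP; rewrite (si_Br dP) subr_eq0 => /eqP e.
  rewrite -(si_conj dP) -e (si_conj dP) dotE (bigD1 1%g)//= big1 => [|g g1].
    by rewrite ev_mk eqxx conjC1 mul1r addr0.
  by rewrite ev_mk (negPf g1) conjC0 mul0r.
have /rowV0Pn[v vA v0] := A_neq0.
pose vK : K := RowSpace (vA : v \in row_space_pred A).
have vcoef : v = coef (J vK : H) (J dK : H).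
  have [[sv _] _] := A_M0 vA.
  apply: supp_ext => // [|g Gg]; first exact: supp_mk.
  rewrite ev_mk onGE//.
  have -> : ev v g = ev (tr g v) 1%g by rewrite ev_tr// gamma1l mul1r mul1g.
  rewrite -evd; last exact: A_tr.
  have -> : dot d (tr g v) = hs_ip dK (pi g vK).
    by rewrite -[RHS]/(dot d (val (pi g vK : row_space A))) val_pi.
  by rewrite -Jip JG.
have [_ /(_ (J vK : H) (J dK : H))] := A_M0 vA.
by rewrite -vcoef => /dot_def e; rewrite e eqxx in v0.
Qed.

End Irreducible.

(** A nonzero invariant subspace of least dimension would be irreducible. *)
Let M0_trivial v : M0 v -> v = 0.
Proof.
move=> Mv; apply: contrapT => v0.
pose Q (A : 'M[C]_n) := [/\ forall v : rv, (v <= A)%MS -> M0 v,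
  forall g (v : rv), G g -> (v <= A)%MS -> (tr g v <= A)%MS & A != 0].
pose P k := `[< exists A, Q A /\ \rank A = k >].
have exP : exists k, P k.
  have [B MB] := subspace_row_space M0_sub.
  exists (\rank B); apply/asboolP; exists B; split=> //; split.
  - by move=> u /MB.
  - by move=> g u Gg /MB Mu; apply/MB; exact: M0_tr.
  - by apply: contra_not_neq v0 => B0; apply/eqP; rewrite -submx0 -B0; apply/MB.
case: (ex_minnP exP) => k /asboolP[A [[AM Atr A0] rA]] kmin.
apply: (irreducible_absurd AM Atr A0) => B BA Btr B0.
have sBA : (B <= A)%MS by apply/rV_subP => u; exact: BA.
rewrite -(geq_leqif (mxrank_leqif_sup sBA)) rA; apply: kmin; apply/asboolP.
by exists B; split=> //; split=> // u /BA; exact: AM.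
Qed.

(** The conjugate of [c] lies in [Vset]. Its component orthogonal to the matrix
    coefficients is zero by [M0_trivial]. *)
Lemma matrix_coefficients_span (c : W -> C) :
  (forall w' g, G' w' -> G g -> c (w' * g)%g = iota w' * gamma w' g * c g) ->
  exists m (h k : 'I_m -> H), forall g, G g -> c g = \sum_i hs_ip (h i) (I g (k i)).
Proof.
move=> cP; pose F : rv := mk (onG (fun g => (c g)^*)).
have VF : Vset F.
  split=> [|w' g Gw Gg]; first exact: supp_mk.
  rewrite !ev_mk !onGE//; last by apply: GM => //; exact: G'G.
  by rewrite cP// rmorphM.
pose S := lin_span [set v | exists h k, v = coef h k].
have [u [Su Fu]] := subspace_split F (lin_span_subspace [set v | exists h k, v = coef h k]).
have Vu : Vset u.
  by apply: (lin_span_min Vset_sub _ Su) => _ [h [k ->]]; exact: coef_V.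
have /eqP : F - u = 0.
  apply: M0_trivial; split=> [|h k]; first exact: lin_subspaceB.
  by apply: Fu; apply: lin_span_incl; exists h, k.
rewrite subr_eq0 => /eqP FE; move: Su; rewrite -FE => -[m [a [s [sE E]]]].
have /choice[hk hkE] i : exists hk : H * H, s i = coef hk.1 hk.2.
  by have [h [k ->]] := sE i; exists (h, k).
exists m, (fun i => a i *: (hk i).2), (fun i => (hk i).1) => g Gg.
rewrite -[c g]conjCK.
have -> : (c g)^* = ev F g by rewrite ev_mk onGE.
rewrite E /ev summxE rmorph_sum /=; apply: eq_bigr => i _.
rewrite -[(a i *: s i) _ _]/(ev (a i *: s i) g) evZ hkE ev_mk onGE// rmorphM /=.
by rewrite (si_conj (hs_semi H)) (si_Zl (hs_semi H)).
Qed.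

End MatrixCoefficients.

(** * Approximation by partitions of unity *)

Section Bumps.
Variables (R : realType) (X : topologicalType).
Hypotheses (hX : hausdorff_space X) (lcX : locally_compact [set: X]).
Local Notation C := R[i].

(** Urysohn's function for [x] and the complement of a neighbourhood of [x] that is
    contained in [O] and in a compact set. *)
Lemma bump_exists (x : X) (O : set X) : nbhs x O ->
  exists (phi : X -> R^o) (K : set X), [/\ continuous phi, compact K,
    (forall y, 0 <= phi y <= 1), phi x = 1 & forall y, ~ (O `&` K) y -> phi y = 0].
Proof.
move=> Ox.
have [B xB [cB clB]] : compact_near (within [set: X] (nbhs x)) := lcX I.
have {}xB : nbhs x B by move: xB; rewrite /within /=; apply: filterS => y h; exact: h.
have : nbhs x (O `&` B) by exact: filterI.
rewrite nbhsE => -[V [oV Vx] VOB].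
have sep : uniform_separator [set x] (~` V).
  apply: (@locally_compact_completely_regular X R lcX hX); first by rewrite closedC.
  by move=> /(_ Vx).
pose u : X -> R := Urysohn [set x] (~` V).
have u01 y : 0 <= u y <= 1.
  have : range u (u y) by exists y.
  by move=> /Urysohn_range; rewrite /= in_itv.
exists (fun y => 1 - u y), B; split=> //.
- move=> y; apply: continuousB; first exact: cvg_cst.
  exact: Urysohn_continuous.
- by move=> y; have /andP[a b] := u01 y; rewrite subr_ge0 b lerBlDr lerDl.
- have : (u @` [set x]) (u x) by exists x.
  by move=> /(Urysohn_sub0 sep) /= ->; rewrite subr0.
- move=> y nOB; have Vy : ~ V y by move=> /VOB.
  have : (u @` (~` V)) (u y) by exists y.
  by move=> /(Urysohn_sub1 sep) /= ->; rewrite subrr.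
Qed.

Lemma compact_support_C0 (g : X -> R^o) (K : set X) : continuous g -> compact K ->
  (forall y, ~ K y -> g y = 0) -> (fun x => (g x)%:C%C : R[i]^o) \in C0_pred.
Proof.
move=> cg cK gK; apply/asboolP; split; first exact: real_complex_continuous.
by move=> e e0; exists K => // x /gK ->; rewrite normr0.
Qed.

Definition C0_act (W : finType) (b : C0 R X) (g : {ffun W -> C0 R X}) : {ffun W -> C0 R X} :=
  [ffun w => C0_mul b (g w)].

Lemma C0_actE (W : finType) b (g : {ffun W -> C0 R X}) w x : C0_act b g w x = b x * g w x.
Proof. by rewrite ffunE. Qed.

Lemma sum_continuous (I : Type) (r : seq I) (phi : I -> X -> R^o) :
  (forall i, continuous (phi i)) -> continuous (fun y => \sum_(i <- r) phi i y : R^o).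
Proof.
move=> cphi; elim: r => [|i r IH] y.
  by under eq_fun do rewrite big_nil; exact: cvg_cst.
under eq_fun do rewrite big_cons; apply: continuousD; [exact: cphi|exact: IH].
Qed.

Lemma compact_finite_cover (K : set X) (U : X -> set X) : compact K ->
  (forall x, open (U x)) -> (forall x, K x -> U x x) ->
  exists D : seq X, forall y, K y -> exists2 x, x \in D & U x y.
Proof.
move=> cK oU KU; have [[x0 _]|X0] := pselect (exists x : X, True); last first.
  by exists [::] => y _; exfalso; apply: X0; exists y.
pose pX := isPointed.Build X x0.
pose X' : ptopologicalType := HB.pack (Topological.sort X) pX.
have : @cover_compact X' K by rewrite -compact_cover.
move=> /(_ X setT U (fun x _ => oU x))[x Kx|D _ KD]; first by exists x => //; exact: KU.
by exists (finmap.enum_fset D) => y /KD[x xD Uxy]; exists x.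
Qed.

(** For a partition of unity [psi], the sum of the [psi x] times [g x] is uniformly
    close to [f]: on a compact set because each [g x] is close to [f] near [x], and
    outside because [f] itself is small there. *)
Lemma local_approximation (W : finType) (L : set {ffun W -> C0 R X}) (f : {ffun W -> C0 R X}) :
  lin_subspace (V := {ffun W -> C0 R X}) L ->
  (forall b g, L g -> L (C0_act b g)) ->
  (forall x, exists2 g, L g & forall w, g w x = f w x) ->
  forall M : R, 0 < M -> exists2 g, L g & forall w x, cabs (f w x - g w x) <= M.
Proof.
move=> L_sub L_act L_pt M M0; have Mc : 0 < M%:C%C :> C by rewrite ltcR.
have [K cK fK] : exists2 K : set X, compact K & forall x w, ~ K x -> cabs (f w x) < M.
  have /choice[k kP] w : exists k : set X, compact k /\ forall x, ~ k x -> cabs (f w x) < M.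
    have /asboolP[_ /(_ _ Mc)[k ck h]] := C0_funP (f w).
    by exists k; split=> // x /h; rewrite cabs_lt.
  exists (\big[setU/set0]_w k w).
    by elim/big_ind: _ => [|A B|w _]; [exact: compact0|exact: compactU|exact: (kP w).1].
  move=> x w nk; apply: (kP w).2 => kx; apply: nk.
  by rewrite (bigD1 w)//=; left.
have /choice[g gP] x : exists g, L g /\ forall w, g w x = f w x.
  by have [g] := L_pt x; exists g.
pose O x := [set y | forall w, cabs (f w y - g x w y) < M].
have nO x : nbhs x (O x).
  apply: (@filter_forall X W (fun w y => cabs (f w y - g x w y) < M) (nbhs x)) => w.
  have /asboolP[cd _] := C0_funP (f w - g x w).
  move/cvgrPdist_lt: (cd x) => /(_ _ Mc); apply: filterS => y.
  by rewrite C0B (gP x).2 subrr sub0r normrN cabs_lt.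
have /choice[phi phiP] x : exists phi : X -> R^o, [/\ continuous phi,
   exists K, compact K /\ forall y, ~ K y -> phi y = 0,
   forall y, 0 <= phi y <= 1, phi x = 1 & forall y, ~ O x y -> phi y = 0].
  have [phi [k [c1 ck c2 c3 c4]]] := bump_exists (nO x).
  exists phi; split=> //; first by exists k; split=> // y ky; apply: c4 => -[].
  by move=> y Oy; apply: c4 => -[].
have cphi x : continuous (phi x) by have [] := phiP x.
have phi0 x y : 0 <= phi x y by have [_ _ /(_ y)/andP[]] := phiP x.
have [|x Kx|D KD] := @compact_finite_cover K (fun x => [set y | 2^-1 < phi x y]) cK.
- by move=> x; apply: open_comp (@open_gt _ 2^-1) => y _; exact: cphi.
- by have [_ _ _ /= -> _] := phiP x; lra.
pose p y : R^o := \sum_(x <- D) phi x y.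
have cp : continuous p by exact: sum_continuous.
have p0 y : 0 <= p y by apply: sumr_ge0 => x _; exact: phi0.
have pK y : K y -> 2^-1 <= p y.
  move=> /KD[x xD] /= /ltW h; apply: le_trans h _; rewrite /p (big_rem x)//=.
  by rewrite lerDl sumr_ge0.
(* Dividing by max(p, 1/2) makes the sum equal to 1 on K, where p >= 1/2, and keeps
   it continuous and at most 1 elsewhere. *)
pose mx y : R^o := Num.max (p y) 2^-1.
have mx0 y : 0 < mx y by rewrite /mx lt_max invr_gt0 ltr0n orbT.
have cmx : continuous mx.
  by move=> y; apply: continuous_max; [exact: cp|exact: cvg_cst].
pose psi x y : R^o := phi x y / mx y.
have psi0 x y : 0 <= psi x y by rewrite divr_ge0// ltW.
have psiC x : (fun y => (psi x y)%:C%C : R[i]^o) \in C0_pred.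
  have [_ [k [ck kphi]] _ _ _] := phiP x.
  apply: (compact_support_C0 _ ck) => [y|y /kphi h]; last by rewrite /psi h mul0r.
  rewrite /psi; apply: (@continuousM _ _ (phi x) (fun z => (mx z)^-1) y).
    exact: cphi.
  by apply: continuousV; [rewrite gt_eqF|exact: cmx].
pose b x : C0 R X := MkC0 (psiC x).
exists (\sum_(x <- D) C0_act (b x) (g x)).
  by apply: (lin_subspace_sum (V := {ffun W -> C0 R X})) => // x _; apply: L_act; exact: (gP x).1.
move=> w y.
have -> : (\sum_(x <- D) C0_act (b x) (g x)) w y = \sum_(x <- D) C0_act (b x) (g x) w y.
  by rewrite sum_ffunE C0_sum.
pose P := \sum_(x <- D) psi x y.
have PE : P = p y / mx y by rewrite /P /psi -mulr_suml.
have P1 : P <= 1 by rewrite PE ler_pdivrMr// mul1r /mx le_max lexx.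
have -> : f w y - \sum_(x <- D) C0_act (b x) (g x) w y =
   ((1 - P)%:C)%C * f w y + \sum_(x <- D) (psi x y)%:C%C * (f w y - g x w y).
  under [X in _ = _ + X]eq_bigr do rewrite mulrBr.
  rewrite sumrB -mulr_suml -rmorph_sum /= -/P rmorphB rmorph1 addrA mulrBl mul1r subrK.
  by congr (_ - _); apply: eq_bigr => x _; rewrite ffunE.
apply: le_trans (cabsD _ _) _; rewrite cabsM cabs_real ?subr_ge0//.
have h1 : (1 - P) * cabs (f w y) <= (1 - P) * M.
  have [Ky|nK] := pselect (K y); last by have /ltW h := fK y w nK; rewrite ler_wpM2l ?subr_ge0.
  have -> : P = 1; last by rewrite subrr !mul0r.
  by rewrite PE /mx max_l ?pK// divff// gt_eqF// (lt_le_trans _ (pK y Ky))// invr_gt0.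
have h2 : cabs (\sum_(x <- D) (psi x y)%:C%C * (f w y - g x w y)) <= P * M.
  apply: le_trans (cabs_sum _ _ _) _; rewrite /P mulr_suml; apply: ler_sum => x _.
  rewrite cabsM cabs_real//.
  have [/(_ w)/ltW|Oy] := pselect (O x y); first exact: ler_wpM2l.
  by have [_ _ _ _ /(_ y Oy) h] := phiP x; rewrite /psi h !mul0r.
lra.
Qed.

End Bumps.

(** * The ideal spanned by the inner products *)

Section LocalIdeal.
Variables (R : realType) (X : topologicalType) (W : finGroupType).
Variables (T : twisted_action R X W) (E : hilbertModule R X).
Variable U : twisted_module_action T E.
Local Notation C := R[i].
Local Notation act := (ta_act T).
Local Notation gamma := (ta_gamma T).
Local Notation "'U_ w" := (tm_U U w) (at level 8, w at level 2, format "''U_' w").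
Local Notation "'V_ w" := (tm_Uinv U w) (at level 8, w at level 2, format "''V_' w").
Implicit Types (xi eta zeta : E) (f g : {ffun W -> C0 R X}) (b : C0 R X).
Hypothesis fibre_neq0 : forall x : X, exists h : fibre E x, h <> 0.

Section AtPoint.
Variable x : X.
Local Notation G := (stabilizer T x).

Lemma fibre_surj (h : fibre E x) : exists xi, h = fibre_at x xi.
Proof. exact: (ex_intro _ _ (esym (fibre_class_repr h))). Qed.

Lemma fibre_ip_at xi eta : hs_ip (fibre_at x xi) (fibre_at x eta) = ip_at x xi eta.
Proof. exact: fibre_ipE. Qed.

Lemma fibre_at_ext xi eta : (forall zeta, ip_at x zeta xi = ip_at x zeta eta) ->
  fibre_at x xi = fibre_at x eta.
Proof.
move=> e; apply/fibre_classP.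
by rewrite -[LHS]/(ip_at x _ _) (si_Br (hm_semi E x)) e subrr.
Qed.

Lemma fibre_at_linear (z : C) xi eta :
  fibre_at x (z *: xi + eta) = z *: fibre_at x xi + fibre_at x eta.
Proof. by rewrite /fibre_at fibre_classD fibre_classZ. Qed.

Lemma fibre_atZ (z : C) xi : fibre_at x (z *: xi) = z *: fibre_at x xi.
Proof. by rewrite /fibre_at fibre_classZ. Qed.

Lemma stab_op_at w xi : G w -> stab_op U w (fibre_at x xi) = fibre_at x ('U_w xi).
Proof. exact: fibre_map_at. Qed.

Lemma stab1 : G 1%g. Proof. exact: ta_act1. Qed.
Lemma stabM u v : G u -> G v -> G (u * v)%g.
Proof. by rewrite /stabilizer /= ta_actM => uG ->. Qed.
Lemma stabV u : G u -> G u^-1%g.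
Proof. by rewrite /stabilizer /= => {1}<-; rewrite ta_actV. Qed.

Lemma stab_op_unitary w : G w -> unitary_op (@stab_op _ _ _ _ _ U x w).
Proof.
move=> Gw; split=> [z h k|h k|k].
- have [xi ->] := fibre_surj h; have [eta ->] := fibre_surj k.
  by rewrite -fibre_at_linear !stab_op_at// tm_linear fibre_at_linear.
- have [xi ->] := fibre_surj h; have [eta ->] := fibre_surj k.
  by rewrite !stab_op_at// !fibre_ip_at ip_U stabV.
- have [xi ->] := fibre_surj k; exists (fibre_at x ('V_w xi)).
  by rewrite stab_op_at// tm_UVK.
Qed.

Lemma stab_op_mul u v (h : fibre E x) : G u -> G v ->
  stab_op U u (stab_op U v h) = (gamma u v x : C)^* *: stab_op U (u * v)%g h.
Proof.
move=> Gu Gv; have Guv := stabM Gu Gv; have [xi ->] := fibre_surj h.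
rewrite !stab_op_at// -fibre_atZ; apply: fibre_at_ext => zeta.
by rewrite ip_UU (si_Zr (hm_semi E x)).
Qed.

Lemma stab_scalarP w (h : fibre E x) : scalar_stab U x w ->
  stab_op U w h = stab_scalar U w x *: h.
Proof.
move=> [_ [c hc]]; pose P := [set c : C | forall h : fibre E x, stab_op U w h = c *: h].
have : P (xget 1 P) by apply: xgetPex; exists c.
exact.
Qed.

Lemma stab_cocycle u v w : G u -> G v -> G w ->
  gamma v w x * gamma u (v * w)%g x = gamma u v x * gamma (u * v)%g w x.
Proof. by move=> /stabV Gu _ _; have := ta_cocycle T u v w x; rewrite Gu. Qed.

Lemma ip_scalar_stab w xi eta : scalar_stab U x w ->
  ip_at x xi ('U_w eta) = stab_scalar U w x * ip_at x xi eta.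
Proof.
move=> Gw; rewrite -!fibre_ip_at -stab_op_at; last exact: Gw.1.
by rewrite stab_scalarP// (si_Zr (hs_semi _)).
Qed.

End AtPoint.

Lemma local_ideal_sub : lin_subspace (local_ideal U).
Proof.
split; first by move=> x w' w _; rewrite !tc0 mulr0.
move=> z f g Lf Lg x w' w Gw; rewrite !(tcD, tcZ) Lf// Lg//; ring.
Qed.

Lemma crossed_ip_local xi eta : local_ideal U (crossed_ip U xi eta).
Proof.
move=> x w' w Gw; rewrite !crossed_ipE ip_Umul ip_scalar_stab//; ring.
Qed.

Let ip_span : set {ffun W -> C0 R X} :=
  lin_span (V := twisted_crossed R X W) [set f | exists xi eta, f = crossed_ip U xi eta].

Let ip_span_sub : lin_subspace (V := twisted_crossed R X W) ip_span.
Proof. exact: lin_span_subspace. Qed.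

Let ip_span_act b g : ip_span g -> ip_span (C0_act b g).
Proof.
apply: (lin_span_min (T := [set g | ip_span (C0_act b g)])).
  split=> [|z f h Sf Sh] /=.
    have -> : C0_act b (0 : {ffun W -> C0 R X}) = 0.
      by apply: tc_ext => t x; rewrite C0_actE tc0 mulr0.
    exact: ip_span_sub.1.
  have -> : C0_act b (z *: (f : twisted_crossed R X W) + h) =
      z *: (C0_act b f : twisted_crossed R X W) + C0_act b h.
    by apply: tc_ext => t x; rewrite !(C0_actE, tcD, tcZ); ring.
  exact: ip_span_sub.2.
move=> _ [xi [eta ->]] /=; apply: lin_span_incl; exists (hm_act xi (C0_conj b)), eta.
by apply: tc_ext => t x; rewrite C0_actE !crossed_ipE ip_at_actl /= conjCK.
Qed.

Hypothesis U_complete : completeness_condition U.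

Lemma stab_matrix_coefficients x (c : W -> C) :
  (forall w' k, scalar_stab U x w' -> stabilizer T x k ->
     c (w' * k)%g = stab_scalar U w' x * gamma w' k x * c k) ->
  exists m (xi eta : 'I_m -> E), forall k, stabilizer T x k ->
    c k = \sum_i ip_at x (xi i) ('U_k (eta i)).
Proof.
move=> cP.
have [|||||||||||||m [h [k hk]]] := @matrix_coefficients_span R W (stabilizer T x) _ _ _
  (fun u v => gamma u v x) _ _ _ _ (fibre E x) (fun w => stab_op U w) _ _ _
  (scalar_stab U x) (fun w => stab_scalar U w x) _ _ _ c cP.
- exact: stab1.
- exact: stabM.
- exact: stabV.
- by move=> u v; exact: gamma_mulJ.
- exact: stab_cocycle.
- by move=> w; exact: ta_gamma1l.
- by move=> w; exact: ta_gamma1r.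
- exact: stab_op_unitary.
- exact: stab_op_mul.
- exact: fibre_neq0.
- by [].
- by move=> w v; exact: stab_scalarP.
- exact: U_complete.
have /choice[xi hxi] i : exists xi, h i = fibre_at x xi by exact: fibre_surj.
have /choice[eta keta] i : exists eta, k i = fibre_at x eta by exact: fibre_surj.
exists m, xi, eta => w Gw; rewrite hk//; apply: eq_bigr => i _.
by rewrite hxi keta stab_op_at// fibre_ip_at.
Qed.

Hypotheses (hX : hausdorff_space X) (lcX : locally_compact [set: X]).

(** The other points of the orbit form a finite, hence closed, set. *)
Lemma orbit_separation (y : X) : exists b : C0 R X, b y = 1 /\
  forall w, act w y <> y -> b (act w y) = 0.
Proof.
pose B : set X := [set z | exists2 w, act w y = z & z <> y].
have fB : finite_set B.
  apply: (@sub_finite_set _ _ ((fun w => act w y) @` [set: W])); last first.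
    exact/finite_image/finite_finset.
  by move=> z [w <- _]; exists w.
have cB : closed B by exact: (accessible_finite_set_closed.1 (hausdorff_accessible hX)).
have yB : nbhs y (~` B).
  by apply: open_nbhs_nbhs; split; [rewrite openC|move=> [w _]].
have [phi [K [cphi cK _ phi1 phi0]]] := bump_exists R hX lcX yB.
have phiC : (fun x => (phi x)%:C%C : R[i]^o) \in C0_pred.
  by apply: (compact_support_C0 cphi cK) => z nK; apply: phi0 => -[].
exists (MkC0 phiC); split=> /=; first by rewrite phi1.
by move=> w wy; rewrite phi0// => -[+ _]; apply; exists w.
Qed.

(** On the coset [W_x t] the coefficients of [f] are, up to phases [gamma], a
    covariant function on [W_x], and hence sums of matrix coefficients. Multiplying
    the right vectors by a function concentrated at [t^-1 x] removes the other
    cosets. *)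
Lemma local_ideal_coset x f t : local_ideal U f ->
  exists2 g, ip_span g & forall w,
    g w x = if `[< stabilizer T x (w * t^-1)%g >] then f w x else 0.
Proof.
move=> Lf; pose c k : C := (gamma k t x : C)^* * f (k * t)%g x.
have [w' k Gw Gk|m [xi [eta cE]]] := @stab_matrix_coefficients x c.
  have Gw' := Gw.1; rewrite /c -mulgA (Lf _ _ _ Gw).
  have := ta_cocycle T w' k t x; rewrite (stabV Gw') => co.
  have e : (gamma (w' * k)%g t x : C)^* * gamma w' (k * t)%g x =
      gamma w' k x * (gamma k t x : C)^*.
    transitivity ((gamma k t x * (gamma k t x : C)^*) * (gamma (w' * k)%g t x : C)^* *
       gamma w' (k * t)%g x); first by rewrite gamma_mulJ mul1r.
    transitivity ((gamma k t x * gamma w' (k * t)%g x) * (gamma k t x : C)^* *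
      (gamma (w' * k)%g t x : C)^*); first by ring.
    rewrite co.
    transitivity (gamma w' k x * (gamma k t x : C)^* *
      (gamma (w' * k)%g t x * (gamma (w' * k)%g t x : C)^*)); first by ring.
    by rewrite gamma_mulJ mulr1.
  transitivity (stab_scalar U w' x * ((gamma (w' * k)%g t x : C)^* * gamma w' (k * t)%g x) *
    f (k * t)%g x); first by ring.
  by rewrite e; ring.
have [b [b1 b0]] := orbit_separation (act t^-1%g x).
exists (\sum_i crossed_ip U (xi i) (hm_act ('V_t (eta i)) b)).
  apply: (lin_subspace_sum (V := twisted_crossed R X W)) => // i _.
  by apply: lin_span_incl; exists (xi i), (hm_act ('V_t (eta i)) b).
move=> w; rewrite tc_sum.
under eq_bigr do rewrite crossed_ipE tm_act ip_at_act.
rewrite -mulr_suml /=; case: asboolP => [Gk|nG].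
  have [k Gk' ->] : exists2 k, stabilizer T x k & w = (k * t)%g.
    by exists (w * t^-1)%g; rewrite ?mulgKV.
  have -> : act (k * t)^-1%g x = act t^-1%g x by rewrite invMg ta_actM (stabV Gk').
  rewrite b1 mulr1.
  rewrite (eq_bigr (fun i => gamma k t x * ip_at x (xi i) ('U_k (eta i)))) => [|i _].
    by rewrite -mulr_sumr -cE// /c mulrA gamma_mulJ mul1r.
  by rewrite ip_Umul tm_UVK.
have -> : act w^-1%g x = act (w^-1 * t)%g (act t^-1%g x).
  by rewrite -ta_actM mulgK.
rewrite b0 ?mulr0// -ta_actM mulgK => e; apply: nG.
by rewrite /stabilizer /= ta_actM -e ta_actVr.
Qed.

(** Each [w] lies in [W_x t] for exactly [|W_x|] elements [t], so that the average of
    the pieces over [t] gives back [f]. *)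
Lemma local_ideal_pointwise x f : local_ideal U f ->
  exists2 g, ip_span g & forall w, g w x = f w x.
Proof.
move=> Lf.
have /choice[g gP] t : exists g, ip_span g /\ forall w,
    g w x = if `[< stabilizer T x (w * t^-1)%g >] then f w x else 0.
  by have [g] := local_ideal_coset x t Lf; exists g.
pose k := \sum_(u : W) (if `[< stabilizer T x u >] then 1 else 0) : C.
have k0 : k != 0.
  rewrite gt_eqF// /k (bigD1 1%g)//= asboolT; last exact: stab1.
  by rewrite ltr_pwDl// sumr_ge0// => u _; case: asboolP.
exists (k^-1 *: (\sum_t g t : twisted_crossed R X W)).
  apply: (lin_subspaceZ (V := twisted_crossed R X W)) => //.
  by apply: (lin_subspace_sum (V := twisted_crossed R X W)) => // t _; exact: (gP t).1.
move=> w; rewrite tcZ tc_sum; under eq_bigr do rewrite (gP _).2.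
rewrite (reindex_inj (inj_comp (mulIg w) invg_inj)) /=.
rewrite (eq_bigr (fun u => (if `[< stabilizer T x u >] then 1 else 0) * f w x)) => [|u _].
  by rewrite -mulr_suml -/k mulrA mulVf ?mul1r.
rewrite invMg invgK mulgA mulgV mul1g.
by case: asboolP => _; rewrite ?mul1r ?mul0r.
Qed.

Section Norm.
Variable N : twisted_crossed R X W -> R.
Hypothesis N_cstar : @cstar_norm_on R (tc_alg T N) setT.
Local Notation A := (tc_alg T N).

Lemma local_ideal_closed : norm_closure N (local_ideal U) `<=` local_ideal U.
Proof.
move=> f Lf x w' w Gw; apply/eqP; rewrite -subr_eq0; apply/eqP.
apply: cabs_eq0; apply/eqP; rewrite eq_le cabs_ge0 andbT.
apply/ler_addgt0Pr => e e0; rewrite add0r.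
set c := stab_scalar U w' x * gamma w' w x.
have d0 : 0 < e / (1 + cabs c) by rewrite divr_gt0// ltr_pwDl// cabs_ge0.
have [g Lg Nfg] := Lf _ d0.
have c1 := tc_coef_le N_cstar (f - g) (w' * w)%g x.
have c2 := tc_coef_le N_cstar (f - g) w x.
rewrite tcB in c1; rewrite tcB in c2.
have -> : f (w' * w)%g x - c * f w x =
   (f (w' * w)%g x - g (w' * w)%g x) - c * (f w x - g w x) by rewrite Lg// -/c; ring.
apply: le_trans (cabsD _ _) _; rewrite cabsN cabsM.
have : N (f - g) * (1 + cabs c) <= e by rewrite -ler_pdivlMr ?ltW// ltr_pwDl// cabs_ge0.
have := cabs_ge0 c; nra.
Qed.

Lemma inner_product_span_local : inner_product_span U N = local_ideal U.
Proof.
apply/seteqP; split.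
  move=> f cf; apply: local_ideal_closed => e /cf[g gS fg]; exists g => //.
  apply: (lin_span_min local_ideal_sub _ gS) => _ [xi [eta ->]].
  exact: crossed_ip_local.
move=> f Lf e e0.
have W0 : 0 < (#|W|%:R + 1 : R) by rewrite ltr_wpDl.
have [|g Sg fg] := @local_approximation R X hX lcX W ip_span f ip_span_sub ip_span_act _ _
   (divr_gt0 e0 W0).
  by move=> x; exact: local_ideal_pointwise.
exists g => //.
apply: (@le_lt_trans _ _ (#|W|%:R * (e / (#|W|%:R + 1)))).
  apply: (tc_norm_le N_cstar) => [|w x]; first by rewrite divr_ge0// ltW.
  by rewrite tcB.
by rewrite mulrA ltr_pdivrMr// mulrC ltr_pM2l// ltrDl.
Qed.

(** Multiplication moves into the inner product:
    [a <<xi|eta>> = <<xi a^*|eta>>] and [<<xi|eta>> a = <<xi|eta a>>]. *)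
Lemma inner_product_span_ideal : @closed_ideal R A setT (inner_product_span U N).
Proof.
have HA := tc_cstar N_cstar.
split=> //.
- by rewrite inner_product_span_local; exact: local_ideal_sub.
- by rewrite inner_product_span_local => f [/local_ideal_closed].
pose J : set A := lin_span (ip_range (A := A) (crossed_ip U)).
have J_sub : lin_subspace J by exact: lin_span_subspace.
have J_mul (a : A) : J `<=` [set b | J (nsd_mul a b) /\ J (nsd_mul b a)].
  apply: lin_span_min => [|_ [xi [eta ->]]].
    split=> [|z u v [u1 u2] [v1 v2]]; split.
    - by have -> : nsd_mul a 0 = 0 by [exact: (cs_mul0r HA)]; exact: J_sub.1.
    - by have -> : nsd_mul 0 a = 0 by [exact: (cs_mul0l HA)]; exact: J_sub.1.
    - have -> : nsd_mul a (z *: u + v) = z *: nsd_mul a u + nsd_mul a v.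
        exact: (sa_mulr HA.1).
      exact: J_sub.2.
    - have -> : nsd_mul (z *: u + v) a = z *: nsd_mul u a + nsd_mul v a.
        exact: (sa_mull HA.1).
      exact: J_sub.2.
  split; apply: lin_span_incl.
    exists (crossed_act U xi (tc_star T a)), eta.
    by rewrite crossed_ip_actl tc_starK.
  by exists xi, (crossed_act U eta a); rewrite crossed_ip_act.
have Na0 (a : A) : 0 <= nsd_norm a by exact: (cn_ge0 N_cstar).
move=> a b _ Jb.
have EL (s : A) : nsd_norm (nsd_mul a b - nsd_mul a s) <= nsd_norm a * nsd_norm (b - s).
  by rewrite -(cs_mulBr HA)//; exact: (cn_submult N_cstar).
have ER (s : A) : nsd_norm (nsd_mul b a - nsd_mul s a) <= nsd_norm a * nsd_norm (b - s).
  by rewrite -(cs_mulBl HA)// mulrC; exact: (cn_submult N_cstar).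
have a1 : 0 < nsd_norm a + 1 by rewrite ltr_wpDl.
have small (s : A) (e : R) : nsd_norm (b - s) < e / (nsd_norm a + 1) ->
    nsd_norm a * nsd_norm (b - s) < e.
  rewrite ltr_pdivlMr// => bs; apply: le_lt_trans bs.
  by rewrite mulrC ler_wpM2l ?lerDl.
split=> e e0; have [s Js bs] := Jb _ (divr_gt0 e0 a1); have [J1 J2] := J_mul a s Js.
  by exists (tc_mul T a s) => //; apply: le_lt_trans (EL s) (small s e bs).
by exists (tc_mul T s a) => //; apply: le_lt_trans (ER s) (small s e bs).
Qed.

End Norm.

End LocalIdeal.

(** * The algebra of adjointable operators *)

Section Subalgebras.
Variables (R : realType) (A : normedStarData R) (S S' : set A).
Hypothesis HS : cstar_algebra_on S.

Lemma cstar_subalgebra : S' `<=` S -> lin_subspace S' ->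
  (forall a b, S' a -> S' b -> S' (nsd_mul a b)) ->
  (forall a, S' a -> S' (nsd_star a)) ->
  norm_closure (@nsd_norm R A) S' `&` S `<=` S' -> cstar_algebra_on S'.
Proof.
move=> sub S'_sub S'M S'S S'cl; have [sa cn] := HS; split; split=> //.
- by move=> a b c /sub Sa /sub Sb /sub Sc; exact: (sa_mulA sa).
- by move=> z a b c /sub Sa /sub Sb /sub Sc; exact: (sa_mull sa).
- by move=> z a b c /sub Sa /sub Sb /sub Sc; exact: (sa_mulr sa).
- by move=> z a b /sub Sa /sub Sb; exact: (sa_star_semilinear sa).
- by move=> a /sub Sa; exact: (sa_starK sa).
- by move=> a b /sub Sa /sub Sb; exact: (sa_starM sa).
- by move=> a /sub Sa; exact: (cn_ge0 cn).
- by move=> a /sub Sa; exact: (cn_eq0 cn).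
- by move=> z a /sub Sa; exact: (cn_scale cn).
- by move=> a b /sub Sa /sub Sb; exact: (cn_triangle cn).
- by move=> a b /sub Sa /sub Sb; exact: (cn_submult cn).
- by move=> a /sub Sa; exact: (cn_cstar cn).
- move=> u Su uC; have [l Sl ul] := cn_complete cn (fun n => sub _ (Su n)) uC.
  exists l => //; apply: S'cl; split=> // e /ul[n0 /(_ n0 (leqnn _)) h].
  by exists (u n0) => //; rewrite (cs_norm_dist HS)//; exact: sub.
Qed.

End Subalgebras.

Section AdjointableOperators.
Variables (R : realType) (X : topologicalType) (E : hilbertModule R X).
Local Notation C := R[i].
Implicit Types (xi eta zeta : E) (k l : E -> E).

Lemma hm_norm_ge0 xi : 0 <= hm_norm xi. Proof. exact: sqrtr_ge0. Qed.

Lemma hm_norm_sq_le xi (M : R) : 0 <= M ->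
  (forall y, cabs (ip_at y xi xi) <= M) -> hm_norm xi ^+ 2 <= M.
Proof.
by move=> M0 h; rewrite /hm_norm sqr_sqrtr ?C0_norm_ge0//; exact: C0_norm_le.
Qed.

Lemma hm_norm0 : hm_norm (0 : E) = 0.
Proof.
apply/eqP; rewrite eq_le hm_norm_ge0 andbT; apply: hm_norm_le => // y.
by rewrite /snorm_at /semi_norm ip_at0 sqrtr0.
Qed.

Lemma hm_norm_eq0 xi : hm_norm xi = 0 -> xi = 0.
Proof.
move=> x0; apply: (rhm_ip_def (hm_ax E)); apply: C0_ext => y.
apply: (si_null (s := fun u v => ip_at y u v)); first exact: hm_semi.
rewrite -(si_norm_sq (hm_semi E y)).
suff -> : semi_norm (ip_at y) xi = 0 by rewrite expr0n.
by apply/eqP; rewrite eq_le sqrtr_ge0 andbT -x0; exact: snorm_at_le.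
Qed.

Lemma hm_normZ (z : C) xi : hm_norm (z *: xi) = cabs z * hm_norm xi.
Proof.
have le (c : C) eta : hm_norm (c *: eta) <= cabs c * hm_norm eta.
  apply: hm_norm_le => [|y]; first by rewrite mulr_ge0 ?cabs_ge0 ?hm_norm_ge0.
  rewrite /snorm_at (si_normZ (hm_semi E y)) ler_wpM2l ?cabs_ge0//.
  exact: snorm_at_le.
have [->|z0] := eqVneq z 0; first by rewrite scale0r cabs0 mul0r hm_norm0.
apply/eqP; rewrite eq_le le /=.
have := le z^-1 (z *: xi); rewrite scalerA mulVf// scale1r => h.
have zz : cabs z * cabs z^-1 = 1 by rewrite -cabsM mulfV// normr1.
by have := ler_wpM2l (cabs_ge0 z) h; rewrite mulrA zz mul1r.
Qed.

Lemma hm_normN xi : hm_norm (- xi) = hm_norm xi.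
Proof. by rewrite -scaleN1r hm_normZ cabsN normr1 mul1r. Qed.

Lemma hm_norm_sum I (r : seq I) (P : pred I) (F : I -> E) :
  hm_norm (\sum_(i <- r | P i) F i) <= \sum_(i <- r | P i) hm_norm (F i).
Proof.
elim/big_ind2: _ => [|a b c d ab cd|//]; first by rewrite hm_norm0.
by apply: le_trans (hm_normD _ _) _; exact: lerD.
Qed.

Lemma adjoint_at k k' : is_adjoint k k' ->
  forall y xi eta, ip_at y (k xi) eta = ip_at y xi (k' eta).
Proof. by move=> kk y xi eta; rewrite /ip_at kk. Qed.

Lemma adjoint_of_at k k' :
  (forall y xi eta, ip_at y (k xi) eta = ip_at y xi (k' eta)) -> is_adjoint k k'.
Proof. by move=> h xi eta; apply: C0_ext => y; exact: h. Qed.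

Lemma adjoint_sym k k' : is_adjoint k k' -> is_adjoint k' k.
Proof.
move=> kk; apply: adjoint_of_at => y xi eta.
by rewrite -ip_at_conj -(adjoint_at kk) ip_at_conj.
Qed.

Lemma adjoint_unique k k1 k2 : is_adjoint k k1 -> is_adjoint k k2 -> k1 = k2.
Proof.
move=> h1 h2; apply/funext => xi; apply: hm_ext => eta y.
by rewrite -(adjoint_at h1) (adjoint_at h2).
Qed.

Lemma op_adj_eq k k' : is_adjoint k k' -> op_adj k = k'.
Proof.
move=> kk; apply: (@adjoint_unique k) => //.
by have : [set k' | is_adjoint k k'] (op_adj k) by apply: xgetPex; exists k'.
Qed.

Lemma adjointable_adj k : adjointable k -> is_adjoint k (op_adj k).
Proof. by move=> [_ [k' kk]]; rewrite (op_adj_eq kk). Qed.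

Lemma adjoint_linear k k' : is_adjoint k k' ->
  forall (z : C) xi eta, k (z *: xi + eta) = z *: k xi + k eta.
Proof.
move=> kk z xi eta; apply: hm_ext => zeta y.
have kk' := adjoint_sym kk.
by rewrite (si_linear (hm_semi E y)) -!(adjoint_at kk') (si_linear (hm_semi E y)).
Qed.

Lemma adjointable_linear k : adjointable k ->
  forall (z : C) xi eta, k (z *: xi + eta) = z *: k xi + k eta.
Proof. by move=> /adjointable_adj; exact: adjoint_linear. Qed.

Lemma adjointable0 k : adjointable k -> k 0 = 0.
Proof.
move=> /adjointable_linear h; have := h 1 0 0; rewrite !scale1r addr0 => e.
by apply: (addrI (k 0)); rewrite addr0 -e.
Qed.

Lemma adjointableZ k : adjointable k -> forall (z : C) xi, k (z *: xi) = z *: k xi.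
Proof.
by move=> ka z xi; rewrite -[z *: xi]addr0 (adjointable_linear ka) (adjointable0 ka) addr0.
Qed.

Lemma op_norm_ub k xi : adjointable k -> hm_norm (k xi) <= op_norm k * hm_norm xi.
Proof.
move=> ka; have [x0|xn] := eqVneq (hm_norm xi) 0.
  by rewrite (hm_norm_eq0 x0) (adjointable0 ka) hm_norm0 mulr0.
have xp : 0 < hm_norm xi by rewrite lt_def xn hm_norm_ge0.
rewrite -ler_pdivrMr//.
pose z : C := (((hm_norm xi)^-1)%:C)%C.
have zE : cabs z = (hm_norm xi)^-1 by rewrite cabs_real// invr_ge0 hm_norm_ge0.
rewrite mulrC -zE -hm_normZ -(adjointableZ ka).
have [[M kM] _] := ka; apply: ub_le_sup.
  exists `|M| => _ [eta /= e1 <-]; apply: le_trans (kM eta) _.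
  apply: le_trans (ler_wpM2r (hm_norm_ge0 eta) (ler_norm M)) _.
  by rewrite ler_piMr.
by exists (z *: xi) => //=; rewrite hm_normZ zE mulVf.
Qed.

Lemma op_norm_le k (M : R) : (forall xi, hm_norm (k xi) <= M * hm_norm xi) ->
  0 <= M -> op_norm k <= M.
Proof.
move=> kM M0; apply: ge_sup; first by exists (hm_norm (k 0)), 0 => //=; rewrite hm_norm0.
move=> _ [xi /= x1 <-]; apply: le_trans (kM xi) _.
by rewrite ler_piMr.
Qed.

Lemma op_norm_ge0 k : adjointable k -> 0 <= op_norm k.
Proof.
move=> ka; have := op_norm_ub 0 ka; have [[M kM] _] := ka.
move=> _; apply: (@le_trans _ _ (hm_norm (k 0))); first exact: hm_norm_ge0.
apply: ub_le_sup; last by exists 0 => //=; rewrite hm_norm0.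
exists `|M| => _ [eta /= e1 <-]; apply: le_trans (kM eta) _.
apply: le_trans (ler_wpM2r (hm_norm_ge0 eta) (ler_norm M)) _.
by rewrite ler_piMr.
Qed.

Lemma adjoint_bounded k k' (M : R) : is_adjoint k k' -> 0 <= M ->
  (forall xi, hm_norm (k xi) <= M * hm_norm xi) ->
  forall xi, hm_norm (k' xi) <= M * hm_norm xi.
Proof.
move=> kk M0 kM xi; have kk' := adjoint_sym kk.
have h : hm_norm (k' xi) ^+ 2 <= M * hm_norm (k' xi) * hm_norm xi.
  apply: hm_norm_sq_le => [|y]; first by rewrite !mulr_ge0// hm_norm_ge0.
  rewrite -(adjoint_at kk); apply: le_trans (cabs_ip_at _ _ _) _.
  by rewrite ler_wpM2r ?hm_norm_ge0.
have [->|n0] := eqVneq (hm_norm (k' xi)) 0; first by rewrite mulr_ge0// hm_norm_ge0.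
have np : 0 < hm_norm (k' xi) by rewrite lt_def n0 hm_norm_ge0.
by rewrite -(ler_pM2l np) -expr2 mulrCA mulrA.
Qed.

Lemma adjoint_adjointable k k' : is_adjoint k k' -> op_bounded k -> adjointable k'.
Proof.
move=> kk [M kM]; split; last by exists k; exact: adjoint_sym.
exists `|M|; apply: (adjoint_bounded kk) => // xi.
by apply: le_trans (kM xi) _; rewrite ler_wpM2r ?hm_norm_ge0// ler_norm.
Qed.

Lemma adjointable_op_adj k : adjointable k -> adjointable (op_adj k).
Proof. by move=> ka; apply: adjoint_adjointable (adjointable_adj ka) ka.1. Qed.

Lemma op_adjK k : adjointable k -> op_adj (op_adj k) = k.
Proof. by move=> ka; apply: op_adj_eq; apply: adjoint_sym; exact: adjointable_adj. Qed.

Lemma op_norm_adj k : adjointable k -> op_norm (op_adj k) = op_norm k.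
Proof.
have le l : adjointable l -> op_norm (op_adj l) <= op_norm l.
  move=> la; apply: op_norm_le; last exact: op_norm_ge0.
  apply: (adjoint_bounded (adjointable_adj la)); first exact: op_norm_ge0.
  by move=> xi; exact: op_norm_ub.
move=> ka; apply/eqP; rewrite eq_le le//=.
by rewrite -{1}(op_adjK ka) le//; exact: adjointable_op_adj.
Qed.

Lemma adjoint_comp k k' l l' : is_adjoint k k' -> is_adjoint l l' ->
  is_adjoint (k \o l) (l' \o k').
Proof. by move=> kk ll xi eta /=; rewrite kk ll. Qed.

Lemma adjointable_comp k l : adjointable k -> adjointable l -> adjointable (k \o l).
Proof.
move=> ka la; split; last first.
  by exists (op_adj l \o op_adj k); apply: adjoint_comp; exact: adjointable_adj.
exists (op_norm k * op_norm l) => xi /=; apply: le_trans (op_norm_ub _ ka) _.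
by rewrite -mulrA ler_wpM2l ?op_norm_ge0// op_norm_ub.
Qed.

Lemma adjoint_lin (z : C) k k' l l' : is_adjoint k k' -> is_adjoint l l' ->
  is_adjoint (z *: (k : E -> E) + l) ((z^* : C) *: (k' : E -> E) + l').
Proof.
move=> kk ll; apply: adjoint_of_at => y xi eta.
have -> : (z *: (k : E -> E) + l) xi = z *: k xi + l xi by [].
have -> : ((z^* : C) *: (k' : E -> E) + l') eta = (z^* : C) *: k' eta + l' eta by [].
rewrite (si_linear (hm_semi E y)) (si_Dl (hm_semi E y)) (si_Zl (hm_semi E y)).
by rewrite (adjoint_at kk) (adjoint_at ll).
Qed.

Lemma adjointable_sub : lin_subspace (V := op_alg E) (@adjointable _ _ E).
Proof.
split.
  split; last first.
    exists 0; apply: adjoint_of_at => y xi eta; transitivity (0 : C).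
      exact: (si_0l (hm_semi E y) eta).
    exact: (esym (si_0r (hm_semi E y) xi)).
  by exists 0 => xi; rewrite mul0r -[(0 : E -> E) xi]/(0 : E) hm_norm0.
move=> z k l ka la; split; last first.
  by exists ((z^* : C) *: op_adj k + op_adj l); apply: adjoint_lin; exact: adjointable_adj.
exists (cabs z * op_norm k + op_norm l) => xi.
have -> : (z *: (k : op_alg E) + l) xi = z *: k xi + l xi by [].
apply: le_trans (hm_normD _ _) _; rewrite hm_normZ mulrDl -mulrA.
by apply: lerD; [rewrite ler_wpM2l ?cabs_ge0// op_norm_ub|exact: op_norm_ub].
Qed.

Lemma adjointable_star_algebra : star_algebra_on (A := op_alg E) (@adjointable _ _ E).
Proof.
split.
- exact: adjointable_sub.
- by move=> a b; exact: adjointable_comp.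
- by move=> a; exact: adjointable_op_adj.
- by [].
- by [].
- move=> z a b c _ _ ca; apply/funext => xi.
  exact: (adjointable_linear ca z (a xi) (b xi)).
- move=> z a b aa ba; apply: op_adj_eq.
  by apply: adjoint_lin; exact: adjointable_adj.
- by move=> a; exact: op_adjK.
- move=> a b aa ba; apply: op_adj_eq.
  by apply: adjoint_comp; exact: adjointable_adj.
Qed.

Lemma op_norm_triangle k l : adjointable k -> adjointable l ->
  op_norm ((k : op_alg E) + l) <= op_norm k + op_norm l.
Proof.
move=> ka la; apply: op_norm_le; last by rewrite addr_ge0// op_norm_ge0.
move=> xi; rewrite mulrDl; apply: le_trans (hm_normD _ _) _.
by apply: lerD; exact: op_norm_ub.
Qed.

(** A Cauchy sequence and the sequence of its adjoints converge pointwise in [E],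
    uniformly on bounded sets, and the two limits are adjoint to each other. *)
Lemma adjointable_complete : norm_complete (V := op_alg E) (@op_norm _ _ E) (@adjointable _ _ E).
Proof.
move=> u ua uC.
have uB m n : adjointable (u m - u n).
  by apply: (lin_subspaceB (V := op_alg E)) => //; exact: adjointable_sub.
have lim (v : nat -> E -> E) : (forall n, adjointable (v n)) ->
    (forall m n, adjointable (v m - v n : op_alg E)) ->
    (forall e : R, 0 < e -> exists n0, forall m n,
       (n0 <= m)%N -> (n0 <= n)%N -> op_norm (v m - v n : op_alg E) < e) ->
    exists k : E -> E, forall e : R, 0 < e -> exists n0, forall n, (n0 <= n)%N ->
      forall xi, hm_norm (v n xi - k xi) <= e * hm_norm xi.
  move=> va vB vC.
  have /choice[k hk] xi : exists x0 : E, forall e : R, 0 < e -> exists n0, forall n,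
      (n0 <= n)%N -> hm_norm (v n xi - x0) < e.
    have [|x0 _ hx0] := @rhm_complete _ _ _ _ _ _ (hm_ax E) (fun n => v n xi) (fun=> I).
      move=> e e0; have x1 : 0 < hm_norm xi + 1 by rewrite ltr_wpDl// hm_norm_ge0.
      have [n0 h] := vC _ (divr_gt0 e0 x1); exists n0 => m n hm hn.
      rewrite -[Num.sqrt _]/(hm_norm ((v m - v n : op_alg E) xi)).
      apply: le_lt_trans (op_norm_ub _ (vB m n)) _.
      have := h m n hm hn; rewrite ltr_pdivlMr//; apply: le_lt_trans.
      by rewrite ler_wpM2l ?op_norm_ge0// lerDl.
    by exists x0.
  exists k => e e0; have [n0 h] := vC _ e0; exists n0 => n hn xi.
  apply/ler_addgt0Pr => d d0; have [n1 h1] := hk xi _ d0.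
  pose m := maxn n0 n1.
  have -> : v n xi - k xi = (v n - v m : op_alg E) xi + (v m xi - k xi).
    by rewrite -[(v n - v m : op_alg E) xi]/(v n xi - v m xi) addrA subrK.
  apply: le_trans (hm_normD _ _) _; apply: lerD; last first.
    by rewrite ltW// h1// leq_maxr.
  apply: le_trans (op_norm_ub _ (vB n m)) _.
  by rewrite ler_wpM2r ?hm_norm_ge0// ltW// h// leq_maxl.
have adjB m n : (op_adj (u m) - op_adj (u n) : op_alg E) = op_adj (u m - u n : op_alg E).
  apply/esym/op_adj_eq.
  have := adjoint_lin (-1) (adjointable_adj (ua n)) (adjointable_adj (ua m)).
  by rewrite rmorphN /= conjC1 !scaleN1r ![- _ + _]addrC.
have [k hk] := lim u ua uB uC.
have [|||k' hk'] := lim (fun n => op_adj (u n)).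
- by move=> n; exact: adjointable_op_adj.
- by move=> m n; rewrite adjB; exact: adjointable_op_adj.
- move=> e /uC[n0 h]; exists n0 => m n hm hn.
  by rewrite adjB op_norm_adj//; exact: h.
have kk : is_adjoint k k'.
  apply: adjoint_of_at => y xi eta; apply/eqP; rewrite -subr_eq0; apply/eqP.
  apply: cabs_eq0; apply/eqP; rewrite eq_le cabs_ge0 andbT.
  apply/ler_addgt0Pr => e e0; rewrite add0r.
  pose c := 2 * hm_norm xi * hm_norm eta + 1.
  have c0 : 0 < c by rewrite ltr_wpDl// !mulr_ge0// hm_norm_ge0.
  have [n1 h1] := hk _ (divr_gt0 e0 c0); have [n2 h2] := hk' _ (divr_gt0 e0 c0).
  pose n := maxn n1 n2.
  have a1 := h1 n (leq_maxl _ _) xi; have a2 := h2 n (leq_maxr _ _) eta.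
  have -> : ip_at y (k xi) eta - ip_at y xi (k' eta) =
     - ip_at y (u n xi - k xi) eta + ip_at y xi (op_adj (u n) eta - k' eta).
    rewrite (si_Bl (hm_semi E y)) (si_Br (hm_semi E y)).
    by rewrite (adjoint_at (adjointable_adj (ua n))); ring.
  apply: le_trans (cabsD _ _) _; rewrite cabsN.
  have b1 := cabs_ip_at y (u n xi - k xi) eta.
  have b2 := cabs_ip_at y xi (op_adj (u n) eta - k' eta).
  have b3 := ler_wpM2r (hm_norm_ge0 eta) a1.
  have b4 := ler_wpM2l (hm_norm_ge0 xi) a2.
  have : e / c * c <= e by rewrite divfK// gt_eqF.
  have : 0 <= e / c by rewrite divr_ge0// ltW.
  rewrite /c; lra.
have ka : adjointable k.
  split; last by exists k'.
  have [n0 /(_ n0 (leqnn _)) h] := hk _ ltr01.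
  exists (op_norm (u n0) + 1) => xi.
  have -> : k xi = u n0 xi - (u n0 xi - k xi) by rewrite opprB addrC subrK.
  apply: le_trans (hm_normD _ _) _; rewrite hm_normN mulrDl.
  by apply: lerD; [exact: op_norm_ub|exact: h].
exists k => // e e0; have e2 : 0 < e / 2 by rewrite divr_gt0.
have [n0 h] := hk _ e2; exists n0 => n /h {}h.
apply: (@le_lt_trans _ _ (e / 2)); last lra.
by apply: op_norm_le => //; exact: ltW.
Qed.

Lemma adjointable_cstar : cstar_algebra_on (A := op_alg E) (@adjointable _ _ E).
Proof.
split; first exact: adjointable_star_algebra.
split.
- by move=> a; exact: op_norm_ge0.
- move=> a aa a0; apply/funext => xi; apply: hm_norm_eq0.
  apply/eqP; rewrite eq_le hm_norm_ge0 andbT.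
  by have := op_norm_ub xi aa; rewrite -[op_norm a]/(nsd_norm (n := op_alg E) a) a0 mul0r.
- have le (z : C) (a : op_alg E) : adjointable a -> op_norm (z *: a) <= cabs z * op_norm a.
    move=> aa; apply: op_norm_le; last by rewrite mulr_ge0 ?cabs_ge0// op_norm_ge0.
    move=> xi; rewrite -[(z *: a) xi]/(z *: a xi) hm_normZ -mulrA.
    by rewrite ler_wpM2l ?cabs_ge0// op_norm_ub.
  move=> z a aa; have [->|z0] := eqVneq z 0.
    apply/eqP; rewrite cabs0 mul0r eq_le; apply/andP; split.
      by have := le 0 a aa; rewrite cabs0 mul0r.
    by rewrite scale0r; apply: op_norm_ge0; exact: adjointable_sub.1.
  apply/eqP; rewrite eq_le le//=.
  have za : adjointable (z *: a).
    by apply: (lin_subspaceZ (V := op_alg E)) => //; exact: adjointable_sub.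
  have := le z^-1 _ za; rewrite scalerA mulVf// scale1r => h.
  have zz : cabs z * cabs z^-1 = 1 by rewrite -cabsM mulfV// normr1.
  by have := ler_wpM2l (cabs_ge0 z) h; rewrite mulrA zz mul1r.
- by move=> a b; exact: op_norm_triangle.
- move=> a b aa ba; apply: op_norm_le; last by rewrite mulr_ge0// op_norm_ge0.
  move=> xi; apply: le_trans (op_norm_ub _ aa) _.
  by rewrite -mulrA ler_wpM2l ?op_norm_ge0// op_norm_ub.
- move=> a aa; have a'a := adjointable_op_adj aa.
  have n0 := op_norm_ge0 aa.
  apply/eqP; rewrite eq_le; apply/andP; split.
    apply: op_norm_le; last exact: exprn_ge0.
    move=> xi; apply: le_trans (op_norm_ub _ a'a) _.
    by rewrite op_norm_adj// expr2 -mulrA ler_wpM2l// op_norm_ub.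
  have ca := adjointable_comp a'a aa; have c0 := op_norm_ge0 ca.
  rewrite -[leLHS]/(op_norm a ^+ 2) -[leRHS]/(op_norm (op_adj a \o a)).
  rewrite -(sqr_sqrtr c0); apply: lerXn2r; rewrite ?nnegrE ?sqrtr_ge0//.
  apply: op_norm_le; last exact: sqrtr_ge0.
  move=> xi; rewrite -(@ler_pXn2r _ 2)// ?nnegrE ?mulr_ge0 ?sqrtr_ge0 ?hm_norm_ge0//.
  rewrite exprMn (sqr_sqrtr c0); apply: hm_norm_sq_le => [|y].
    by rewrite mulr_ge0// exprn_ge0// hm_norm_ge0.
  rewrite (adjoint_at (adjointable_adj aa)); apply: le_trans (cabs_ip_at _ _ _) _.
  rewrite mulrC expr2 mulrA ler_wpM2r ?hm_norm_ge0//.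
  exact: (op_norm_ub xi ca).
- exact: adjointable_complete.
Qed.

End AdjointableOperators.

(** * The fixed-point algebra and the Morita equivalence *)

Section FixedPointAlgebra.
Variables (R : realType) (X : topologicalType) (W : finGroupType).
Variables (T : twisted_action R X W) (E : hilbertModule R X).
Variable U : twisted_module_action T E.
Local Notation C := R[i].
Local Notation act := (ta_act T).
Local Notation gamma := (ta_gamma T).
Local Notation "'U_ w" := (tm_U U w) (at level 8, w at level 2, format "''U_' w").
Local Notation "'V_ w" := (tm_Uinv U w) (at level 8, w at level 2, format "''V_' w").
Local Notation B := (@adjointable R X E : set (op_alg E)).
Local Notation K := (compact_op_fixed U).
Implicit Types (xi eta zeta : E) (k l : op_alg E).

Let HB : cstar_algebra_on B := adjointable_cstar E.

Let finite_rank : set (op_alg E) := lin_span [set k | exists xi eta, k = rank_one xi eta].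

Let finite_rank_sub : lin_subspace finite_rank.
Proof. exact: lin_span_subspace. Qed.

Lemma rank_one_adjoint xi eta : is_adjoint (rank_one xi eta) (rank_one eta xi).
Proof.
apply: adjoint_of_at => y u v; rewrite /rank_one ip_at_act ip_at_actl.
by rewrite -[hm_ip eta u y]/(ip_at y eta u) ip_at_conj mulrC.
Qed.

Lemma rank_one_snorm y xi eta zeta :
  snorm_at y (rank_one xi eta zeta) <= snorm_at y xi * snorm_at y eta * snorm_at y zeta.
Proof.
rewrite /rank_one snorm_act mulrC -mulrA ler_wpM2l ?sqrtr_ge0//.
exact: cabs_ip_snorm.
Qed.

Lemma rank_one_adjointable xi eta : B (rank_one xi eta).
Proof.
split; last by exists (rank_one eta xi); exact: rank_one_adjoint.
exists (hm_norm xi * hm_norm eta) => zeta.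
apply: hm_norm_le => [|y]; first by rewrite !mulr_ge0 ?hm_norm_ge0.
apply: le_trans (rank_one_snorm y _ _ _) _.
by rewrite !ler_pM ?mulr_ge0 ?sqrtr_ge0 ?snorm_at_le.
Qed.

Lemma finite_rank_adjointable : finite_rank `<=` B.
Proof.
apply: lin_span_min; first exact: adjointable_sub.
by move=> _ [xi [eta ->]]; exact: rank_one_adjointable.
Qed.

Let finite_rank_comp k l : finite_rank k -> B l -> finite_rank (k \o l).
Proof.
move=> Fk Bl; apply: (lin_span_min (T := [set k : op_alg E | finite_rank (k \o l)])) Fk.
  split; first exact: finite_rank_sub.1.
  by move=> z a b Fa Fb; exact: (finite_rank_sub.2 z _ _ Fa Fb).
move=> _ [xi [eta ->]]; apply: lin_span_incl; exists xi, (op_adj l eta).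
apply/funext => zeta; rewrite /rank_one /=; congr hm_act.
exact/esym/(adjoint_sym (adjointable_adj Bl)).
Qed.

Let finite_rank_star k : finite_rank k -> finite_rank (op_adj k).
Proof.
move=> Fk; suff : [set l : op_alg E | B l /\ finite_rank (op_adj l)] k by case.
apply: lin_span_min Fk => [|_ [xi [eta ->]]].
  split=> [|z a b [Ba Fa] [Bb Fb]].
    split; first exact: (adjointable_sub E).1.
    rewrite -[op_adj 0]/(nsd_star (n := op_alg E) 0) (cs_star0 HB); exact: finite_rank_sub.1.
  split; first exact: (adjointable_sub E).2.
  have -> : op_adj (z *: a + b) = (z^* : C) *: (op_adj a : op_alg E) + op_adj b.
    exact: (sa_star_semilinear HB.1 z Ba Bb).
  exact: finite_rank_sub.2.
split; first exact: rank_one_adjointable.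
rewrite (op_adj_eq (rank_one_adjoint xi eta)).
by apply: lin_span_incl; exists eta, xi.
Qed.

Local Notation compact_ops := (@compact_op R X E : set (op_alg E)).

Let compact_sub : lin_subspace compact_ops.
Proof.
split.
  split; first exact: (adjointable_sub E).1.
  move=> e e0; exists 0; first exact: finite_rank_sub.1.
  by rewrite subrr [op_norm _](cs_norm0 HB).
move=> z k l [Bk ck] [Bl cl]; split; first exact: (adjointable_sub E).2.
move=> e e0; have z1 : 0 < cabs z + 1 by rewrite ltr_wpDl// cabs_ge0.
have e2 : 0 < e / 2 by rewrite divr_gt0.
have [k' Fk' hk] := ck _ (divr_gt0 e2 z1); have [l' Fl' hl] := cl _ e2.
exists (z *: k' + l'); first exact: finite_rank_sub.2.
have Bk' := finite_rank_adjointable Fk'; have Bl' := finite_rank_adjointable Fl'.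
have Bkk : B (k - k') by exact: (csB HB).
have -> : z *: k + l - (z *: k' + l') = z *: (k - k') + (l - l').
  by rewrite opprD addrACA scalerBr.
have Bz := csZ HB z Bkk; have Bll : B (l - l') by exact: (csB HB).
apply: le_lt_trans (op_norm_triangle Bz Bll) _.
have -> : op_norm (z *: (k - k')) = cabs z * op_norm (k - k') by exact: (cn_scale HB.2).
have : op_norm (k - k') * (cabs z + 1) < e / 2 by rewrite -ltr_pdivlMr.
have := op_norm_ge0 Bkk; rewrite -[op_norm (l - l')]/(nsd_norm (l - l')) /=; lra.
Qed.

Let compact_comp k l : compact_ops k -> B l -> compact_ops (k \o l).
Proof.
move=> [Bk ck] Bl; split; first exact: adjointable_comp.
move=> e e0; have l1 : 0 < op_norm l + 1 by rewrite ltr_wpDl// op_norm_ge0.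
have [k' Fk' hk] := ck _ (divr_gt0 e0 l1).
exists (k' \o l); first exact: finite_rank_comp.
have Bkk : B (k - k') by apply: (csB HB) => //; exact: finite_rank_adjointable.
apply: le_lt_trans (cn_submult HB.2 Bkk Bl) _.
move: hk; rewrite ltr_pdivlMr//; apply: le_lt_trans.
by rewrite ler_wpM2l ?op_norm_ge0// lerDl.
Qed.

Let compact_star k : compact_ops k -> compact_ops (op_adj k).
Proof.
move=> [Bk ck]; split; first exact: adjointable_op_adj.
move=> e /ck[k' Fk' hk]; exists (op_adj k'); first exact: finite_rank_star.
have Bk' := finite_rank_adjointable Fk'.
have -> : (op_adj k : op_alg E) - op_adj k' = op_adj (k - k') by exact/esym/(cs_starB HB).
by rewrite op_norm_adj//; exact: (csB HB).
Qed.

Let compact_closed : norm_closure (@op_norm R X E) compact_ops `&` B `<=` compact_ops.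
Proof.
move=> k [ck Bk]; split=> // e e0; have e2 : 0 < e / 2 by rewrite divr_gt0.
have [k1 [Bk1 ck1] h1] := ck _ e2; have [k2 Fk2 h2] := ck1 _ e2.
exists k2 => //; have Bk2 := finite_rank_adjointable Fk2.
have -> : k - k2 = (k - k1) + (k1 - k2) by rewrite addrA subrK.
apply: le_lt_trans (cn_triangle HB.2 _ _) _; [exact: (csB HB)|exact: (csB HB)|].
by rewrite [ltRHS](splitr e); exact: ltrD.
Qed.

Lemma hm_norm_V w xi : hm_norm ('V_w xi) <= hm_norm xi.
Proof.
apply: hm_norm_le => [|y]; first exact: sqrtr_ge0.
by rewrite -[y](ta_actV T w) -(snorm_U U) tm_UVK snorm_at_le.
Qed.

Lemma compact_op_fixed_cstar : cstar_algebra_on (A := op_alg E) K.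
Proof.
apply: (cstar_subalgebra HB).
- by move=> k [[]].
- split.
    split; first exact: compact_sub.1.
    by move=> w xi; exact: tm_U0.
  move=> z k l [ck fk] [cl fl]; split; first exact: compact_sub.2.
  move=> w xi; rewrite -[(z *: k + l) xi]/(z *: k xi + l xi) tm_linear fk fl.
  by [].
- move=> k l [ck fk] [cl fl]; split; first by apply: compact_comp => //; exact: cl.1.
  by move=> w xi /=; rewrite fk fl.
- move=> k [ck fk]; split; first exact: compact_star.
  have kk := adjoint_sym (adjointable_adj ck.1).
  move=> w xi; apply: hm_ext => zeta y.
  rewrite -[zeta](tm_UVK U w) ip_U -!(adjoint_at (adjointable_adj ck.1)).
  by rewrite -fk ip_U.
- move=> k [ck Bk]; split.
    by apply: compact_closed; split=> // e /ck[l [cl _] h]; exists l.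
  move=> w xi; apply/eqP; rewrite -subr_eq0; apply/eqP; apply: hm_norm_eq0.
  apply/eqP; rewrite eq_le hm_norm_ge0 andbT; apply/ler_addgt0Pr => e e0; rewrite add0r.
  have x1 : 0 < 2 * hm_norm xi + 1 by rewrite ltr_wpDl// mulr_ge0// hm_norm_ge0.
  have [l [[Bl _] fl] h] := ck _ (divr_gt0 e0 x1).
  have Bkl : B (k - l) by exact: (csB HB).
  have -> : 'U_w (k xi) - k ('U_w xi) = 'U_w ((k - l) xi) - (k - l) ('U_w xi).
    rewrite -[(k - l) xi]/(k xi - l xi) -[(k - l) ('U_w xi)]/(k ('U_w xi) - l ('U_w xi)).
    have -> : 'U_w (k xi - l xi) = 'U_w (k xi) - 'U_w (l xi).
      by rewrite tm_UD -scaleN1r tm_UZ scaleN1r.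
    by rewrite fl opprB addrA subrK.
  apply: le_trans (hm_normD _ _) _; rewrite hm_normN.
  have a1 := le_trans (hm_norm_U U w ((k - l) xi)) (op_norm_ub xi Bkl).
  have a2 := op_norm_ub ('U_w xi) Bkl.
  have a3 := ler_wpM2l (op_norm_ge0 Bkl) (hm_norm_U U w xi).
  have : op_norm (k - l) * (2 * hm_norm xi + 1) < e by rewrite -ltr_pdivlMr.
  have := op_norm_ge0 Bkl; lra.
Qed.

Lemma compact_fixed_adjointable k : K k -> adjointable k.
Proof. by move=> [[]]. Qed.

(** The left inner product, in the form forced by [ib_assoc]. *)
Definition fixed_ip xi eta : op_alg E :=
  fun zeta => crossed_act U xi (crossed_ip U eta zeta).

Lemma fixed_ip_average xi eta zeta :
  fixed_ip xi eta zeta = \sum_w 'V_w (rank_one xi eta ('U_w zeta)).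
Proof. by apply: eq_bigr => w _; rewrite /crossed_ip ffunE. Qed.

Lemma ip_Vl w y xi eta : ip_at y ('V_w xi) eta = ip_at (act w y) xi ('U_w eta).
Proof. by rewrite -ip_at_conj ip_V ip_at_conj. Qed.

Lemma fixed_ip_rank_one xi eta : fixed_ip xi eta = \sum_w rank_one ('V_w xi) ('V_w eta).
Proof.
apply/funext => zeta; rewrite fct_sumE fixed_ip_average; apply: eq_bigr => w _.
apply: hm_ext => u y; rewrite ip_V /rank_one !ip_at_act -ip_V.
rewrite -[hm_ip eta _ _]/(ip_at (act w y) eta ('U_w zeta)).
by rewrite -[hm_ip ('V_w eta) _ _]/(ip_at y ('V_w eta) zeta) ip_Vl.
Qed.

Lemma fixed_ip_adjoint xi eta : is_adjoint (fixed_ip xi eta) (fixed_ip eta xi).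
Proof.
apply: adjoint_of_at => y u v.
by rewrite -!(crossed_ip1 U) !crossed_ip_act crossed_ip_actl crossed_ip_star.
Qed.

Lemma fixed_ip_finite_rank xi eta : finite_rank (fixed_ip xi eta).
Proof.
rewrite fixed_ip_rank_one; apply: (lin_subspace_sum (V := op_alg E)) => // w _.
by apply: lin_span_incl; exists ('V_w xi), ('V_w eta).
Qed.

Lemma fixed_ip_commute xi eta w zeta :
  'U_w (fixed_ip xi eta zeta) = fixed_ip xi eta ('U_w zeta).
Proof.
apply: hm_ext => u y.
rewrite -{1}[u](tm_UVK U w) ip_U !fixed_ip_average !(si_sumr (hm_semi E _)).
rewrite (reindex_inj (mulIg w)) /=; apply: eq_bigr => v _.
rewrite !ip_V /rank_one !ip_at_act ta_actM ta_actVr.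
rewrite -[hm_ip eta _ _]/(ip_at (act v y) eta ('U_(v * w)%g zeta)).
rewrite -[hm_ip eta _ _ in RHS]/(ip_at (act v y) eta ('U_v ('U_w zeta))).
rewrite ip_UU -{2}[u](tm_UVK U w) ip_UUl.
rewrite [RHS]mulrACA gamma_mulJ mul1r.
by [].
Qed.

Lemma fixed_ip_in xi eta : K (fixed_ip xi eta).
Proof.
split; last by move=> w zeta; exact: fixed_ip_commute.
have F := fixed_ip_finite_rank xi eta; split; first exact: finite_rank_adjointable.
move=> e e0; exists (fixed_ip xi eta) => //.
by rewrite subrr [op_norm _](cs_norm0 HB).
Qed.

Lemma fixed_ip_quadratic y xi u : ip_at y u (fixed_ip xi xi u) =
  \sum_w (ip_at y ('V_w xi) u : C)^* * ip_at y ('V_w xi) u.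
Proof.
rewrite fixed_ip_rank_one fct_sumE (si_sumr (hm_semi E y)); apply: eq_bigr => w _.
by rewrite /rank_one ip_at_act ip_at_conj.
Qed.

Lemma fixed_ip_snorm y xi eta u : snorm_at y (fixed_ip xi eta u) <=
  #|W|%:R * (hm_norm xi * hm_norm eta) * snorm_at y u.
Proof.
rewrite fixed_ip_rank_one fct_sumE.
have h : snorm_at y (\sum_w rank_one ('V_w xi) ('V_w eta) u) <=
    \sum_w snorm_at y (rank_one ('V_w xi) ('V_w eta) u).
  elim/big_ind2: _ => [|a b c d ab cd|//].
    by rewrite /snorm_at /semi_norm ip_at0 sqrtr0.
  by apply: le_trans (si_normD (hm_semi E y) _ _) _; exact: lerD.
apply: le_trans h _.
rewrite -sum1_card natr_sum !mulr_suml; apply: ler_sum => w _; rewrite mul1r.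
apply: le_trans (rank_one_snorm y _ _ _) _; rewrite ler_wpM2r ?sqrtr_ge0//.
apply: ler_pM; rewrite ?sqrtr_ge0//.
  exact: le_trans (snorm_at_le _ _) (hm_norm_V _ _).
exact: le_trans (snorm_at_le _ _) (hm_norm_V _ _).
Qed.

Lemma fixed_ip_op_norm xi : op_norm (fixed_ip xi xi) <= #|W|%:R * hm_norm xi ^+ 2.
Proof.
apply: op_norm_le; last by rewrite mulr_ge0// exprn_ge0// hm_norm_ge0.
move=> u; apply: hm_norm_le => [|y].
  by rewrite !mulr_ge0 ?exprn_ge0 ?hm_norm_ge0.
apply: le_trans (fixed_ip_snorm y xi xi u) _; rewrite -expr2 ler_wpM2l ?snorm_at_le//.
by rewrite mulr_ge0// exprn_ge0// hm_norm_ge0.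
Qed.

Lemma tm_V1 xi : 'V_1%g xi = xi.
Proof. by rewrite -{1}[xi](tm_U1 U) tm_UK. Qed.

Lemma fixed_ip_lower y xi :
  (cabs (ip_at y xi xi) ^+ 2)%:C%C <= ip_at y xi (fixed_ip xi xi xi).
Proof.
rewrite fixed_ip_quadratic (bigD1 1%g)//= tm_V1 cabs_sq lerDl sumr_ge0// => w _.
by rewrite mulrC mul_conjC_ge0.
Qed.

(** With [l] the left inner product of [xi] with itself,
    [<xi|xi>^2 <= <xi|l xi> <= |l| |xi|^2] at each point of [X]. *)
Lemma fixed_ip_norm_ge xi : hm_norm xi <= Num.sqrt (op_norm (fixed_ip xi xi)).
Proof.
have Ba := compact_fixed_adjointable (fixed_ip_in xi xi).
have p0 := op_norm_ge0 Ba; set p := op_norm _ in p0 *.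
have h : (hm_norm xi ^+ 2) ^+ 2 <= p * hm_norm xi ^+ 2.
  have q0 : 0 <= p * hm_norm xi ^+ 2 by rewrite mulr_ge0// exprn_ge0// hm_norm_ge0.
  rewrite -(sqr_sqrtr q0); apply: lerXn2r; rewrite ?nnegrE ?sqrtr_ge0 ?exprn_ge0 ?hm_norm_ge0//.
  apply: hm_norm_sq_le => [|y]; first exact: sqrtr_ge0.
  rewrite -[cabs _]ger0_norm ?cabs_ge0// -sqrtr_sqr ler_wsqrtr//.
  have := fixed_ip_lower y xi; rewrite (ge0_ReE (le_trans _ (fixed_ip_lower y xi))); last first.
    by rewrite ler0c exprn_ge0// cabs_ge0.
  rewrite lecR => /le_trans; apply.
  apply: (@le_trans _ _ (cabs (ip_at y xi (fixed_ip xi xi xi)))).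
    by rewrite -lecR -cabsE; apply: le_trans (normc_ge_Re _); rewrite lecR ler_norm.
  apply: le_trans (cabs_ip_at _ _ _) _; rewrite expr2 mulrA [leRHS]mulrC.
  by rewrite ler_wpM2l ?hm_norm_ge0// op_norm_ub.
have n0 := hm_norm_ge0 xi.
rewrite -[leLHS]ger0_norm// -sqrtr_sqr ler_wsqrtr//.
have [->|n1] := eqVneq (hm_norm xi ^+ 2) 0; first by [].
have np : 0 < hm_norm xi ^+ 2 by rewrite lt_def n1 exprn_ge0.
by rewrite -(ler_pM2r np) -expr2.
Qed.

Lemma fixed_ip_complete :
  norm_complete (fun xi : E => Num.sqrt (op_norm (fixed_ip xi xi))) setT.
Proof.
move=> u _ uC.
have [|x0 _ hx0] := @rhm_complete _ _ _ _ _ _ (hm_ax E) u (fun=> I).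
  move=> e /uC[n0 h]; exists n0 => m n hm hn; apply: le_lt_trans (h m n hm hn).
  exact: fixed_ip_norm_ge.
exists x0 => // e e0.
have W1 : 0 < Num.sqrt (#|W|%:R + 1 : R) by rewrite sqrtr_gt0 ltr_wpDl.
have [n0 h] := hx0 _ (divr_gt0 e0 W1); exists n0 => n /h.
rewrite -[Num.sqrt _ in X in X -> _]/(hm_norm (u n - x0)); set d := u n - x0 => dn.
have d0 : 0 <= hm_norm d by exact: sqrtr_ge0.
apply: (@le_lt_trans _ _ (Num.sqrt (#|W|%:R + 1) * hm_norm d)).
  rewrite -[X in _ * X]ger0_norm// -sqrtr_sqr -sqrtrM ?addr_ge0//; apply: ler_wsqrtr.
  apply: le_trans (fixed_ip_op_norm d) _; rewrite ler_wpM2r ?exprn_ge0//.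
  by rewrite lerDl.
by rewrite mulrC -ltr_pdivlMr.
Qed.

Lemma fixed_ip_positive xi : positive_in (A := op_alg E) K (fixed_ip xi xi).
Proof.
apply: (@positive_in_of_forms R (op_alg E) K compact_op_fixed_cstar E X
  (fun y => ip_at y) (fun k v => k v) (hm_semi E) _ _ _ 1 ler01 _ _
  (#|W|%:R * (hm_norm xi * hm_norm xi))).
- by move=> z k u v /compact_fixed_adjointable/adjointable_linear.
- by [].
- by [].
- move=> k e _ e0 h; rewrite mul1r; apply: op_norm_le => // u.
  apply: hm_norm_le => [|y]; first by rewrite mulr_ge0// hm_norm_ge0.
  by apply: le_trans (h y u) _; rewrite ler_wpM2l// snorm_at_le.
- exact: fixed_ip_in.
- exact: (op_adj_eq (fixed_ip_adjoint xi xi)).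
- by move=> y u v; exact: (adjoint_at (fixed_ip_adjoint xi xi)).
- move=> y u; rewrite fixed_ip_quadratic sumr_ge0// => w _.
  by rewrite mulrC mul_conjC_ge0.
- by rewrite !mulr_ge0 ?hm_norm_ge0.
- by move=> y u; exact: fixed_ip_snorm.
Qed.

Lemma crossed_act_fixed k xi (f : {ffun W -> C0 R X}) : K k ->
  crossed_act U (k xi) f = k (crossed_act U xi f).
Proof.
move=> Kk; have ka' := adjoint_sym (adjointable_adj (compact_fixed_adjointable Kk)).
have [_ fk'] : K (op_adj k) := sa_star_in compact_op_fixed_cstar.1 Kk.
apply: hm_ext => zeta y; rewrite -(adjoint_at ka') !ip_crossed_act.
by apply: eq_bigr => w _; rewrite fk' (adjoint_at ka').
Qed.

Lemma fixed_left_hilbert :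
  left_hilbert_module (A := op_alg E) K (fun k xi => k xi) fixed_ip.
Proof.
split.
- by move=> z x y k /compact_fixed_adjointable/adjointable_linear.
- by [].
- by [].
- exact: fixed_ip_in.
- by move=> z x x' y; apply/funext => u; exact: crossed_act_linearl.
- by move=> x y k Kk; apply/funext => u; exact: crossed_act_fixed.
- by move=> x y; exact: (op_adj_eq (fixed_ip_adjoint x y)).
- exact: fixed_ip_positive.
- move=> x x0; apply: (rhm_ip_def (hm_ax E)); apply: C0_ext => y.
  have := fixed_ip_lower y x; rewrite x0 -[(0 : op_alg E) x]/(0 : E) ip_at0.
  rewrite -[0]/((0 : R)%:C%C) lecR => h.
  by apply: cabs_eq0; apply/eqP; rewrite -sqrf_eq0 eq_le h exprn_ge0// cabs_ge0.
- exact: fixed_ip_complete.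
Qed.

(** The conditional expectation onto the operators that commute with [U]. *)
Definition average (d : op_alg E) : op_alg E :=
  fun xi => ((#|W|%:R : C)^-1) *: \sum_w 'V_w (d ('U_w xi)).

Lemma averageE (d : op_alg E) xi :
  average d xi = ((#|W|%:R : C)^-1) *: \sum_w 'V_w (d ('U_w xi)).
Proof. by []. Qed.

Let W_neq0 : (#|W|%:R : C) != 0.
Proof. by rewrite pnatr_eq0 -lt0n; apply/card_gt0P; exists 1%g. Qed.

Lemma average_linear (z : C) (k l : op_alg E) :
  average (z *: k + l) = z *: average k + average l.
Proof.
apply/funext => xi.
have lin (a b : C) (u v : E) : a *: (b *: u + v) = b *: (a *: u) + a *: v.
  by rewrite scalerDr !scalerA mulrC.
transitivity ((#|W|%:R : C)^-1 *:
    (z *: (\sum_w 'V_w (k ('U_w xi))) + \sum_w 'V_w (l ('U_w xi)))).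
  rewrite averageE; congr (_ *: _); rewrite scaler_sumr -big_split /=; apply: eq_bigr => w _.
  by rewrite -[(z *: k + l) _]/(z *: k ('U_w xi) + l ('U_w xi)) tm_V_linear.
exact: lin.
Qed.

Lemma average_fixed k : K k -> average k = k.
Proof.
move=> [_ fk]; apply/funext => xi; rewrite averageE.
under eq_bigr do rewrite -fk tm_UK.
by rewrite sumr_const -[k xi *+ _]scaler_nat scalerA mulVf ?W_neq0// scale1r.
Qed.

Lemma average_bound (d : op_alg E) (M : R) : 0 <= M ->
  (forall xi, hm_norm (d xi) <= M * hm_norm xi) -> op_norm (average d) <= M.
Proof.
move=> M0 dM; apply: op_norm_le => // xi.
rewrite averageE hm_normZ.
have -> : cabs ((#|W|%:R : C)^-1) = (#|W|%:R : R)^-1.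
  have -> : (#|W|%:R : C)^-1 = (((#|W|%:R : R)^-1)%:C)%C by rewrite fmorphV rmorph_nat.
  by rewrite cabs_real// invr_ge0.
have W0 : 0 < (#|W|%:R : R) by rewrite ltr0n; apply/card_gt0P; exists 1%g.
rewrite ler_pdivrMl//; apply: le_trans (hm_norm_sum _ _ _) _.
rewrite -sum1_card natr_sum mulr_suml; apply: ler_sum => w _; rewrite mul1r.
apply: le_trans (hm_norm_V _ _) _; apply: le_trans (dM _) _.
by rewrite ler_wpM2l// hm_norm_U.
Qed.

(** The average of a rank one operator is a multiple of a left inner product. *)
Lemma fixed_full : full (A := op_alg E) K fixed_ip.
Proof.
move=> k Kk e e0; have [[Bk ck] _] := Kk.
have [s Fs ks] := ck e e0.
have Bs := finite_rank_adjointable Fs; have Bks : B (k - s) by exact: (csB HB).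
exists (average s).
  pose Z : set (op_alg E) := lin_span (ip_range (A := op_alg E) fixed_ip).
  have Z_sub : lin_subspace Z by exact: lin_span_subspace.
  suff : [set l : op_alg E | Z (average l)] s by [].
  apply: lin_span_min Fs => [|_ [xi [eta ->]]].
    split=> [|z a b Za Zb].
      suff : Z (average 0) by [].
      have := average_linear (-1) 0 0; rewrite scaler0 addr0 scaleN1r addNr => ->.
      exact: Z_sub.1.
    suff : Z (average (z *: a + b)) by [].
    by rewrite average_linear; exact: Z_sub.2.
  suff : Z (average (rank_one xi eta)) by [].
  have -> : average (rank_one xi eta) = ((#|W|%:R : C)^-1) *: (fixed_ip xi eta : op_alg E).
    by apply/funext => u; rewrite averageE -fixed_ip_average.
  apply: lin_subspaceZ => //; apply: lin_span_incl; by exists xi, eta.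
apply: le_lt_trans ks.
have -> : k - average s = average (k - s).
  by rewrite -{1}(average_fixed Kk) addrC -scaleN1r -average_linear scaleN1r addrC.
by apply: average_bound => [|u]; [exact: op_norm_ge0|exact: op_norm_ub].
Qed.

End FixedPointAlgebra.

Section Morita.
Variables (R : realType) (X : topologicalType) (W : finGroupType).
Variables (T : twisted_action R X W) (E : hilbertModule R X).
Variables (U : twisted_module_action T E) (N : twisted_crossed R X W -> R).
Hypothesis N_cstar : @cstar_norm_on R (tc_alg T N) setT.
Local Notation A := (tc_alg T N).
Local Notation J := (inner_product_span U N).

Lemma closed_ideal_cstar : @closed_ideal R A setT J -> cstar_algebra_on (A := A) J.
Proof.
move=> [J_sub _ J_cl J_mul]; have HA := tc_cstar N_cstar.
apply: (cstar_subalgebra HA) => //.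
- by move=> a b Ja Jb; have [] := J_mul a b I Jb.
- have star_span (s : A) : lin_span (ip_range (A := A) (crossed_ip U)) s ->
      lin_span (ip_range (A := A) (crossed_ip U)) (nsd_star s).
    move=> Js.
    suff : [set s : A | lin_span (ip_range (A := A) (crossed_ip U)) (nsd_star s)] s by [].
    apply: lin_span_min Js => [|_ [xi [eta ->]]].
      split=> [|z b c Jb Jc].
        suff : lin_span (ip_range (A := A) (crossed_ip U)) (nsd_star (0 : A)) by [].
        by rewrite (cs_star0 HA); exact: (lin_span_subspace _).1.
      suff : lin_span (ip_range (A := A) (crossed_ip U)) (nsd_star (z *: b + c)) by [].
      by rewrite (sa_star_semilinear HA.1)//; exact: (lin_span_subspace _).2.
    by apply: lin_span_incl; exists eta, xi; exact: crossed_ip_star.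
  have star_dist (a b : A) : nsd_norm (nsd_star a - nsd_star b) = nsd_norm (a - b).
    by rewrite -(cs_starB HA)// (cs_norm_star HA).
  move=> a Ja e /Ja[s Js as_e]; exists (tc_star T s); first exact: star_span.
  by apply: le_lt_trans as_e; rewrite le_eqVlt; apply/orP; left; apply/eqP; exact: star_dist.
Qed.

Lemma morita_equivalence : @closed_ideal R A setT J -> implements_morita_equivalence U J.
Proof.
move=> J_ideal; have HJ := closed_ideal_cstar J_ideal.
have Jip xi eta : J (crossed_ip U xi eta).
  move=> e e0; exists (crossed_ip U xi eta).
    by apply: lin_span_incl; exists xi, eta.
  by rewrite subrr [N _](cs_norm0 (tc_cstar N_cstar)).
exists (fixed_ip U); split.
- exact: compact_op_fixed_cstar.
- exact: HJ.
- exact: fixed_left_hilbert.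
- exact: crossed_right_hilbert.
- exact: fixed_full.
- by [].
- by move=> k x f Kk _; exact: crossed_act_fixed.
- move=> k x y Kk; apply: tc_ext => w p.
  have [_ fk'] : compact_op_fixed U (op_adj k) := sa_star_in (compact_op_fixed_cstar U).1 Kk.
  have ka := adjointable_adj (compact_fixed_adjointable Kk).
  by rewrite !crossed_ipE (adjoint_at ka) fk'.
- move=> f x y _; apply/funext => z.
  by rewrite /fixed_ip -crossed_actM crossed_ip_actl tc_starK.
- by [].
Qed.

End Morita.

Theorem theorem2p29 (R : realType) (X : topologicalType) (W : finGroupType)
    (T : twisted_action R X W) (E : hilbertModule R X)
    (U : twisted_module_action T E) (N : twisted_crossed R X W -> R)
    (X_hausdorff : hausdorff_space X)
    (X_locally_compact : locally_compact [set: X])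
    (N_cstar : @cstar_norm_on R (tc_alg T N) setT)
    (fibre_neq0 : forall x : X, exists h : fibre E x, h <> 0)
    (U_complete : completeness_condition U) :
  [/\ inner_product_span U N = local_ideal U,
      @closed_ideal R (tc_alg T N) setT (inner_product_span U N) &
      implements_morita_equivalence U (inner_product_span U N)].
Proof.
have ideal : @closed_ideal R (tc_alg T N) setT (inner_product_span U N).
  exact: inner_product_span_ideal.
split=> //; first exact: inner_product_span_local.
exact: morita_equivalence.
Qed.
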